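(* Let $A$ be an $(n-2)\times n$ integer matrix of rank $n-2$ with columns $a_1,\dots,a_n$ such that some $w\in\mathbb Q^{n-2}$ satisfies $w\cdot a_i=1$ for all $i$, and let $B$ be an $n\times2$ integer matrix with rows $b_1,\dots,b_n$ whose columns form a $\mathbb Z$-basis of $\ker_{\mathbb Z}(A)$. Let $d_B$ be the degree of the toric variety $X_B$, and let $\Sigma(A)$ be the Newton polytope of the full discriminant $E_A$ (the secondary polytope of $A$). Then $\Sigma(A)$ is the image of the polygon $P_B$ under the affine isomorphism $v\mapsto (d_B-v^{(1)},\dots,d_B-v^{(n)})$.
   Context: $X_B\subset\mathbf P^{n-1}$ is defined by the ideal generated by all binomials $x^{u_+}-x^{u_-}$ with $u=u_+-u_-\in\ker_{\mathbb Z}(A)$; $d_B$ is its degree (the number of points in its intersection with a generic 2-plane). Dual Chow form: with $Y=(y_{i\ell})$ an $n\times2$ matrix of indeterminates, $\tilde{\mathcal C}_B$ is the irreducible polynomial in $\mathbb Z[y_{i\ell}]$ (unique up to sign) vanishing exactly when the line $\{(y_{11}+ty_{12}:\cdots:y_{n1}+ty_{n2})\}$ meets $X_B$; it is a polynomial of degree $d_B$ in the brackets $[\,i\,j\,]=y_{i1}y_{j2}-y_{i2}y_{j1}$. For an $(n-2)\times n$ matrix of indeterminates $Z=(z_{ij})$, let $\langle i\,j\rangle=\pm\det Z\langle i,j\rangle$ (omit columns $i,j$), with signs chosen so that $\pm\det A\langle i,j\rangle$ is proportional, with a constant independent of $i,j$, to the $2\times2$ minor of $B$ on rows $i,j$.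 Replacing $[\,i\,j\,]$ by $\langle i\,j\rangle$ in $\tilde{\mathcal C}_B$ gives the primal Chow form $\mathcal C_A$, and $E_A$ is the image of $\mathcal C_A$ under $z_{ij}\mapsto a_{ij}x_j$. The Newton polytope of a polynomial is the convex hull in $\mathbb R^n$ of the exponent vectors of its monomials. For $b,u\in\mathbb R^2$ write $\det(b,u)=b_1u_2-b_2u_1$. $P_B$ is the lattice polygon (unique up to translation) whose boundary, traversed counterclockwise, consists of the nonzero rows of $B$ as directed edges taken in counterclockwise cyclic order of their directions. For each $i$ let $\mu_i=\max\{\det(b_i,u):u\in P_B\}$, and for $v\in P_B$ let $v^{(i)}=\mu_i-\det(b_i,v)$. *)

(* Defs.v *)
From HB Require Import structures.
From mathcomp Require Import all_boot all_order all_algebra all_field.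
From mathcomp Require Import mpoly.
Set Implicit Arguments. Unset Strict Implicit. Unset Printing Implicit Defensive.
Import Order.TTheory GRing.Theory Num.Theory.
Local Open Scope ring_scope.

Definition in_kerZ (k n : nat) (A : 'M[int]_(k, n)) (u : 'cV[int]_n) : Prop :=
  A *m u = 0.

Definition Zbasis_of_ker (k n : nat) (A : 'M[int]_(k, n)) (B : 'M[int]_(n, 2)) : Prop :=
  A *m B = 0 /\
  (forall u : 'cV[int]_n, in_kerZ A u -> exists c : 'cV[int]_2, u = B *m c) /\
  (forall c : 'cV[int]_2, B *m c = 0 -> c = 0).

Definition upos n (u : 'cV[int]_n) (i : 'I_n) : nat := absz (Num.max (u i 0) 0).
Definition uneg n (u : 'cV[int]_n) (i : 'I_n) : nat := absz (Num.max (- u i 0) 0).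

Definition in_cone_XB (k n : nat) (A : 'M[int]_(k, n)) (x : 'cV[algC]_n) : Prop :=
  forall u : 'cV[int]_n, in_kerZ A u ->
    \prod_(i < n) x i 0 ^+ upos u i = \prod_(i < n) x i 0 ^+ uneg u i.

Definition proportional n (x y : 'cV[algC]_n) : Prop :=
  exists c : algC, x = c *: y.

(* the 2-plane P(colspace M) (M of rank 3) meets X_B in exactly d points *)
Definition meets_in_exactly (k n : nat) (A : 'M[int]_(k, n))
    (M : 'M[algC]_(n, 3)) (d : nat) : Prop :=
  exists pts : d.-tuple 'cV[algC]_n,
    (forall a : 'I_d, tnth pts a != 0 /\ in_cone_XB A (tnth pts a) /\
        exists t : 'cV[algC]_3, tnth pts a = M *m t) /\
    (forall a b : 'I_d, proportional (tnth pts a) (tnth pts b) -> a = b) /\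
    (forall x : 'cV[algC]_n, x != 0 -> in_cone_XB A x ->
        (exists t : 'cV[algC]_3, x = M *m t) ->
        exists a : 'I_d, proportional x (tnth pts a)).

(* d is the degree of X_B: a generic 2-plane (outside the zero set of a
   nonzero polynomial in the entries of a 3-frame M) meets X_B in d points *)
Definition is_degree_XB (k n : nat) (A : 'M[int]_(k, n)) (d : nat) : Prop :=
  exists h : {mpoly algC[n * 3]}, h != 0 /\
    forall M : 'M[algC]_(n, 3), h.@[fun l => mxvec M 0 l] != 0 ->
      \rank M = 3%N /\ meets_in_exactly A M d.

Definition mirreducible (N : nat) (p : {mpoly int[N]}) : Prop :=
  p != 0 /\ p \isn't a GRing.unit /\
  forall q r : {mpoly int[N]}, p = q * r -> q \is a GRing.unit \/ r \is a GRing.unit.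

Definition y_var (n : nat) (i : 'I_n) (l : 'I_2) : {mpoly int[n * 2]} :=
  'X_(mxvec_index i l).

Definition bracket (n : nat) (i j : 'I_n) : {mpoly int[n * 2]} :=
  y_var i 0 * y_var j 1 - y_var i 1 * y_var j 0.

Definition evalY (n : nat) (p : {mpoly int[n * 2]}) (Y : 'M[algC]_(n, 2)) : algC :=
  (map_mpoly (fun z : int => z%:~R : algC) p).@[fun l => mxvec Y 0 l].

Definition line_meets_XB (k n : nat) (A : 'M[int]_(k, n)) (Y : 'M[algC]_(n, 2)) : Prop :=
  exists s t : algC, (s, t) != (0, 0) /\
    in_cone_XB A (s *: col 0 Y + t *: col 1 Y).

(* C is the dual Chow form of X_B (up to sign) *)
Definition is_dual_chow_form (k n : nat) (A : 'M[int]_(k, n)) (C : {mpoly int[n * 2]}) : Prop :=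
  mirreducible C /\
  forall Y : 'M[algC]_(n, 2), \rank Y = 2%N ->
    (evalY C Y = 0 <-> line_meets_XB A Y).

(* G is a polynomial in variables p_ij ((i,j) in I_n x I_n, variable index
   mxvec_index i j); G([i j]) substitutes p_ij := [i j] *)
Definition bracket_tuple (n : nat) : (n * n).-tuple {mpoly int[n * 2]} :=
  [tuple mxvec (\matrix_(i < n, j < n) bracket i j) 0 l | l < n * n].

Definition other_cols (n : nat) (i j : 'I_n) (r : 'I_(n - 2)) : 'I_n :=
  nth i (enum [pred l : 'I_n | (l != i) && (l != j)]) r.

Definition omit2 (R : Type) (n : nat) (M : 'M[R]_(n - 2, n)) (i j : 'I_n) : 'M[R]_(n - 2) :=
  colsub (other_cols i j) M.

Definition Zmat (n : nat) : 'M[{mpoly int[(n - 2) * n]}]_(n - 2, n) :=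
  \matrix_(r < n - 2, c < n) 'X_(mxvec_index r c).

Definition angle (n : nat) (eps : 'I_n -> 'I_n -> int) (i j : 'I_n) : {mpoly int[(n - 2) * n]} :=
  if (i < j)%N then (eps i j)%:MP * \det (omit2 (Zmat n) i j)
  else if (j < i)%N then - ((eps j i)%:MP * \det (omit2 (Zmat n) j i))
  else 0.

Definition angle_tuple (n : nat) (eps : 'I_n -> 'I_n -> int) : (n * n).-tuple {mpoly int[(n - 2) * n]} :=
  [tuple mxvec (\matrix_(i < n, j < n) angle eps i j) 0 l | l < n * n].

Definition minorB (n : nat) (B : 'M[int]_(n, 2)) (i j : 'I_n) : int :=
  B i 0 * B j 1 - B i 1 * B j 0.

Definition admissible_signs (n : nat) (A : 'M[int]_(n - 2, n)) (B : 'M[int]_(n, 2))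
    (eps : 'I_n -> 'I_n -> int) : Prop :=
  (forall i j : 'I_n, (i < j)%N -> eps i j = 1 \/ eps i j = -1) /\
  exists c : rat, c != 0 /\
    forall i j : 'I_n, (i < j)%N ->
      ((eps i j * \det (omit2 A i j))%:~R : rat) = c * (minorB B i j)%:~R.

Definition spec_tuple (n : nat) (A : 'M[int]_(n - 2, n)) : ((n - 2) * n).-tuple {mpoly int[n]} :=
  [tuple mxvec (\matrix_(r < n - 2, c < n) ((A r c)%:MP * 'X_c)) 0 l | l < (n - 2) * n].

(* E_A obtained from a bracket expression G of the dual Chow form *)
Definition full_discr (n : nat) (A : 'M[int]_(n - 2, n)) (eps : 'I_n -> 'I_n -> int)
    (G : {mpoly int[n * n]}) : {mpoly int[n]} :=
  comp_mpoly (spec_tuple A) (comp_mpoly (angle_tuple eps) G).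

Definition in_conv (R : realFieldType) (m : nat) (pts : seq 'rV[R]_m) (v : 'rV[R]_m) : Prop :=
  exists lam : 'I_(size pts) -> R,
    (forall k, 0 <= lam k) /\ \sum_k lam k = 1 /\
    v = \sum_k lam k *: nth 0 pts k.

Definition exps_pts (R : realFieldType) (n : nat) (p : {mpoly int[n]}) : seq 'rV[R]_n :=
  [seq \row_(i < n) ((m : 'X_{1..n}) i)%:R | m <- msupp p].

Definition newton_polytope (R : realFieldType) (n : nat) (p : {mpoly int[n]}) (v : 'rV[R]_n) : Prop :=
  in_conv (exps_pts R p) v.

Definition det2 (R : ringType) (b u : R * R) : R := b.1 * u.2 - b.2 * u.1.

Definition rowB (n : nat) (B : 'M[int]_(n, 2)) (i : 'I_n) : int * int := (B i 0, B i 1).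

Definition upper_half (b : int * int) : bool := (0 < b.2) || ((b.2 == 0) && (0 < b.1)).

(* counterclockwise order of directions, angles measured in [0, 2 pi) *)
Definition angle_le (b c : int * int) : bool :=
  if upper_half b == upper_half c then 0 <= det2 b c else upper_half b.

Definition sorted_rows (n : nat) (B : 'M[int]_(n, 2)) : seq 'I_n :=
  sort (fun i j => angle_le (rowB B i) (rowB B j))
       [seq i <- enum 'I_n | rowB B i != (0, 0)].

Definition to_pt (R : realFieldType) (b : int * int) : 'rV[R]_2 :=
  \row_(k < 2) (if k == 0 then b.1 else b.2)%:~R.

(* the vertices (partial sums of the edge vectors) of a translate of P_B *)
Definition PB_pts (R : realFieldType) (n : nat) (B : 'M[int]_(n, 2)) : seq 'rV[R]_2 :=
  [seq \sum_(i <- take k (sorted_rows B)) to_pt R (rowB B i)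
  | k <- iota 0 (size (sorted_rows B)).+1].

Definition in_PB (R : realFieldType) (n : nat) (B : 'M[int]_(n, 2)) (v : 'rV[R]_2) : Prop :=
  in_conv (PB_pts R B) v.

Definition detR (R : realFieldType) (b : int * int) (u : 'rV[R]_2) : R :=
  b.1%:~R * u 0 1 - b.2%:~R * u 0 0.

Definition is_max_on_PB (R : realFieldType) (n : nat) (B : 'M[int]_(n, 2)) (i : 'I_n) (mu : R) : Prop :=
  (exists2 u, in_PB B u & detR (rowB B i) u = mu) /\
  (forall u, in_PB B u -> detR (rowB B i) u <= mu).

(* the affine map v |-> (d_B - v^(1), ..., d_B - v^(n)), v^(i) = mu_i - det(b_i, v) *)
Definition PB_map (R : realFieldType) (n : nat) (B : 'M[int]_(n, 2)) (d : nat) (mu : 'I_n -> R)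
    (v : 'rV[R]_2) : 'rV[R]_n :=
  \row_(i < n) (d%:R - (mu i - detR (rowB B i) v)).

(* Main.v *)
(* By the homogeneities of C, the degrees of its monomials in the rows of Y form a finite set S in
   one coset of B Z^2, so S is the image of some V in Z^2 under v |-> (kap_i - det(b_i, v))_i.
   Substituting z_ij = a_ij x_j turns the bracket <i j> into c (prod x) det(b_i, b_j) / (x_i x_j), so
   the exponents of E_A are D - e, where e runs over the exponents of F(x) = C(diag(x) B) and D is the
   degree of C in the brackets; counting the roots of a pencil of lines gives D = d_B.
   Three facts pin down V. (1) The degree of C in row i is at most the width
   sum_l max(det(b_i, b_l), 0) of P_B: a one-parameter subgroup orthogonal to b_i turns the equation
   of X_B on a line whose i-th coordinate moves into one polynomial equation in one unknown. (2) Following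
   this equation when another row is rescaled shows that the part of C of top degree in row i is
   divisible by powers of coprime polynomials, one for each row parallel to b_i, so that the face of V in
   direction b_i contains a segment at least as long as the edge of P_B. (3) A generic degeneration of B shows that
   extreme points of V are exponents of F, because the degenerate line misses X_B.
   Going around V, the edges of (2) fill the whole width allowed by (1), so conv V has
   exactly the edges of P_B. *)
Require Import Defs.
From HB Require Import structures.
From mathcomp Require Import all_boot all_order all_algebra all_field.
From mathcomp Require Import perm.
From mathcomp Require Import mpoly.
From mathcomp Require Import zify ring.
From Stdlib Require Import Classical.
Set Implicit Arguments. Unset Strict Implicit. Unset Printing Implicit Defensive.
Import Order.TTheory GRing.Theory Num.Theory.
Local Open Scope ring_scope.

(** The Chow form C is given only by its irreducibility over Z and by its zeros on matrices of rank
    2, so every algebraic fact about it has to be extracted from the zero set. Unique factorization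
    in Z[y] does this: if C does not divide f, a Bezout identity in one variable shows that C and f
    have no common zero on a generic line; applied to the derivative, it shows that C has only
    simple roots on such a line, so that degrees can be counted as numbers of intersection points.
    The second difficulty is that rows of B may vanish, be parallel or be nonprimitive. Hence a
    nonzero row is written b_i = g rho with rho primitive, and m with dot rho m = 1 completes perp
    rho to a basis of Z^2: the equation of X_B for perp rho does not contain x_i, the one for m
    contains x_i^g. Finally, the exponents of F are only some of those of C, because a coefficient
    may vanish at B; V is therefore controlled through C, and only its extreme points are compared
    with F. *)

Section UniqueFactorization.
Import Pdiv.Idomain.

(** * Unique factorization *)

Section Factorial.
Variable R : idomainType.
Implicit Types a b p q r : R.

Definition divides a b := exists q, b = q * a.

Definition prime_elt p :=
  [/\ p != 0, p \isn't a GRing.unit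
    & forall a b, divides p (a * b) -> divides p a \/ divides p b].

Definition irreducible_elt p :=
  [/\ p != 0, p \isn't a GRing.unit
    & forall q r, p = q * r -> q \is a GRing.unit \/ r \is a GRing.unit].

Definition prime_seq (s : seq R) := forall p, p \in s -> prime_elt p.

(** Primality of the factors already gives uniqueness, so existence of such a factorization is all
    that has to pass from R to R[x]. *)
Definition factorial_ring :=
  forall a, a != 0 -> exists u s,
    [/\ u \is a GRing.unit, prime_seq s & a = u * \prod_(p <- s) p].

Lemma prime_seq_cons p s : prime_seq (p :: s) -> prime_elt p /\ prime_seq s.
Proof.
move=> ps; split; first by apply: ps; rewrite mem_head.
by move=> q qs; apply: ps; rewrite inE qs orbT.
Qed.

(** The first prime factor q of p is not a unit, so irreducibility makes the cofactor t a unit, and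
    p inherits primality from its associate q. *)
Lemma irreducible_prime p : factorial_ring -> irreducible_elt p -> prime_elt p.
Proof.
move=> ufd [p0 pU pI]; split=> // a b pab.
have [u [[|q s] [uU ps def_p]]] := ufd _ p0.
  by move: pU; rewrite def_p big_nil mulr1 uU.
have [[q0 qU qP] ps'] := prime_seq_cons ps.
rewrite big_cons mulrCA in def_p; set t := u * _ in def_p.
have tU : t \is a GRing.unit by have [qU'|] := pI _ _ def_p; rewrite ?qU' in qU *.
have pq c : divides p c <-> divides q c.
  split=> -[k ->]; first by exists (k * t); rewrite def_p -mulrA [t * q]mulrC.
  by exists (k / t); rewrite def_p mulrCA divrK // mulrC.
by have := qP a b; rewrite -!pq; apply.
Qed.

(** Each prime in turn divides a or b and is cancelled there. The sizes are recorded because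
    [poly_factorial] inducts on the number of primes in a leading coefficient. *)
Lemma split_prime_prod s u a b : u \is a GRing.unit -> prime_seq s ->
    a * b = u * \prod_(p <- s) p ->
  exists u1 s1 u2 s2, [/\ u1 \is a GRing.unit /\ u2 \is a GRing.unit,
    prime_seq s1 /\ prime_seq s2, a = u1 * \prod_(p <- s1) p,
    b = u2 * \prod_(p <- s2) p & size s = (size s1 + size s2)%N].
Proof.
move=> uU; elim: s a b => [|p s IH] a b.
  rewrite big_nil mulr1 => _ ab; exists a, [::], b, [::].
  move: uU; rewrite -ab unitrM => /andP[aU bU].
  by rewrite !big_nil !mulr1; split.
case/prime_seq_cons=> pP ps; rewrite big_cons mulrCA => ab.
have [p0 _ pdiv] := pP.
have [|[c ac]|[c bc]] := pdiv a b; first by exists (u * \prod_(q <- s) q); rewrite ab mulrC.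
- have /IH-/(_ ps)[u1 [s1 [u2 [s2 [U S c1 b1 sz]]]]] : c * b = u * \prod_(q <- s) q.
    by apply: (mulfI p0); rewrite -ab ac mulrCA mulrA.
  exists u1, (p :: s1), u2, s2; split=> //; last by rewrite /= sz.
    split; last by case: S.
    by move=> q; rewrite inE => /predU1P[->|] //; case: S => + _; apply.
  by rewrite ac c1 big_cons -mulrA [_ * p]mulrC.
have /IH-/(_ ps)[u1 [s1 [u2 [s2 [U S c1 b1 sz]]]]] : a * c = u * \prod_(q <- s) q.
  by apply: (mulfI p0); rewrite -ab bc mulrCA [p * c]mulrC.
exists u1, s1, u2, (p :: s2); split=> //; last by rewrite /= sz addnS.
  split; first by case: S.
  by move=> q; rewrite inE => /predU1P[->|] //; case: S => _; apply.
by rewrite bc b1 big_cons -mulrA [_ * p]mulrC.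
Qed.

End Factorial.

Section FactorialIso.
Variables (R S : idomainType) (f : {rmorphism R -> S}) (g : S -> R).
Hypotheses (fK : cancel f g) (gK : cancel g f).

Lemma iso_unit x : (f x \is a GRing.unit) = (x \is a GRing.unit).
Proof.
apply/idP/idP => [|/rmorph_unit]; last by apply.
case/unitrP=> y [yx xy]; apply/unitrP; exists (g y).
by split; apply: (can_inj fK); rewrite rmorphM rmorph1 gK.
Qed.

Lemma iso_divides x y : divides (f x) (f y) <-> divides x y.
Proof.
split=> -[q]; last by move=> ->; exists (f q); rewrite rmorphM.
by move=> e; exists (g q); apply: (can_inj fK); rewrite rmorphM gK.
Qed.

Lemma iso_neq0 x : (f x != 0) = (x != 0).
Proof. by rewrite -(inj_eq (can_inj fK)) rmorph0. Qed.

Lemma iso_prime x : prime_elt (f x) <-> prime_elt x.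
Proof.
split=> -[]; rewrite ?iso_neq0 ?iso_unit => x0 xU xP; split; rewrite ?iso_unit ?iso_neq0 //.
  by move=> a b; rewrite -!iso_divides rmorphM; apply: xP.
by move=> a b; rewrite -(gK a) -(gK b) -rmorphM !iso_divides; apply: xP.
Qed.

Lemma iso_irreducible x : irreducible_elt (f x) <-> irreducible_elt x.
Proof.
split=> -[]; rewrite ?iso_neq0 ?iso_unit => x0 xU xP; split; rewrite ?iso_unit ?iso_neq0 //.
  by move=> a b e; rewrite -!iso_unit; apply: xP; rewrite e rmorphM.
move=> a b; rewrite -(gK a) -(gK b) -rmorphM => /(can_inj fK) e.
by rewrite !iso_unit; apply: xP.
Qed.

Lemma iso_factorial : factorial_ring S -> factorial_ring R.
Proof.
move=> ufd a; rewrite -iso_neq0 => /ufd[u [s [uU ps e]]].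
exists (g u), (map g s); rewrite -iso_unit gK; split=> //.
  by move=> p /mapP[q qs ->]; rewrite -iso_prime gK; apply: ps.
apply: (can_inj fK); rewrite e rmorphM gK big_map rmorph_prod; congr (_ * _).
by apply: eq_bigr => q _; rewrite gK.
Qed.

End FactorialIso.

Lemma int_factorial : factorial_ring int.
Proof.
have unitz (a : int) : (a \is a GRing.unit) = (`|a| == 1)%N.
  by case: a => [[|[|k]]|[|k]].
have primez (p : nat) : prime p -> prime_elt (p%:Z).
  move=> pp; split.
  - by rewrite eqz_nat -lt0n prime_gt0.
  - by rewrite unitz absz_nat neq_ltn prime_gt1 ?orbT.
  - have dv (c : int) : divides p%:Z c <-> (p %| `|c|)%N.
      split=> [[q ->]|H]; first by rewrite abszM dvdn_mull.
    by have /dvdzP : (p%:Z %| c)%Z by rewrite dvdzE.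
    by move=> a b; rewrite !dv abszM Euclid_dvdM // => /orP.
suff H (m : nat) : forall a : int, (`|a| <= m)%N -> a != 0 -> exists u s,
    [/\ u \is a GRing.unit, prime_seq s & a = u * \prod_(p <- s) p].
  by move=> a; apply: (H `|a|%N).
elim: m => [|m IH] a; first by rewrite leqn0 absz_eq0 => ->.
move=> am a0; have [a1|a1] := boolP (`|a| == 1)%N.
  by exists a, [::]; rewrite big_nil mulr1; split; rewrite // unitz.
have pp : prime (pdiv `|a|).
  by rewrite pdiv_prime // ltn_neqAle eq_sym a1 lt0n absz_eq0.
have /dvdzP[q aq] : (pdiv `|a| %| a)%Z by rewrite dvdzE /= pdiv_dvd.
have q0 : q != 0 by apply: contraNneq a0 => q0; rewrite aq q0 mul0r.
have [|u [s [uU ps qe]]] := IH q _ q0.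
  rewrite -ltnS (leq_trans _ am) // {1}aq abszM /= -[X in (X < _)%N]muln1.
  by rewrite ltn_pmul2l ?prime_gt1 // lt0n absz_eq0.
exists u, ((pdiv `|a|)%:Z :: s); split=> //.
  by move=> p; rewrite inE => /predU1P[->|]; [apply: primez | apply: ps].
by rewrite big_cons {1}aq qe mulrCA mulrC.
Qed.

Section Gauss.
Variable R : idomainType.
Hypothesis ufd : factorial_ring R.
Implicit Types (f g h P : {poly R}).

Lemma dividesC_coef (p : R) f : divides p%:P f <-> forall i, divides p f`_i.
Proof.
split=> [[q ->] i|H]; first by exists q`_i; rewrite coefMC.
have H' i : {q | f`_i == q * p}.
  by apply: sigW; have [q ->] := H i; exists q.
exists (\poly_(i < size f) sval (H' i)); apply/polyP=> i.
rewrite coefMC coef_poly; case: ltnP => [_|/(nth_default 0) ->]; last by rewrite mul0r.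
exact/eqP/(svalP (H' i)).
Qed.

Lemma dividesD (p a b : R) : divides p a -> divides p b -> divides p (a + b).
Proof. by move=> [q ->] [r ->]; exists (q + r); rewrite mulrDl. Qed.

Lemma divides_sum (p : R) (I : Type) (r : seq I) (Q : pred I) (F : I -> R) :
  (forall i, Q i -> divides p (F i)) -> divides p (\sum_(i <- r | Q i) F i).
Proof.
move=> H; apply: (big_ind (divides p)) => //; last exact: dividesD.
by exists 0; rewrite mul0r.
Qed.

(** If p divides neither f nor g, take in each the first coefficient not divisible by p, of index i
    and j; modulo p the coefficient of f g at i + j is the product of the two. *)
Lemma polyC_prime (p : R) : prime_elt p -> prime_elt p%:P.
Proof.
move=> [p0 pU pP]; split; first by rewrite polyC_eq0.
  by rewrite poly_unitE size_polyC p0 coefC.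
move=> f g pfg; apply: NNPP => /not_or_and[].
have minC h : ~ divides p%:P h -> exists i, ~ divides p h`_i /\
    forall j, (j < i)%N -> divides p h`_j.
  rewrite dividesC_coef => /not_all_ex_not[i].
  elim/ltn_ind: i => i IH Hi.
  case: (classic (exists2 j, (j < i)%N & ~ divides p h`_j)) => [[j ji Hj]|].
    exact: IH ji Hj.
  move=> N; exists i; split=> // j ji; apply: NNPP => Hj; apply: N.
  by exists j.
move=> /minC[i [fi Hi]] /minC[j [gj Hj]].
have /dividesC_coef/(_ (i + j)%N) := pfg; rewrite coefM.
have iP : (i < (i + j).+1)%N by rewrite ltnS leq_addr.
rewrite (bigD1 (Ordinal iP)) //= addKn => Hs.
suff /pP[] : divides p (f`_i * g`_j) by [].
have [q Hq] := Hs.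
suff [r Hr] : divides p (\sum_(k < (i + j).+1 | k != Ordinal iP) f`_k * g`_(i + j - k)).
  by exists (q - r); rewrite mulrBl -Hq -Hr addrK.
apply: divides_sum => k; rewrite -val_eqE /= neq_ltn => /orP[ki|ik].
  by have [r ->] := Hi _ ki; exists (r * g`_(i + j - k)); rewrite mulrAC.
have [|r ->] := Hj (i + j - k)%N.
  by rewrite ltn_subLR ?ltn_add2r // -ltnS.
by exists (f`_k * r); rewrite mulrA.
Qed.

(* Every prime factor of [a] divides [g] or [h] and can be cancelled there. *)
Lemma gauss_cancel (a : R) f g h : a != 0 -> a%:P * f = g * h ->
  exists a1 a2 g' h', [/\ a1 != 0, a2 != 0, g = a1%:P * g', h = a2%:P * h' & f = g' * h'].
Proof.
move=> /ufd[u [s [uU ps ->]]] {a}.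
elim: s f g h ps => [|p s IH] f g h.
  move=> _; rewrite big_nil mulr1 => e.
  exists u, 1, (u^-1%:P * g), h; have u0 : u != 0 by apply: contraTneq uU => ->; rewrite unitr0.
  rewrite oner_eq0 mul1r mulrA -polyCM divrr // mul1r; split=> //.
  by rewrite -mulrA -e mulrA -polyCM mulVr // mul1r.
case/prime_seq_cons=> pP ps; rewrite big_cons mulrCA polyCM -mulrA => e.
have [p0 _ pdiv] := polyC_prime pP.
have [|[k gk]|[k hk]] := pdiv g h; first by exists ((u * \prod_(q <- s) q)%:P * f); rewrite -e mulrC.
- have /(IH _ _ _ ps)[a1 [a2 [g' [h' [a10 a20 gE hE fE]]]]] :
      (u * \prod_(q <- s) q)%:P * f = k * h.
    by apply: (mulfI p0); rewrite e gk mulrCA mulrA.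
  exists (p * a1), a2, g', h'; split=> //; first by rewrite mulf_neq0 // -polyC_eq0.
  by rewrite gk gE polyCM mulrC mulrA.
have /(IH _ _ _ ps)[a1 [a2 [g' [h' [a10 a20 gE hE fE]]]]] :
    (u * \prod_(q <- s) q)%:P * f = g * k.
  by apply: (mulfI p0); rewrite e hk mulrA mulrC.
exists a1, (p * a2), g', h'; split=> //; first by rewrite mulf_neq0 // -polyC_eq0.
by rewrite hk hE polyCM mulrC mulrA.
Qed.

Lemma unit_polyC (a : R) : (a%:P \is a GRing.unit) = (a \is a GRing.unit).
Proof.
rewrite poly_unitE coefC size_polyC /=; have [->|//] := eqVneq a 0.
by rewrite unitr0.
Qed.

Lemma irreducible_polyC (p : R) : irreducible_elt p%:P -> irreducible_elt p.
Proof.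
case; rewrite polyC_eq0 unit_polyC => p0 pU pI; split=> // q r e.
have eC : p%:P = q%:P * r%:P by rewrite e polyCM.
by move: (pI _ _ eC); rewrite !unit_polyC.
Qed.

(** [gauss_cancel] distributes a over the two factors on the right; the part a2 split off from P is
    a unit, since the remaining factor has the degree of P and cannot be one. *)
Lemma irreducible_cancel (a : R) P f k : irreducible_elt P -> (1 < size P)%N -> a != 0 ->
  a%:P * f = k * P -> divides P f.
Proof.
move=> [P0 PU PI] sP a0 /(gauss_cancel a0)[a1 [a2 [k' [P' [_ a20 _ EP ->]]]]].
have [a2U|P'U] := PI _ _ EP.
  exists (k' * (a2^-1)%:P); rewrite EP -mulrA [(_^-1)%:P * _]mulrA -polyCM mulVr ?mul1r //.
  by rewrite -unit_polyC.
by move: sP; rewrite EP mul_polyC size_scale //; move: P'U; rewrite poly_unitE => /andP[/eqP ->].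
Qed.

(* Over the fraction field [P] stays irreducible by Gauss' lemma, so it is coprime to [f] there;
   the resultant is then a nonzero constant in the ideal. *)
Lemma irreducible_bezout P f : irreducible_elt P -> (1 < size P)%N -> ~ divides P f ->
  exists u v a, a != 0 /\ u * P + v * f = a%:P.
Proof.
move=> Pirr sP PNf; have [P0 PU PI] := Pirr.
have f0 : f != 0 by apply/eqP=> f0; apply: PNf; exists 0; rewrite mul0r.
have [sf|sf] := leqP (size f) 1.
  exists 0, 1, f`_0; rewrite mul0r add0r mul1r -size1_polyC //; split=> //.
  by apply: contraNneq f0 => f00; rewrite (size1_polyC sf) f00.
have [[u v] _ e] := resultant_in_ideal sP sf.
have [r0|r0] := eqVneq (resultant P f) 0; last by exists u, v, (resultant P f).
case: PNf; move/eqP: r0; rewrite resultant_eq0 => sG.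
set G := gcdp P f in sG.
have /dvdpP[[c H] /= c0 cP] : G %| P by rewrite dvdp_gcdl.
have /dvdpP[[c' K] /= c'0 cf] : G %| f by rewrite dvdp_gcdr.
rewrite -mul_polyC in cP; rewrite -mul_polyC in cf.
have [a1 [a2 [H' [G' [_ a20 _ EG EP]]]]] := gauss_cancel c0 cP.
have G'N : G' \isn't a GRing.unit.
  apply/negP; rewrite poly_unitE => /andP[/eqP s1 _].
  by move: sG; rewrite EG mul_polyC size_scale // s1.
have H'U : H' \is a GRing.unit by have [//|G'U] := PI _ _ EP; rewrite G'U in G'N.
apply: (irreducible_cancel (a := c') (k := K * a2%:P / H')) => //.
rewrite cf EG EP mulrA -[in RHS]mulrA; congr (_ * _).
by rewrite mulrA mulVr // mul1r.
Qed.

(** For P of positive degree not dividing g, multiply u P + v g = a by h: P divides a h, and the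
    constant a can be cancelled. *)
Lemma irreducible_poly_prime P : irreducible_elt P -> prime_elt P.
Proof.
move=> Pirr; have [P0 PU PI] := Pirr.
have [sP|sP] := leqP (size P) 1.
  rewrite (size1_polyC sP); apply/polyC_prime/irreducible_prime => //.
  by apply: irreducible_polyC; rewrite -size1_polyC.
split=> // g h [k gh]; have [|N] := classic (divides P g); [by left | right].
have [u [v [a [a0 e]]]] := irreducible_bezout Pirr sP N.
apply: (irreducible_cancel (a := a) (k := u * h + v * k)) => //.
by rewrite -e !mulrDl -!mulrA [P * h]mulrC gh.
Qed.

(** The induction carries a prime factorization of the leading coefficient. When f is a product of
    nonunits, each factor has positive degree or at least one prime in its leading coefficient
    ([big]), so size plus number of primes drops for both. *)
Lemma poly_factorial : factorial_ring {poly R}.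
Proof.
suff H N f u (s : seq R) : f != 0 -> u \is a GRing.unit -> prime_seq s ->
    lead_coef f = u * \prod_(p <- s) p -> (size f + size s <= N)%N ->
    exists v t, [/\ v \is a GRing.unit, prime_seq t & f = v * \prod_(p <- t) p].
  move=> f f0; have [|u [s [uU ps e]]] := ufd (a := lead_coef f); first by rewrite lead_coef_eq0.
  exact: (H _ f u s f0 uU ps e (leqnn _)).
elim: N f u s => [|N IH] f u s f0 uU ps lf sf.
  by move: sf; rewrite leqn0 addn_eq0 size_poly_eq0 (negPf f0).
have [fU|fU] := boolP (f \is a GRing.unit).
  by exists f, [::]; rewrite big_nil mulr1; split.
have [firr|] := classic (irreducible_elt f).
  exists 1, [:: f]; rewrite big_seq1 mul1r unitr1; split=> // p.
  by rewrite inE => /eqP->; apply: irreducible_poly_prime.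
move=> fN; have [g [h [fgh gU hU]]] : exists g h, [/\ f = g * h,
    g \isn't a GRing.unit & h \isn't a GRing.unit].
  apply: NNPP => N'; apply: fN; split=> // g h e.
  case: (boolP (g \is a GRing.unit)) => gU; first by left.
  case: (boolP (h \is a GRing.unit)) => hU; first by right.
  by case: N'; exists g, h.
have /andP[g0 h0] : (g != 0) && (h != 0) by rewrite -negb_or -mulf_eq0 -fgh.
move: lf; rewrite fgh lead_coefM => /(split_prime_prod uU ps).
move=> [u1 [s1 [u2 [s2 [[u1U u2U] [ps1 ps2] lg lh ss]]]]].
have big (k : {poly R}) w t : k != 0 -> k \isn't a GRing.unit -> w \is a GRing.unit ->
    lead_coef k = w * \prod_(p <- t) p -> (1 < size k + size t)%N.
  move=> k0 kU wU lk; rewrite ltnNge; apply: contra kU => sk.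
  have sk1 : size k = 1%N.
    apply/eqP; rewrite eqn_leq lt0n size_poly_eq0 k0 andbT.
    by rewrite (leq_trans _ sk) // leq_addr.
  move: sk lk; rewrite sk1 -[X in (_ <= X)%N]addn0 leq_add2l leqn0 size_eq0 => /eqP ->.
  rewrite big_nil mulr1 => lk; rewrite poly_unitE sk1 eqxx /=.
  have -> : k`_0 = lead_coef k by rewrite /lead_coef sk1.
  by rewrite lk.
have sgh : (size f).+1 = (size g + size h)%N.
  by rewrite fgh size_mul // prednK // addn_gt0 lt0n size_poly_eq0 g0.
have g1 := big _ _ _ g0 gU u1U lg; have h1 := big _ _ _ h0 hU u2U lh.
have sN : ((size g + size s1) + (size h + size s2) <= N.+2)%N.
  by lia.
have [|v1 [t1 [v1U pt1 ->]]] := IH g u1 s1 g0 u1U ps1 lg.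
  by rewrite -(leq_add2r 2) !addn2; apply: leq_trans sN; rewrite -addn2 leq_add2l.
have [|v2 [t2 [v2U pt2 ->]]] := IH h u2 s2 h0 u2U ps2 lh.
  by rewrite -(leq_add2l 2) !add2n; apply: leq_trans sN; rewrite -add2n leq_add2r.
exists (v1 * v2), (t1 ++ t2); rewrite unitrM v1U v2U big_cat mulrACA; split=> //.
by move=> p; rewrite mem_cat => /orP[/pt1|/pt2].
Qed.

End Gauss.

End UniqueFactorization.

(** * Multivariate polynomials over the integers *)

Section MuniIso.
Variables (R : comNzRingType) (n : nat).

(** Inverse of [muni]; through this isomorphism [poly_factorial] adds one variable at a time. *)
Definition mmulti_horner (p : {poly {mpoly R[n]}}) : {mpoly R[n.+1]} :=
  (map_poly (@mwiden n R) p).['X_ord_max].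

Lemma muniX_widen (i : 'I_n) :
  muni ('X_(widen_ord (leqnSn n) i) : {mpoly R[n.+1]}) = ('X_i)%:P.
Proof.
rewrite /muni mmapX mmap1U; case: splitP => [j /= eq|j].
  by congr ('X__)%:P; apply/val_inj.
by rewrite ord1 /= addn0 => /eqP; rewrite ltn_eqF.
Qed.

Lemma muniX_max : muni ('X_ord_max : {mpoly R[n.+1]}) = 'X.
Proof.
rewrite /muni mmapX mmap1U; case: splitP => // j /eqP /=.
by rewrite eq_sym ltn_eqF.
Qed.

Lemma ord_max_or_widen (i : 'I_n.+1) :
  i = ord_max \/ exists j, i = widen_ord (leqnSn n) j.
Proof.
have [->|ni] := eqVneq i ord_max; first by left.
right; have im : (i < n)%N.
  by have := ltn_ord i; rewrite ltnS leq_eqVlt => /predU1P[e|//]; case/eqP: ni; apply/val_inj.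
by exists (Ordinal im); apply/val_inj.
Qed.

Lemma muni_mwiden (p : {mpoly R[n]}) : muni (mwiden p) = p%:P.
Proof.
rewrite /mwiden /mmap rmorph_sum [in RHS](mpolyE p) rmorph_sum.
apply: eq_bigr => m _; rewrite -[p@_m *: _]mul_mpolyC !rmorphM /= muniC; congr (_ * _).
rewrite /mmap1 rmorph_prod mpolyXE_id rmorph_prod; apply: eq_bigr => i _.
by rewrite !rmorphXn /= muniX_widen.
Qed.

Lemma mmulti_hornerK : cancel mmulti_horner (@muni n R).
Proof.
move=> p; rewrite /mmulti_horner horner_coef rmorph_sum /=.
rewrite -[RHS]coefK poly_def.
under eq_bigr => i _ do rewrite rmorphM rmorphXn /= muniX_max coef_map muni_mwiden mul_polyC.
rewrite (big_ord_widen _ (fun i => p`_i *: 'X^i) (size_poly _ _)).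
rewrite [LHS]big_mkcond; apply: eq_bigr => i _.
case: ltnP => // /(nth_default 0); rewrite coef_map /= => e.
by rewrite (_ : p`_i = 0) ?scale0r //; apply: (@inj_mwiden n R); rewrite e mwiden0.
Qed.

Lemma muniK : cancel (@muni n R) mmulti_horner.
Proof.
move=> p; rewrite {1}(mpolyE p) [in RHS](mpolyE p) rmorph_sum /mmulti_horner rmorph_sum /= horner_sum.
apply: eq_bigr => m _; rewrite muniZ -mul_polyC rmorphM hornerM /= map_polyC hornerC /= mwidenC mul_mpolyC.
congr (_ *: _); rewrite mpolyXE_id !rmorph_prod.
rewrite horner_prod; apply: eq_bigr => i _; rewrite !rmorphXn horner_exp; congr (_ ^+ _) => /=.
have [->|[j ->]] := ord_max_or_widen i; first by rewrite muniX_max map_polyX hornerX.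
by rewrite muniX_widen map_polyC hornerC /= /mwiden mmapX mmap1U.
Qed.

End MuniIso.

Lemma mpoly_factorial N : factorial_ring {mpoly int[N]}.
Proof.
elim: N => [|N IH].
  apply: (@iso_factorial _ _ (@mcoeff 0 int 0%MM) (@mpolyC 0 int)); last exact: int_factorial.
    by move=> p; rewrite -nvar0_mpolyC.
  exact: mpolyCK.
exact: (iso_factorial (@muniK _ N) (@mmulti_hornerK _ N) (poly_factorial IH)).
Qed.

Lemma mirreducible_elt N (p : {mpoly int[N]}) : mirreducible p -> irreducible_elt p.
Proof. by case=> p0 [pU pP]; split. Qed.

Definition evC N (C : {mpoly int[N]}) (y : 'I_N -> algC) : algC :=
  (map_mpoly (fun z : int => z%:~R : algC) C).@[y].

Lemma poly_ext (F : numFieldType) (p q : {poly F}) : (forall s, p.[s] = q.[s]) -> p = q.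
Proof.
move=> e; apply/eqP; rewrite -subr_eq0; apply/negPn/negP => r0.
have : all (root (p - q)) [seq i%:R | i <- iota 0 (size (p - q))].
  by apply/allP => x _; rewrite rootE hornerD hornerN e subrr.
move=> /(max_poly_roots r0)/(_ _); rewrite map_inj_uniq ?iota_uniq.
  by rewrite size_map size_iota ltnn => /(_ isT).
by move=> i j /eqP; rewrite eqr_nat => /eqP.
Qed.

Lemma poly_nonroot (F : numFieldType) (p : {poly F}) : p != 0 -> exists s, p.[s] != 0.
Proof.
move=> p0; apply: NNPP => N; case/eqP: p0; apply: poly_ext => s.
by rewrite horner0; apply/eqP; apply/negPn/negP => ps; apply: N; exists s.
Qed.

Lemma muni_eval (R : comNzRingType) n (p : {mpoly R[n.+1]}) (y : 'I_n.+1 -> R) :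
  (map_poly (meval (fun j => y (widen_ord (leqnSn n) j))) (muni p)).[y ord_max] = p.@[y].
Proof.
rewrite muniE mevalE rmorph_sum /= horner_sum; apply: eq_bigr => m _.
rewrite -mul_polyC rmorphM hornerM /= map_polyC hornerC /= mevalZ mevalX map_polyXn hornerXn -mulrA.
by rewrite big_ord_recr /=; congr (_ * (_ * _)); apply: eq_bigr => i _; rewrite mnmE.
Qed.

(** Natural coordinates matter in [separable_pencil], where the point found becomes the direction of
    a line and [line_separable] wants integral directions. *)
Lemma mpoly_nonroot_nat (F : numFieldType) N (p : {mpoly F[N]}) : p != 0 ->
  exists y : 'I_N -> nat, p.@[fun i => (y i)%:R] != 0.
Proof.
elim: N p => [|N IH] p p0.
  exists (fun _ => 0%N); move: p0; rewrite [p]nvar0_mpolyC mevalC.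
  by apply: contraNneq => ->; rewrite mpolyC0.
have : lead_coef (muni p) != 0.
  by rewrite lead_coef_eq0 -(muni0 N F) (can_eq (@muniK F N)).
move=> /IH[y ly]; set q := map_poly (meval (fun i => (y i)%:R)) (muni p).
have q0 : q != 0 by rewrite -lead_coef_eq0 lead_coef_map_eq.
have [s ps] : exists s : nat, q.[s%:R] != 0.
  apply: NNPP => Nq; have : all (root q) [seq i%:R | i <- iota 0 (size q)].
    by apply/allP => x /mapP[i _ ->]; rewrite rootE; apply/negPn/negP => H; apply: Nq; exists i.
  move=> /(max_poly_roots q0); rewrite map_inj_uniq ?iota_uniq => [/(_ isT)|].
    by rewrite size_map size_iota ltnn.
  by move=> i j /eqP; rewrite eqr_nat => /eqP.
pose y' (i : 'I_N.+1) := if unlift ord_max i is Some j then y j else s.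
have y'w j : y' (widen_ord (leqnSn N) j) = y j.
  rewrite /y' (_ : widen_ord _ j = lift ord_max j) ?liftK //.
  by apply/val_inj; rewrite /= /bump leqNgt ltn_ord.
have y'm : y' ord_max = s by rewrite /y' unlift_none.
exists y'; rewrite -muni_eval y'm; apply: contraNneq ps => <-; apply/eqP; congr (_.[_]).
by apply: eq_map_poly => r; apply: meval_eq => j; rewrite y'w.
Qed.

Lemma mpoly_nonroot (F : numFieldType) N (p : {mpoly F[N]}) : p != 0 -> exists y, p.@[y] != 0.
Proof. by case/mpoly_nonroot_nat=> y py; exists (fun i => (y i)%:R). Qed.

Section Evaluation.
Variable N : nat.
Implicit Types (C f : {mpoly int[N]}) (p : {mpoly algC[N]}).

Lemma evC_mul C f y : evC (C * f) y = evC C y * evC f y.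
Proof. by rewrite /evC rmorphM mevalM. Qed.

Lemma evC_add C f y : evC (C + f) y = evC C y + evC f y.
Proof. by rewrite /evC raddfD mevalD. Qed.

Lemma evC_ext C y y' : y =1 y' -> evC C y = evC C y'.
Proof. exact: meval_eq. Qed.

Lemma evC_sum (I : Type) (r : seq I) (Q : pred I) (F : I -> {mpoly int[N]}) y :
  evC (\sum_(i <- r | Q i) F i) y = \sum_(i <- r | Q i) evC (F i) y.
Proof. by apply: (big_morph (fun C => evC C y)) => [C f|]; rewrite ?evC_add // /evC raddf0 meval0. Qed.

Lemma evC_const (c : int) y : evC (c%:MP : {mpoly int[N]}) y = c%:~R.
Proof. by rewrite /evC map_mpolyC mevalC. Qed.

Lemma evC_prod (I : Type) (r : seq I) (Q : pred I) (F : I -> {mpoly int[N]}) y :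
  evC (\prod_(i <- r | Q i) F i) y = \prod_(i <- r | Q i) evC (F i) y.
Proof. by apply: (big_morph (fun C => evC C y)) => [C f|]; rewrite ?evC_mul // -mpolyC1 evC_const. Qed.

Lemma evC_exp C y k : evC (C ^+ k) y = evC C y ^+ k.
Proof. by rewrite /evC rmorphXn /= rmorphXn. Qed.

Lemma evC_var i y : evC ('X_i : {mpoly int[N]}) y = y i.
Proof. by rewrite /evC map_mpolyX mevalXU. Qed.

Lemma evC_opp C y : evC (- C) y = - evC C y.
Proof. by rewrite /evC rmorphN mevalN. Qed.

Lemma evCE C y : evC C y = \sum_(m <- msupp C) (C@_m)%:~R * \prod_i y i ^+ m i.
Proof.
rewrite {1}(mpolyE C) evC_sum; apply: eq_bigr => m _.
rewrite -mul_mpolyC evC_mul evC_const mpolyXE_id evC_prod; congr (_ * _).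
by apply: eq_bigr => i _; rewrite evC_exp evC_var.
Qed.

Lemma map_intr_eq0 C : (map_mpoly (fun z : int => z%:~R : algC) C == 0) = (C == 0).
Proof.
apply/eqP/eqP => [e|->]; last by rewrite raddf0.
apply/mpolyP => m; rewrite mcoeff0; apply/eqP.
by rewrite -(intr_eq0 algC) -mcoeff_map_mpoly e mcoeff0.
Qed.

Definition line_restr p (y D : 'I_N -> algC) : {poly algC} :=
  mmap polyC (fun l => (y l)%:P + D l *: 'X) p.

Lemma line_restrE p y D s : (line_restr p y D).[s] = p.@[fun l => y l + s * D l].
Proof.
rewrite /line_restr /mmap mevalE horner_sum; apply: eq_bigr => m _.
rewrite hornerM hornerC; congr (_ * _); rewrite /mmap1 horner_prod.
by apply: eq_bigr => i _; rewrite horner_exp !hornerE mulrC.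
Qed.

End Evaluation.

Lemma evC_comp N M (T : N.-tuple {mpoly int[M]}) (C : {mpoly int[N]}) y :
  evC (comp_mpoly T C) y = evC C (fun i => evC (tnth T i) y).
Proof.
rewrite comp_mpolyE evC_sum evCE; apply: eq_bigr => m _.
rewrite -mul_mpolyC evC_mul evC_const evC_prod; congr (_ * _).
by apply: eq_bigr => i _; rewrite evC_exp.
Qed.

Lemma comp_mpolyK N M (T : N.-tuple {mpoly int[M]}) (S : M.-tuple {mpoly int[N]}) :
  (forall i, comp_mpoly S (tnth T i) = 'X_i) -> cancel (comp_mpoly T) (comp_mpoly S).
Proof.
move=> TS p; rewrite (comp_mpolyE p T) raddf_sum [in RHS](mpolyE p); apply: eq_bigr => m _ /=.
rewrite comp_mpolyZ rmorph_prod mpolyXE_id; congr (_ *: _); apply: eq_bigr => i _.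
by rewrite rmorphXn /= TS.
Qed.

Lemma muni_evC n (p : {mpoly int[n.+1]}) (y : 'I_n.+1 -> algC) :
  (map_poly (meval (fun j => y (widen_ord (leqnSn n) j)) \o map_mpoly (fun c : int => c%:~R))
     (muni p)).[y ord_max] = evC p y.
Proof.
rewrite muniE evCE rmorph_sum /= horner_sum; apply: eq_bigr => m _.
rewrite -mul_polyC rmorphM hornerM /= map_polyC hornerC /= map_mpolyZ mevalZ map_mpolyX mevalX.
rewrite map_polyXn hornerXn -mulrA.
by rewrite big_ord_recr /=; congr (_ * (_ * _)); apply: eq_bigr => i _; rewrite mnmE.
Qed.

(** * Generic lines in a fixed integral direction *)

Section Direction.
Variables (N : nat) (D : 'I_N.+1 -> int) (k : 'I_N.+1).
Hypothesis Dk : D k = 1.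
Local Notation sg := (tperm k ord_max).

(* A unimodular substitution that turns the last variable into a parameter along [D]. *)
Definition dir_sub : N.+1.-tuple {mpoly int[N.+1]} :=
  [tuple if l == k then 'X_ord_max else 'X_(sg l) + (D l)%:MP * 'X_ord_max | l < N.+1].

Definition dir_unsub : N.+1.-tuple {mpoly int[N.+1]} :=
  [tuple if j == ord_max then 'X_k else 'X_(sg j) - (D (sg j))%:MP * 'X_k | j < N.+1].

Lemma sg_max (l : 'I_N.+1) : (sg l == ord_max) = (l == k).
Proof. by apply/eqP/eqP => [e|->]; rewrite ?tpermL // -(tpermK k ord_max l) e tpermR. Qed.

Lemma sg_k (l : 'I_N.+1) : (sg l == k) = (l == ord_max).
Proof. by apply/eqP/eqP => [e|->]; rewrite ?tpermR // -(tpermK k ord_max l) e tpermL. Qed.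

Lemma dir_subK : cancel (comp_mpoly dir_sub) (comp_mpoly dir_unsub).
Proof.
apply: comp_mpolyK => i; rewrite tnth_mktuple; case: eqP => [->|/eqP ik].
  by rewrite comp_mpolyXU -tnth_nth tnth_mktuple eqxx.
rewrite rmorphD rmorphM /= comp_mpolyC !comp_mpolyXU -!tnth_nth !tnth_mktuple eqxx.
by rewrite sg_max (negPf ik) tpermK subrK.
Qed.

Lemma dir_unsubK : cancel (comp_mpoly dir_unsub) (comp_mpoly dir_sub).
Proof.
apply: comp_mpolyK => i; rewrite tnth_mktuple; case: eqP => [->|/eqP im].
  by rewrite comp_mpolyXU -tnth_nth tnth_mktuple eqxx.
rewrite rmorphB rmorphM /= comp_mpolyC !comp_mpolyXU -!tnth_nth !tnth_mktuple eqxx.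
by rewrite sg_k (negPf im) tpermK addrK.
Qed.

Definition dir_poly (C : {mpoly int[N.+1]}) : {poly {mpoly int[N]}} :=
  muni (comp_mpoly dir_sub C).

Definition dir_base (y : 'I_N.+1 -> algC) (j : 'I_N) : algC :=
  evC (tnth dir_unsub (widen_ord (leqnSn N) j)) y.

Definition dir_restr (P : {poly {mpoly int[N]}}) (z : 'I_N -> algC) : {poly algC} :=
  map_poly (meval z \o map_mpoly (fun c : int => c%:~R)) P.

(** The new parameter is the k-th coordinate itself, which on the line equals y k + s because D k =
    1; hence the shift. *)
Lemma line_restr_dir C y :
  line_restr (map_mpoly (fun z : int => z%:~R) C) y (fun l => (D l)%:~R) =
  dir_restr (dir_poly C) (dir_base y) \Po ('X + (y k)%:P).
Proof.
apply: poly_ext => s; rewrite line_restrE horner_comp !hornerE -/(evC C _).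
pose z (i : 'I_N.+1) := if unlift ord_max i is Some j then dir_base y j else s + y k.
have zm : z ord_max = s + y k by rewrite /z unlift_none.
have zw j : z (widen_ord (leqnSn N) j) = dir_base y j.
  rewrite /z (_ : widen_ord _ j = lift ord_max j) ?liftK //.
  by apply/val_inj; rewrite /= /bump leqNgt ltn_ord.
have -> : dir_restr (dir_poly C) (dir_base y) =
    dir_restr (dir_poly C) (fun j => z (widen_ord (leqnSn N) j)).
  by apply: eq_map_poly => q /=; apply: meval_eq => j; rewrite zw.
rewrite -zm muni_evC evC_comp; apply: evC_ext => l.
rewrite tnth_mktuple; case: eqP => [->|/eqP lk]; first by rewrite evC_var zm Dk mulr1 addrC.
rewrite evC_add evC_mul evC_const !evC_var zm.
have [e|[j e]] := ord_max_or_widen (sg l).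
  by move: lk; rewrite -sg_max e eqxx.
rewrite e zw /dir_base tnth_mktuple -e sg_max (negPf lk) tpermK.
by rewrite evC_add evC_opp evC_mul evC_const !evC_var mulrDr; ring.
Qed.
End Direction.

Local Notation toC := (map_mpoly (fun z : int => z%:~R : algC)).

(** The identity u P + v Q = a specializes to a Bezout identity wherever a does not vanish; the
    factor [lead_coef P] of h keeps the degree of P. *)
Lemma irreducible_restr_coprime N (P Q : {poly {mpoly int[N]}}) :
  irreducible_elt P -> (1 < size P)%N -> ~ divides P Q ->
  exists h : {mpoly int[N]}, h != 0 /\ forall z, evC h z != 0 ->
    size (dir_restr P z) = size P /\ coprimep (dir_restr P z) (dir_restr Q z).
Proof.
move=> Pirr sP PQ.
have [u [v [a [a0 e]]]] := irreducible_bezout (@mpoly_factorial N) Pirr sP PQ.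
exists (lead_coef P * a); rewrite mulf_neq0 ?lead_coef_eq0 -?size_poly_gt0 ?(ltn_trans _ sP) //.
split=> // z; rewrite evC_mul mulf_eq0 negb_or => /andP[lz az].
split; first by rewrite /dir_restr size_map_poly_id0.
apply/Bezout_coprimepP; exists (dir_restr u z, dir_restr v z) => /=.
rewrite /dir_restr -!rmorphM -rmorphD /= e map_polyC /=.
by rewrite -[X in _ %= X]polyC1 !polyC_eqp1; rewrite -/(evC a z) ?az // polyC_eqp.
Qed.

Lemma evC_mwiden N (p : {mpoly int[N]}) (y : 'I_N.+1 -> algC) :
  evC (mwiden p) y = evC p (fun i => y (widen_ord (leqnSn N) i)).
Proof.
have -> : mwiden p = comp_mpoly [tuple 'X_(widen_ord (leqnSn N) i) | i < N] p.
  rewrite /mwiden /comp_mpoly /mmap; apply: eq_bigr => m _; congr (_ * _).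
  by apply: mmap1_eq => i; rewrite tnth_mktuple.
by rewrite evC_comp; apply: evC_ext => i; rewrite tnth_mktuple evC_var.
Qed.

Lemma deriv_eq0_mpoly N (p : {poly {mpoly int[N]}}) : p^`() = 0 -> (size p <= 1)%N.
Proof.
move=> p'0; rewrite leqNgt; apply/negP => sp.
have s1 : (0 < (size p).-1)%N by rewrite ltn_predRL.
have c0 : p`_(size p).-1 *+ (size p).-1 = 0.
  by have := congr1 (fun q : {poly _} => q`_(size p).-2) p'0; rewrite coef_deriv coef0 prednK.
suff : lead_coef p = 0 by move/eqP; rewrite lead_coef_eq0 -size_poly_eq0; case: (size p) sp.
apply/mpolyP => m; have /eqP := congr1 (mcoeff m) c0.
by rewrite mcoeffMn !mcoeff0 mulrn_eq0 (gtn_eqF s1) => /eqP.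
Qed.

Lemma comp_poly_coprime (F : fieldType) (p q : {poly F}) c :
  coprimep p q -> coprimep (p \Po ('X + c%:P)) (q \Po ('X + c%:P)).
Proof.
case/Bezout_coprimepP=> [[u v] /= /eqp_size]; rewrite size_poly1 => /eqP/size_poly1P[a a0 e].
apply/Bezout_coprimepP; exists (u \Po ('X + c%:P), v \Po ('X + c%:P)) => /=.
by rewrite -!comp_polyM -comp_polyD e comp_polyC -[X in _ %= X]polyC1 polyC_eqp1.
Qed.

Section DirectionElimination.
Variables (N : nat) (C : {mpoly int[N.+1]}) (D : 'I_N.+1 -> int) (k : 'I_N.+1).
Hypotheses (Cirr : mirreducible C) (Dk : D k = 1).
Local Notation restr f y := (line_restr (toC f) y (fun l => (D l)%:~R)).
Local Notation P := (dir_poly D k C).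

Lemma dir_poly_irreducible : irreducible_elt P.
Proof.
have [_ muni_irr] := iso_irreducible (@muniK int N) (@mmulti_hornerK int N) (comp_mpoly (dir_sub D k) C).
by apply: muni_irr; apply/(iso_irreducible (dir_subK D k) (dir_unsubK D k))/mirreducible_elt.
Qed.

Lemma size_restr f y : size (restr f y) = size (dir_restr (dir_poly D k f) (dir_base D k y)).
Proof. by rewrite (line_restr_dir Dk) size_comp_poly2 // size_XaddC. Qed.

Lemma dir_point (h0 : {mpoly int[N]}) : h0 != 0 -> exists h : {mpoly algC[N.+1]},
  h != 0 /\ forall y, h.@[y] = evC h0 (dir_base D k y).
Proof.
move=> h00; exists (toC (comp_mpoly (dir_unsub D k) (mwiden h0))); split.
  rewrite map_intr_eq0 -(rmorph0 (comp_mpoly (dir_unsub D k))) (can_eq (dir_unsubK D k)).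
  by rewrite -(mwiden0 N int) (inj_eq (@inj_mwiden N int)).
by move=> y; rewrite -/(evC _ y) evC_comp evC_mwiden.
Qed.

Hypothesis Cdep : exists y, (1 < size (restr C y))%N.

Lemma size_dir_poly : (1 < size P)%N.
Proof. by have [y] := Cdep; rewrite size_restr => /leq_trans; apply; apply: size_poly. Qed.

(** Stands in for the Nullstellensatz: if f vanished at the zeros of C on a generic line, C would
    divide f, because C is nonconstant on that line and so has a root there. *)
Lemma dir_elim f : ~ divides C f ->
  exists h : {mpoly algC[N.+1]}, h != 0 /\ forall y, h.@[y] != 0 ->
    (1 < size (restr C y))%N /\ coprimep (restr C y) (restr f y).
Proof.
move=> CNf.
have [|h0 [/dir_point[h [h1 hE]] H]] := irreducible_restr_coprime (Q := dir_poly D k f)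
    dir_poly_irreducible size_dir_poly.
  have [muni_div _] := iso_divides (@muniK int N) (@mmulti_hornerK int N)
    (comp_mpoly (dir_sub D k) C) (comp_mpoly (dir_sub D k) f).
  by move/muni_div/(iso_divides (dir_subK D k) (dir_unsubK D k)).
exists h; split=> // y; rewrite hE => /H[sz cop].
rewrite size_restr sz size_dir_poly !(line_restr_dir Dk); split=> //.
exact: comp_poly_coprime.
Qed.

(** The same elimination with the derivative in place of f: P does not divide its derivative for
    degree reasons. Preserving the leading coefficient also makes the degree on the line maximal. *)
Lemma dir_separable :
  exists h : {mpoly algC[N.+1]}, h != 0 /\ forall y, h.@[y] != 0 ->
    (forall y', (size (restr C y') <= size (restr C y))%N) /\
    coprimep (restr C y) (restr C y)^`().
Proof.
have sP := size_dir_poly.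
have [|h0 [/dir_point[h [h1 hE]] H]] := irreducible_restr_coprime (Q := P^`())
    dir_poly_irreducible size_dir_poly.
  move=> [q e]; have [q0|q0] := eqVneq q 0.
    by move: sP; rewrite ltnNge deriv_eq0_mpoly // e q0 mul0r.
  have P0 : P != 0 by rewrite -size_poly_gt0 ltnW.
  have := lt_size_deriv P0; rewrite e size_mul // -subn1 ltn_subLR ?addn_gt0 ?size_poly_gt0 ?q0 //.
  by rewrite ltn_add2r ltnS leqn0 size_poly_eq0 (negPf q0).
exists h; split=> // y; rewrite hE => /H[sz cop]; split.
  by move=> y'; rewrite !size_restr sz; apply: size_poly.
rewrite (line_restr_dir Dk) deriv_comp derivD derivX derivC addr0 mulr1.
rewrite (_ : (dir_restr P _)^`() = dir_restr P^`() (dir_base D k y)); last by rewrite /dir_restr deriv_map.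
exact: comp_poly_coprime.
Qed.

End DirectionElimination.

Section LineElimination.
Variables (N : nat) (C : {mpoly int[N]}) (D : 'I_N -> int) (k : 'I_N).
Hypotheses (Cirr : mirreducible C) (Dk : D k = 1).
Local Notation restr f y := (line_restr (toC f) y (fun l => (D l)%:~R)).
Hypothesis Cdep : exists y, (1 < size (restr C y))%N.

Lemma line_elim (f : {mpoly int[N]}) : ~ divides C f ->
  exists h : {mpoly algC[N]}, h != 0 /\ forall y, h.@[y] != 0 ->
    (1 < size (restr C y))%N /\ coprimep (restr C y) (restr f y).
Proof. by case: N C D k Cirr Dk Cdep f => [|N'] C' D' k'; [case: k' | apply: dir_elim]. Qed.

Lemma line_separable :
  exists h : {mpoly algC[N]}, h != 0 /\ forall y, h.@[y] != 0 ->
    (forall y', (size (restr C y') <= size (restr C y))%N) /\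
    coprimep (restr C y) (restr C y)^`().
Proof. by case: N C D k Cirr Dk Cdep => [|N'] C' D' k'; [case: k' | apply: dir_separable]. Qed.

End LineElimination.

(** * The dual Chow form on pairs of column vectors *)

Definition dot (b c : int * int) : int := b.1 * c.1 + b.2 * c.2.
Definition posn (z : int) : nat := `|Num.max z 0|%N.

Lemma posn_eq0 z : z <= 0 -> posn z = 0%N.
Proof. by move=> z0; rewrite /posn max_r. Qed.

Lemma posn_ge0 z : 0 <= z -> (posn z)%:Z = z.
Proof. by move=> z0; rewrite /posn max_l // gez0_abs. Qed.

Lemma posnE z : z = (posn z)%:Z - (posn (- z))%:Z.
Proof.
have [z0|z0] := leP 0 z; first by rewrite posn_ge0 // [posn (- z)]posn_eq0 ?subr0 // oppr_le0.
by rewrite posn_eq0 ?ltW // posn_ge0 ?oppr_ge0 ?ltW // sub0r opprK.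
Qed.

Lemma ord2_cases (j : 'I_2) : j = 0 \/ j = 1.
Proof. by case: j => [[|[|//]] ?]; [left|right]; apply/val_inj. Qed.

Lemma det2E (R : comNzRingType) (M : 'M[R]_2) : \det M = M 0 0 * M 1 1 - M 0 1 * M 1 0.
Proof.
rewrite (expand_det_row _ 0) !big_ord_recl big_ord0 /cofactor !det_mx11 !mxE /= expr0 expr1.
have -> : lift 0 0 = 1 :> 'I_2 by apply/val_inj.
have -> : lift 1 0 = 0 :> 'I_2 by apply/val_inj.
by rewrite mul1r mulN1r mulrN addr0.
Qed.

Section Pairs.
Variable n : nat.
Implicit Types (p q x z : 'I_n -> algC).

Definition ptY p q : 'I_(n * 2) -> algC :=
  fun l => mxvec (\matrix_(i < n, j < 2) if j == 0 then p i else q i) 0 l.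

Definition vrow (l : 'I_(n * 2)) : 'I_n := (enum_val (cast_ord (esym (mxvec_cast n 2)) l)).1.

Lemma vrow_index i j : vrow (mxvec_index i j) = i.
Proof. by rewrite /vrow /mxvec_index cast_ordK enum_rankK. Qed.

Lemma ptY_index p q i j : ptY p q (mxvec_index i j) = if j == 0 then p i else q i.
Proof. by rewrite /ptY mxvecE mxE. Qed.

Lemma ptY_surj (y : 'I_(n * 2) -> algC) :
  y =1 ptY (fun i => y (mxvec_index i 0)) (fun i => y (mxvec_index i 1)).
Proof.
move=> l; case/mxvec_indexP: l => i j; rewrite ptY_index.
by have [->|->] := ord2_cases j.
Qed.

Definition br p q (i j : 'I_n) := p i * q j - q i * p j.

Lemma rank2_br p q i j : br p q i j != 0 ->
  \rank (\matrix_(i < n, j < 2) (if j == 0 then p i else q i)) = 2%N.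
Proof.
move=> b0; set Y := \matrix_(_, _) _.
pose f (k : 'I_2) := if k == 0 then i else j.
apply/eqP; rewrite eqn_leq rank_leq_col /=.
have r2 : \rank (rowsub f Y) = 2%N.
  apply/eqP; rewrite -[_ == _]/(row_free _) row_free_unit unitmxE unitfE.
  rewrite det2E !mxE /f /=; apply: contraNneq b0; rewrite /br => <-; apply/eqP; ring.
by rewrite -[X in (X <= _)%N]r2 rowsubE mxrankM_maxr.
Qed.

Variable B : 'M[int]_(n, 2).
(** This is the vector B c; when the columns of B form a basis of the kernel lattice, c runs over
    the whole lattice. [mpos] and [mneg] are the two monomials of its binomial. *)
Definition wt (c : int * int) (l : 'I_n) : int := dot (rowB B l) c.
Definition mpos (c : int * int) x := \prod_l x l ^+ posn (wt c l).
Definition mneg (c : int * int) x := \prod_l x l ^+ posn (- wt c l).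
Definition inX x := forall c, mpos c x = mneg c x.

Variable C : {mpoly int[n * 2]}.
Definition CL p q := evC C (ptY p q).

Definition rowdeg (m : 'X_{1..n * 2}) : 'X_{1..n} :=
  [multinom (m (mxvec_index i 0%R) + m (mxvec_index i 1%R))%N | i < n].

Definition rowpart (e : 'X_{1..n}) : {mpoly int[n * 2]} :=
  \sum_(m <- msupp C | rowdeg m == e) C@_m *: 'X_[m].

(* [CF p q] is the polynomial z |-> C (diag z * (p q)), where (p q) is the matrix with columns p and q.
   The exponents that occur for some p, q ([rowexp] below) are the degrees of C in the rows of Y;
   those of [CF] at the columns of B give, after e |-> D - e, the exponents of the full discriminant. *)
Definition CF p q : {mpoly algC[n]} :=
  \sum_(m <- msupp C) ((C@_m)%:~R * \prod_i ptY p q i ^+ m i) *: 'X_[rowdeg m].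

Lemma prod_index (R : comNzRingType) (F : 'I_(n * 2) -> R) :
  \prod_l F l = \prod_i (F (mxvec_index i 0) * F (mxvec_index i 1)).
Proof.
rewrite (reindex _ (curry_mxvec_bij _ _)) /=.
rewrite (eq_bigr (fun ij => F (mxvec_index ij.1 ij.2))); last by case.
rewrite -(pair_bigA _ (fun i j => F (mxvec_index i j))) /=.
by apply: eq_bigr => i _; rewrite big_ord_recl big_ord1; congr (_ * F (mxvec_index _ _)); apply/val_inj.
Qed.

Lemma CF_eval p q z : (CF p q).@[z] = CL (fun i => z i * p i) (fun i => z i * q i).
Proof.
rewrite /CF raddf_sum /CL evCE; apply: eq_bigr => m _ /=; rewrite mevalZ mevalX -mulrA; congr (_ * _).
rewrite !prod_index -big_split; apply: eq_bigr => i _ /=.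
by rewrite !ptY_index mnmE /= !exprMn exprD [RHS]mulrACA mulrC.
Qed.

Lemma CF_coef p q e : (CF p q)@_e = evC (rowpart e) (ptY p q).
Proof.
rewrite /CF raddf_sum /rowpart evC_sum [RHS]big_mkcond; apply: eq_bigr => m _ /=.
rewrite mcoeffZ mcoeffX; case: eqP => _; last by rewrite mulr0.
by rewrite mulr1 -mul_mpolyC evC_mul evC_const mpolyXE_id evC_prod; congr (_ * _); apply: eq_bigr => i _; rewrite evC_exp evC_var.
Qed.

Definition rowexp e := exists p q, (CF p q)@_e != 0.

Lemma rowexp_supp e : rowexp e -> exists2 m, m \in msupp C & rowdeg m = e.
Proof.
case=> p [q]; rewrite CF_coef => H; apply: NNPP => N; move/eqP: H; apply.
rewrite /rowpart big1_seq ?/evC ?raddf0 ?meval0 // => m /andP[/eqP me ms].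
by case: N; exists m.
Qed.

(** Distinct monomials of C with the same row degrees do not cancel: their sum [rowpart] is a
    nonzero polynomial, hence nonzero at some pair. *)
Lemma supp_rowexp m : m \in msupp C -> rowexp (rowdeg m).
Proof.
move=> mC; have : map_mpoly (fun z : int => z%:~R : algC) (rowpart (rowdeg m)) != 0.
  rewrite map_intr_eq0; apply/eqP => /(congr1 (mcoeff m)) /eqP; rewrite mcoeff0 /rowpart raddf_sum.
  rewrite -big_filter (bigD1_seq m) ?mem_filter ?eqxx ?filter_uniq ?msupp_uniq //=.
  rewrite mcoeffZ mcoeffX eqxx mulr1 big1 => [|m' mm']; last first.
    by rewrite mcoeffZ mcoeffX (negPf mm') mulr0.
  by rewrite addr0 mcoeff_eq0 mC.
move=> /mpoly_nonroot[y]; rewrite -/(evC _ y) (evC_ext _ (ptY_surj y)) -CF_coef => H.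
by exists (fun i => y (mxvec_index i 0)), (fun i => y (mxvec_index i 1)).
Qed.

End Pairs.

(** * Torus invariance and multihomogeneity of the Chow form *)

Lemma unit_steps N (T : Type) (g : ('I_N -> algC) -> T) :
  (forall y y', y =1 y' -> g y = g y') ->
  (forall k y s, g (fun l => y l + s * (l == k)%:R) = g y) ->
  forall y y', g y = g y'.
Proof.
move=> gE gs y y'.
pose h j := fun i : 'I_N => if (i < j)%N then y' i else y i.
have hj j : (j <= N)%N -> g (h j) = g y.
  elim: j => [|j IH] jN; first by apply: gE.
  rewrite -IH ?(ltnW jN) // -[RHS](gs (Ordinal jN) _ (y' (Ordinal jN) - y (Ordinal jN))).
  apply: gE => i; rewrite /h ltnS -val_eqE /=; case: (ltngtP i j) => ij; rewrite ?mulr0 ?addr0 //.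
  by rewrite mulr1 (_ : i = Ordinal jN) ?subrKC //; apply/val_inj.
by rewrite -(hj N) //; apply: gE => i; rewrite /h ltn_ord.
Qed.

Lemma sum_nat_int (I : finType) (F : I -> nat) : (\sum_i F i)%N%:Z = \sum_i (F i)%:Z.
Proof. exact: (big_morph _ PoszD). Qed.

Section Torus.
Variables (n : nat) (B : 'M[int]_(n, 2)).
Implicit Types (c : int * int) (x u : 'I_n -> algC).

Lemma mposM c u x : mpos B c (fun l => u l * x l) = mpos B c u * mpos B c x.
Proof. by rewrite /mpos -big_split; apply: eq_bigr => l _; rewrite exprMn. Qed.

Lemma mnegM c u x : mneg B c (fun l => u l * x l) = mneg B c u * mneg B c x.
Proof. by rewrite /mneg -big_split; apply: eq_bigr => l _; rewrite exprMn. Qed.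

Lemma inXM u x : inX B u -> inX B x -> inX B (fun l => u l * x l).
Proof. by move=> uX xX c; rewrite mposM mnegM uX xX. Qed.

Lemma inX_ext x x' : x =1 x' -> inX B x -> inX B x'.
Proof.
move=> e xX c; have := xX c.
by rewrite /mpos /mneg; under eq_bigr do rewrite e; under [in RHS]eq_bigr do rewrite e.
Qed.

Lemma sum_posn (eta : 'I_n -> nat) c : \sum_l (eta l)%:Z * wt B c l = 0 ->
  (\sum_l eta l * posn (wt B c l) = \sum_l eta l * posn (- wt B c l))%N.
Proof.
move=> s0; apply/eqP; rewrite -eqz_nat !sum_nat_int -subr_eq0 -sumrB.
apply/eqP; rewrite -[RHS]s0; apply: eq_bigr => l _.
by rewrite !PoszM -mulrBr -posnE.
Qed.

(** Both monomials become powers of t with equal natural exponents, so t = 0 is allowed as well. *)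
Lemma inX_oneparam (eta : 'I_n -> nat) t :
  (forall c, \sum_l (eta l)%:Z * wt B c l = 0) -> inX B (fun l => t ^+ eta l).
Proof.
move=> H c; rewrite /mpos /mneg; under eq_bigr do rewrite -exprM.
under [RHS]eq_bigr do rewrite -exprM.
by rewrite -!expr_sum sum_posn.
Qed.

Hypothesis sumB : forall c, \sum_l wt B c l = 0.

Lemma inX_scale t x : inX B x -> inX B (fun l => t * x l).
Proof.
move=> xX; apply: (inXM (u := fun=> t)) => // c.
have := @inX_oneparam (fun=> 1%N) t; apply => c'.
by rewrite -[RHS](sumB c'); apply: eq_bigr => l _; rewrite mul1r.
Qed.

End Torus.

Section Chow.
Variables (n : nat) (B : 'M[int]_(n, 2)) (C : {mpoly int[n * 2]}).
Hypothesis n3 : (2 < n)%N.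
Hypothesis Cirr : mirreducible C.
Hypothesis Czero : forall p q i j, br p q i j != 0 ->
  CL C p q = 0 <-> exists s t, (s, t) != (0, 0) /\ inX B (fun l => s * p l + t * q l).

Lemma inX_scale2 (p q u : 'I_n -> algC) s t :
  inX B u -> inX B (fun l => s * p l + t * q l) ->
  inX B (fun l => s * (u l * p l) + t * (u l * q l)).
Proof.
move=> uX xX; apply: inX_ext (inXM uX xX) => l.
by rewrite mulrDr !(mulrCA (u l)).
Qed.

Lemma CL_torus u p q i j : (forall l, u l != 0) -> inX B u -> br p q i j != 0 ->
  CL C p q = 0 -> CL C (fun l => u l * p l) (fun l => u l * q l) = 0.
Proof.
move=> u0 uX pq /(Czero pq)[s [t [st xX]]].
apply/(Czero (i := i) (j := j)); last by exists s, t; split=> //; apply: inX_scale2.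
have -> : br (fun l => u l * p l) (fun l => u l * q l) i j = u i * u j * br p q i j by rewrite /br; ring.
by rewrite !mulf_neq0.
Qed.

Lemma CL_zero_exists : exists y, evC C y = 0.
Proof.
pose i0 := Ordinal (ltnW (ltnW n3)); pose i1 := Ordinal (ltnW n3).
exists (ptY (fun=> 1) (fun l => (l == i1)%:R)).
apply/(Czero (i := i0) (j := i1)).
  by rewrite /br /= mul1r mul0r subr0 oner_eq0.
exists 1, 0; split; first by rewrite xpair_eqE oner_eq0.
by move=> c; rewrite /mpos /mneg !big1 // => l _; rewrite mulr1 mul0r addr0 expr1n.
Qed.

Lemma C_dep : exists k y, (1 < size (line_restr (map_mpoly (fun z : int => z%:~R) C) y
   (fun l => ((l == k)%:R : int)%:~R)))%N.
Proof.
apply: NNPP => N; have [y0 y00] := CL_zero_exists.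
have C0 : map_mpoly (fun z : int => z%:~R : algC) C != 0 by rewrite map_intr_eq0; case: Cirr.
have [y1] := mpoly_nonroot C0; rewrite -/(evC C y1) (unit_steps (g := evC C) _ _ y1 y0) ?y00 ?eqxx //.
  by move=> y y'; apply: evC_ext.
move=> k y s; set P := line_restr (map_mpoly (fun z : int => z%:~R) C) y (fun l => ((l == k)%:R : int)%:~R).
have /size1_polyC cP : (size P <= 1)%N by rewrite leqNgt; apply/negP => H; apply: N; exists k, y.
have ev s' : evC C (fun l => y l + s' * (l == k)%:R) = P.[s'].
  by rewrite /P line_restrE -/(evC C _); apply: evC_ext => l; rewrite natz.
have -> : evC C y = P.[0] by rewrite -ev; apply: evC_ext => l; rewrite mul0r addr0.
by rewrite ev cP !hornerC.
Qed.

Definition gradepart (eta : 'I_n -> nat) (kp : nat) : {mpoly int[n * 2]} :=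
  \sum_(m <- msupp C | (\sum_i eta i * rowdeg m i == kp)%N) C@_m *: 'X_[m].

Lemma gradepart_coef eta kp m : (gradepart eta kp)@_m =
  if (\sum_i eta i * rowdeg m i == kp)%N then C@_m else 0.
Proof.
rewrite /gradepart raddf_sum /=.
have [mC|mC] := boolP (m \in msupp C); last first.
  rewrite (memN_msupp_eq0 mC) if_same big1_seq // => m' /andP[_ m'C].
  rewrite mcoeffZ mcoeffX; case: eqP => [e|_]; last by rewrite mulr0.
  by rewrite -e m'C in mC.
case: ifP => e; last first.
  rewrite big1 // => m' e'; rewrite mcoeffZ mcoeffX; case: eqP => [mm|_]; last by rewrite ?mulr0n mulr0.
  by rewrite mm e in e'.
rewrite -big_filter (bigD1_seq m) ?mem_filter ?e ?filter_uniq ?msupp_uniq //=.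
rewrite mcoeffZ mcoeffX eqxx mulr1 big1 ?addr0 // => m' mm'.
by rewrite mcoeffZ mcoeffX (negPf mm') mulr0.
Qed.

(** The values of the graded parts at (p, q) are the coefficients of G(t), the value of C on the
    line moved by the one-parameter subgroup; G vanishes for all nonzero t, hence identically. *)
Lemma gradepart_zero eta p q i j :
  (forall c, \sum_l (eta l)%:Z * wt B c l = 0) -> br p q i j != 0 ->
  CL C p q = 0 -> forall kp, evC (gradepart eta kp) (ptY p q) = 0.
Proof.
move=> Heta pq Cpq kp.
pose M := \max_(m <- msupp C) (\sum_i eta i * rowdeg m i)%N.
pose G : {poly algC} := \poly_(k < M.+1) evC (gradepart eta k) (ptY p q).
have Gt t : G.[t] = CL C (fun l => t ^+ eta l * p l) (fun l => t ^+ eta l * q l).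
  rewrite /G horner_poly -CF_eval /CF raddf_sum /=.
  under eq_bigr do rewrite /gradepart evC_sum big_distrl /= big_mkcond /=.
  rewrite exchange_big; apply: eq_big_seq => m mC.
  have mM : (\sum_i eta i * rowdeg m i < M.+1)%N by rewrite ltnS /M; apply: (leq_bigmax_seq (F := fun m => (\sum_i eta i * rowdeg m i)%N)).
  move: mM; set sm := (\sum_i _)%N => mM.
  rewrite (bigD1 (Ordinal mM)) //= eqxx big1 ?addr0 => [|k]; last first.
    by rewrite -val_eqE /= eq_sym => /negPf ->.
  rewrite -mul_mpolyC evC_mul evC_const mevalZ mevalX mpolyXE_id evC_prod; congr (_ * _ * _).
    by apply: eq_bigr => l _; rewrite evC_exp evC_var.
  by rewrite /sm expr_sum; apply: eq_bigr => l _; rewrite exprM.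
have G0 : G = 0.
  apply/eqP; apply/negPn/negP => G0; have : G * 'X != 0 by rewrite mulf_neq0 ?polyX_eq0.
  move=> /poly_nonroot[t]; rewrite hornerM hornerX mulf_eq0 negb_or => /andP[+ t0].
  rewrite Gt (CL_torus (i := i) (j := j)) ?eqxx // => [l|]; first by rewrite expf_neq0.
  exact: inX_oneparam.
have [kM|kM] := ltnP kp M.+1.
  by have := congr1 (fun P : {poly _} => P`_kp) G0; rewrite coef_poly kM coef0.
rewrite (_ : gradepart _ _ = 0) ?/evC ?raddf0 ?meval0 //.
rewrite /gradepart big1_seq // => m /andP[/eqP e mC].
by move: kM; rewrite -e ltnNge (leq_bigmax_seq (F := fun m => (\sum_i eta i * rowdeg m i)%N)).
Qed.

Lemma third_rows (i : 'I_n) : exists a b, [/\ a != b, a != i & b != i].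
Proof.
have : (1 < #|[set~ i]|)%N by rewrite cardsC1 card_ord; case: n n3 => [|[]].
case/card_gt1P=> a [b []]; rewrite !inE => ai bi ab.
by exists a, b.
Qed.

(** A graded part Ck vanishes at the zeros of C, so C divides it; by comparison of degrees Ck is a
    constant multiple of C, and therefore every monomial of C has weight kp. *)
Lemma rowexp_graded eta : (forall c, \sum_l (eta l)%:Z * wt B c l = 0) ->
  forall e e', rowexp C e -> rowexp C e' ->
  (\sum_i eta i * e i = \sum_i eta i * e' i)%N.
Proof.
move=> Heta e e' /rowexp_supp[m mC <-] /rowexp_supp[m' m'C <-].
set kp := (\sum_i _)%N; pose Ck := gradepart eta kp.
have Ckm : Ck@_m = C@_m by rewrite gradepart_coef eqxx.
have Ck0 : Ck != 0.
  by apply: contraTneq mC => Ck0; rewrite -mcoeff_eq0 -Ckm Ck0 mcoeff0.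
have [[r Cr]|N] := classic (divides C Ck).
  have C0 : C != 0 by case: Cirr.
  have r0 : r != 0 by apply: contraNneq Ck0 => r0; rewrite Cr r0 mul0r.
  have : (msize Ck <= msize C)%N.
    rewrite [X in (X <= _)%N]msizeE; apply/bigmax_leqP_seq => m1 m1C _; apply: msize_mdeg_lt.
    by move: m1C; rewrite !mcoeff_msupp gradepart_coef; case: ifP; rewrite ?eqxx.
  rewrite Cr msizeM // -subn1 leq_subLR leq_add2r => /msize1_polyC rE.
  apply/eqP; have := gradepart_coef eta kp m'; rewrite -/Ck Cr rE mul_mpolyC mcoeffZ eq_sym.
  case: ifP => // _ /eqP; rewrite mulf_eq0 [C@_m' == 0]mcoeff_eq0 m'C orbF => /eqP r00.
  by case/eqP: r0; rewrite rE r00.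
have [k Cdep] := C_dep.
have [|h [h0 H]] := line_elim (D := fun l => (l == k)%:R) (k := k) Cirr _ Cdep N; first by rewrite eqxx.
(* Along the line only one entry of Y changes. Two rows away from it keep their bracket, whose
   nonvanishing at y is part of the generic condition. *)
have [a [b [ab ak bk]]] := third_rows (vrow k).
pose brp : {mpoly algC[n * 2]} := 'X_(mxvec_index a 0) * 'X_(mxvec_index b 1) - 'X_(mxvec_index a 1) * 'X_(mxvec_index b 0).
have brp0 : brp != 0.
  apply/eqP => /(congr1 (meval (ptY (fun l => (l == a)%:R) (fun l => (l == b)%:R)))).
  rewrite /brp mevalB !mevalM !mevalXU !ptY_index /= meval0 !eqxx [a == b](negPf ab).
  by rewrite mul1r mul0r subr0 => /eqP; rewrite oner_eq0.
have [y] := mpoly_nonroot (mulf_neq0 h0 brp0).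
rewrite mevalM mulf_eq0 negb_or => /andP[/H[sz cop] yb].
have /closed_rootP[s] : size (line_restr (map_mpoly (fun z : int => z%:~R) C) y
   (fun l => ((l == k)%:R : int)%:~R)) != 1%N by rewrite gtn_eqF.
move=> rs; have := coprimep_root cop rs; move: rs.
rewrite rootE !line_restrE -/(evC C _) -/(evC Ck _).
set y' := fun l => _; rewrite (evC_ext C (ptY_surj y')) (evC_ext Ck (ptY_surj y')) => /eqP Cy'.
rewrite (@gradepart_zero eta _ _ a b) ?eqxx //.
have kout (i : 'I_n) j : i != vrow k -> y' (mxvec_index i j) = y (mxvec_index i j).
  move=> ik; rewrite /y' (_ : (mxvec_index i j == k) = false) ?mulr0 ?addr0 //.
  by apply: contraNF ik => /eqP <-; rewrite vrow_index.
move: yb; rewrite /brp mevalB !mevalM !mevalXU /br !kout //.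
Qed.

End Chow.

(** * Extreme exponents of C survive at B *)

Lemma poly_nonroot_small (p : {poly algC}) (d : algC) : p != 0 -> 0 < d ->
  exists2 s, `|s| <= d & p.[s] != 0.
Proof.
move=> p0 d0; apply: NNPP => N.
have : all (root p) [seq d / i.+1%:R | i <- iota 0 (size p)].
  apply/allP => x /mapP[i _ ->]; rewrite rootE; apply/negPn/negP => H; apply: N.
  exists (d / i.+1%:R) => //.
  rewrite ger0_norm ?divr_ge0 ?ler0n ?(ltW d0) //.
  by rewrite ler_pdivrMr ?ltr0n // ler_peMr ?ler1n ?(ltW d0).
move=> /(max_poly_roots p0); rewrite map_inj_uniq ?iota_uniq => [/(_ isT)|].
  by rewrite size_map size_iota ltnn.
move=> i j /(mulfI (lt0r_neq0 d0)) /invr_inj /eqP; rewrite eqr_nat => /eqP[].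
by [].
Qed.

(** Each linear factor obeys |s0 - r| <= |s0| + |r| <= 2 |r|. *)
Lemma no_small_root (P : {poly algC}) (S : nat) (d s0 : algC) :
  (size P <= S.+1)%N -> `|s0| <= d -> (forall s, root P s -> d <= `|s|) ->
  `|P.[s0]| <= 2 ^+ S * `|P.[0]|.
Proof.
move=> sP s0d H; have [-> |P0] := eqVneq P 0; first by rewrite !horner0 normr0 mulr0.
have [r Pr] := closed_field_poly_normal P.
have sr : (size r <= S)%N.
  move: sP; rewrite Pr size_scale ?lead_coef_eq0 // size_prod_XsubC ltnS //.
have rr x : x \in r -> d <= `|x|.
  move=> xr; apply: H; rewrite Pr rootZ ?lead_coef_eq0 //.
  by rewrite root_prod_XsubC.
rewrite Pr !hornerZ !normrM mulrCA ler_wpM2l //.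
apply: (@le_trans _ _ (2 ^+ size r * `|(\prod_(z <- r) ('X - z%:P)).[0]|)); last first.
  by rewrite ler_wpM2r // ler_eXn2l ?ltr1n.
elim: r rr {Pr sr} => [|x r IH] rr; first by rewrite !big_nil !hornerE /= ?expr0 ?mul1r.
rewrite !big_cons !hornerM !normrM exprS mulrACA ler_pM //.
  rewrite !hornerE ?sub0r normrN mulr_natl mulr2n.
  apply: le_trans (ler_normB _ _) _; rewrite lerD2r (le_trans s0d) // rr ?mem_head //.
by apply: IH => y yr; apply: rr; rewrite inE yr orbT.
Qed.

Lemma size_line_restr N (p : {mpoly algC[N]}) y D : (size (line_restr p y D) <= msize p)%N.
Proof.
rewrite /line_restr /mmap; apply: (leq_trans (size_sum _ _ _)).
apply/bigmax_leqP_seq => m mp _; apply: leq_trans (msize_mdeg_lt mp).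
rewrite mul_polyC (leq_trans (size_scale_leq _ _)) // /mmap1.
have lin l : (size ((y l)%:P + D l *: 'X)%R <= 2)%N.
  rewrite (leq_trans (size_polyD _ _)) // geq_max (leq_trans (size_polyC_leq1 _)) //=.
  by rewrite (leq_trans (size_scale_leq _ _)) // size_polyX.
rewrite mdegE; elim/big_ind2: _ => [|a b c d|l _].
- by rewrite size_poly1.
- move=> ab cd; rewrite (leq_trans (size_polyMleq _ _)) // -subn1 leq_subLR.
  by rewrite (leq_trans (leq_add ab cd)) // addSn addnS.
rewrite (leq_trans (size_poly_exp_leq _ _)) // ltnS -[X in (_ <= X)%N]mul1n leq_mul2r.
by rewrite -subn1 leq_subLR lin orbT.
Qed.

Lemma ptY_ext n (p p' q q' : 'I_n -> algC) : p =1 p' -> q =1 q' -> ptY p q =1 ptY p' q'.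
Proof. by move=> ep eq l; case/mxvec_indexP: l => i j; rewrite !ptY_index ep eq. Qed.

Lemma CL_ext n (C : {mpoly int[n * 2]}) p p' q q' : p =1 p' -> q =1 q' -> CL C p q = CL C p' q'.
Proof. by move=> ep eq; apply/evC_ext/ptY_ext. Qed.

Lemma CF_coef_ext n (C : {mpoly int[n * 2]}) p p' q q' e :
  p =1 p' -> q =1 q' -> (CF C p q)@_e = (CF C p' q')@_e.
Proof. by move=> ep eq; rewrite !CF_coef; apply/evC_ext/ptY_ext. Qed.

Section SmallRoot.
Variables (n : nat) (C : {mpoly int[n * 2]}) (b1 b2 v1 v2 : 'I_n -> algC).
Variables (om : 'I_n -> nat) (e : 'X_{1..n}).
Local Notation weight e := (\sum_l om l * e l)%N.
Hypothesis emax : forall e', rowexp C e' -> e' != e -> (weight e' < weight e)%N.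
Hypothesis e0 : (CF C b1 b2)@_e = 0.
Hypothesis e1 : (CF C (fun l => b1 l + v1 l) (fun l => b2 l + v2 l))@_e != 0.

Let P1 s l := b1 l + s * v1 l.
Let P2 s l := b2 l + s * v2 l.

Lemma ptY_line s : ptY (P1 s) (P2 s) =1 (fun l => ptY b1 b2 l + s * ptY v1 v2 l).
Proof.
move=> l; case/mxvec_indexP: l => i j; rewrite !ptY_index.
by case: ifP.
Qed.

Lemma CF_leading s : exists2 K, 0 <= K & forall T : nat, (0 < T)%N ->
  `|CL C (fun l => T%:R ^+ om l * P1 s l) (fun l => T%:R ^+ om l * P2 s l)
    - T%:R ^+ weight e * (CF C (P1 s) (P2 s))@_e| * T%:R <= T%:R ^+ weight e * K.
Proof.
pose a m := (C@_m)%:~R * \prod_i ptY (P1 s) (P2 s) i ^+ m i.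
exists (\sum_(m <- msupp C) `|a m|); first by apply: sumr_ge0 => m _; apply: normr_ge0.
move=> T T0; have T1 : 1 <= T%:R :> algC by rewrite ler1n.
rewrite -CF_eval CF_coef /CF raddf_sum /rowpart evC_sum mulr_sumr [X in _ - X]big_mkcond /=.
rewrite -sumrB mulr_sumr; apply: (@le_trans _ _ ((\sum_(m <- msupp C)
    if rowdeg m == e then 0 else `|a m| * T%:R ^+ weight (rowdeg m)) * T%:R)); last first.
  rewrite mulr_suml big_seq [leRHS]big_seq; apply: ler_sum => m mC; case: eqP => [_|/eqP me].
    by rewrite mul0r mulr_ge0 ?exprn_ge0.
  rewrite -mulrA -exprSr mulrC ler_wpM2r // ler_weXn2l //.
  by apply: emax => //; apply: supp_rowexp.
rewrite ler_wpM2r // (le_trans (ler_norm_sum _ _ _)) // ler_sum // => m _.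
rewrite mevalZ mevalX -/(a m).
have -> : \prod_i (T%:R ^+ om i) ^+ rowdeg m i = T%:R ^+ weight (rowdeg m) :> algC.
  by rewrite expr_sum; apply: eq_bigr => l _; rewrite exprM.
case: eqP => [<-|_]; last by rewrite subr0 normrM [X in _ * X]ger0_norm ?exprn_ge0.
rewrite -mul_mpolyC evC_mul evC_const mpolyXE_id evC_prod.
under [X in _ - _ * (_ * X)]eq_bigr do rewrite evC_exp evC_var.
by rewrite -/(a m) mulrC subrr normr0.
Qed.

(** At s0 the scaled form has size about T^(weight e); at s = 0 it is smaller by a factor T, because
    the coefficient of e vanishes there. For large T this contradicts [no_small_root] unless some
    root has modulus less than d. *)
Lemma small_root d : 0 < d -> exists T0 : nat, forall T, (T0 <= T)%N -> (0 < T)%N ->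
  exists2 s, `|s| < d & CL C (fun l => T%:R ^+ om l * P1 s l) (fun l => T%:R ^+ om l * P2 s l) = 0.
Proof.
move=> d0; pose G := line_restr (map_mpoly (fun z : int => z%:~R) (rowpart C e)) (ptY b1 b2) (ptY v1 v2).
have GE s : G.[s] = (CF C (P1 s) (P2 s))@_e.
  by rewrite /G line_restrE CF_coef -/(evC _ _); apply: evC_ext => l; rewrite ptY_line.
have G0 : G != 0.
  apply: contraNneq e1 => G0; have := GE 1; rewrite G0 horner0 => ->; apply/eqP.
  by apply: CF_coef_ext => l; rewrite ?/P1 ?/P2 ?mul1r.
have [s0 s0d Gs0] := poly_nonroot_small G0 d0.
have [K K0 HK] := CF_leading 0; have [L L0 HL] := CF_leading s0.
pose S := msize (map_mpoly (fun z : int => z%:~R : algC) C).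
(* The bound on T that would follow if no root were smaller than d. *)
pose bd := (2 ^+ S * K + L) / `|G.[s0]|.
have bd0 : 0 <= bd by rewrite divr_ge0 // addr_ge0 // mulr_ge0 // exprn_ge0.
exists (Num.bound bd) => T bT T0; have T0' : 0 < T%:R :> algC by rewrite ltr0n.
pose Q := line_restr (map_mpoly (fun z : int => z%:~R) C)
  (ptY (fun l => T%:R ^+ om l * b1 l) (fun l => T%:R ^+ om l * b2 l))
  (ptY (fun l => T%:R ^+ om l * v1 l) (fun l => T%:R ^+ om l * v2 l)).
have QE s : Q.[s] = CL C (fun l => T%:R ^+ om l * P1 s l) (fun l => T%:R ^+ om l * P2 s l).
  rewrite /Q line_restrE -/(evC _ _); apply: evC_ext => l; case/mxvec_indexP: l => i j.
  by rewrite !ptY_index /P1 /P2; case: ifP => _; rewrite mulrDr mulrCA.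
apply: NNPP => N.
have Qroot : forall s, root Q s -> d <= `|s|.
  move=> s rs; rewrite real_leNgt ?(gtr0_real d0) ?normr_real //; apply/negP => sd; apply: N.
  by exists s => //; rewrite -QE; apply/eqP.
have := no_small_root (leqW (size_line_restr _ _ _)) s0d Qroot; rewrite !QE => HQ.
have := HK T T0; have := HL T T0; rewrite -!GE.
have -> : G.[0] = 0.
  by rewrite GE -[RHS]e0; apply: CF_coef_ext => l; rewrite ?/P1 ?/P2 ?mul0r ?addr0.
set X := CL _ _ _ in HQ *; set Y := CL _ _ _ in HQ *; set W := T%:R ^+ _.
have W0 : 0 < W by rewrite exprn_gt0.
rewrite mulr0 subr0 => H1 H2.
have : `|G.[s0]| * T%:R <= 2 ^+ S * K + L.
  rewrite -(ler_pM2l W0) mulrA -[W in W * `|_|]gtr0_norm // -normrM.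
  have -> : W * G.[s0] = X - (X - W * G.[s0]) by rewrite opprB subrKC.
  apply: (@le_trans _ _ ((`|X| + `|X - W * G.[s0]|) * T%:R)).
    by rewrite ler_wpM2r ?ler0n // ler_normB.
  rewrite mulrDl mulrDr lerD // mulrCA.
  apply: (@le_trans _ _ (2 ^+ S * `|Y| * T%:R)); first by rewrite ler_wpM2r.
  by rewrite -mulrA ler_wpM2l ?exprn_ge0.
rewrite mulrC -ler_pdivlMr ?normr_gt0 // -/bd => Tb.
have := archi_boundP bd0; rewrite real_ltNge ?realn ?ger0_real // => /negP; apply.
by apply: le_trans Tb; rewrite ler_nat.
Qed.

End SmallRoot.

Definition fB n (B : 'M[int]_(n, 2)) (j : 'I_2) (l : 'I_n) : algC := (B l j)%:~R.

Lemma det2_int n (B : 'M[int]_(n, 2)) i j :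
  det2 (rowB B i) (rowB B j) = B i 0 * B j 1 - B i 1 * B j 0.
Proof. by []. Qed.

Lemma br_fB n (B : 'M[int]_(n, 2)) i j :
  br (fB B 0) (fB B 1) i j = (det2 (rowB B i) (rowB B j))%:~R.
Proof. by rewrite det2_int rmorphB !rmorphM. Qed.

Lemma norm_int_ge1 (z : int) : z != 0 -> 1 <= `|z%:~R : algC|.
Proof.
by move=> z0; rewrite -intr_norm ler1z; lia.
Qed.

Lemma exists_real_max (s t : algC) : (s, t) != (0, 0) ->
  exists2 r, 0 < r & [/\ `|s| <= r, `|t| <= r & `|s| = r \/ `|t| = r].
Proof.
move=> st; case: (real_leP (normr_real s) (normr_real t)) => h.
  exists `|t|; last by split=> //; right.
  rewrite normr_gt0; apply: contraNneq st => t0.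
  by move: h; rewrite t0 normr0 normr_le0 => /eqP->.
exists `|s|; last by split=> //; [apply: ltW | left].
by apply: le_lt_trans h.
Qed.

(* Cramer's rule: two independent rows cannot both be small on a normalized vector. *)
Lemma cramer_bound (a1 a2 b1 b2 s t M d : algC) :
  `|a1| <= M -> `|a2| <= M -> `|b1| <= M -> `|b2| <= M ->
  `|s| = 1 \/ `|t| = 1 -> 1 <= `|a1 * b2 - a2 * b1| ->
  `|a1 * s + a2 * t| <= d -> `|b1 * s + b2 * t| <= d -> 1 <= d * M + d * M.
Proof.
move=> a1M a2M b1M b2M st D1 x y; apply: (le_trans D1).
case: st => n1.
  rewrite -[leLHS]mulr1 -n1 -normrM.
  have -> : (a1 * b2 - a2 * b1) * s = (a1 * s + a2 * t) * b2 - (b1 * s + b2 * t) * a2 by ring.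
  by apply: le_trans (ler_normB _ _) _; rewrite !normrM; apply: lerD; apply: ler_pM.
rewrite -[leLHS]mulr1 -n1 -normrM.
have -> : (a1 * b2 - a2 * b1) * t = (b1 * s + b2 * t) * a1 - (a1 * s + a2 * t) * b1 by ring.
by apply: le_trans (ler_normB _ _) _; rewrite !normrM; apply: lerD; apply: ler_pM.
Qed.

Lemma fun_bound n (f : 'I_n -> algC) : exists2 M, 1 <= M & forall l, `|f l| <= M.
Proof.
exists (1 + \sum_l `|f l|) => [|l]; first by rewrite lerDl sumr_ge0.
by rewrite (bigD1 l) //= addrCA lerDl addr_ge0 // sumr_ge0.
Qed.

Section Degeneration.
Variables (n : nat) (B : 'M[int]_(n, 2)) (C : {mpoly int[n * 2]}).
Hypothesis Czero : forall p q i j, br p q i j != 0 ->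
  CL C p q = 0 <-> exists s t, (s, t) != (0, 0) /\ inX B (fun l => s * p l + t * q l).
Hypothesis sumB : forall c, \sum_l wt B c l = 0.
Variables (i0 j0 : 'I_n).
Hypothesis ij0 : det2 (rowB B i0) (rowB B j0) != 0.

Variables (om : 'I_n -> nat).
Definition eta : int * int := (\sum_l (om l)%:Z * B l 0, \sum_l (om l)%:Z * B l 1).
Hypothesis eta_gen : forall l, rowB B l != (0, 0) -> det2 eta (rowB B l) != 0.

Lemma wt_eta c : \sum_l (om l)%:Z * wt B c l = dot eta c.
Proof.
rewrite /dot /eta !big_distrl -big_split; apply: eq_bigr => l _ /=.
by rewrite /wt /dot /=; ring.
Qed.

(* If the rows that are small at [xi] are pairwise parallel, the equation of [X_B] for a suitable
   integer vector orthogonal to them bounds [T]. *)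
Lemma degenerate_bound (M ep : algC) : 0 < ep -> ep <= 1 -> 1 <= M ->
  exists K : algC, 0 <= K /\ forall (T : nat) (xi : 'I_n -> algC), (0 < T)%N ->
    (forall l, `|xi l| <= M) ->
    (forall l l', rowB B l != (0, 0) -> rowB B l' != (0, 0) ->
       `|xi l| < ep -> `|xi l'| < ep -> det2 (rowB B l) (rowB B l') = 0) ->
    inX B (fun l => T%:R ^+ om l * xi l) -> T%:R <= K.
Proof.
move=> ep0 ep1 M1.
(* Candidates for the integer vector: [eta] if no nonzero row is small, otherwise one of the two
   normals of a small row, with the sign that makes [dot eta c] positive. N sums over all
   candidates, so that it depends neither on T nor on xi. *)
pose cs := eta :: [seq (- B l 1, B l 0) | l <- enum 'I_n] ++ [seq (B l 1, - B l 0) | l <- enum 'I_n].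
pose NN c := (\sum_l (posn (wt B c l) + posn (- wt B c l)))%N.
pose N := (\sum_(c <- cs) NN c)%N.
exists (M ^+ N / ep ^+ N); split.
  by rewrite divr_ge0 ?exprn_ge0 // ltW // (lt_le_trans _ M1).
move=> T xi T0 xiM par xX.
suff [c [ccs cpos csmall]] : exists c, [/\ c \in cs, 0 < dot eta c &
    forall l, wt B c l != 0 -> ep <= `|xi l|].
  have cN : (NN c <= N)%N by rewrite /N (big_rem c) //= leq_addr.
  have [up dn] : (\sum_l posn (wt B c l) <= N)%N /\ (\sum_l posn (- wt B c l) <= N)%N.
    by split; apply: leq_trans cN; rewrite /NN big_split /= ?leq_addr ?leq_addl.
  have := xX c; rewrite mposM mnegM => /(congr1 (fun z => `|z|)); rewrite /= !normrM.
  have -> : mpos B c (fun l => T%:R ^+ om l) = T%:R ^+ (\sum_l om l * posn (wt B c l))%N.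
    by rewrite expr_sum; apply: eq_bigr => l _; rewrite exprM.
  have -> : mneg B c (fun l => T%:R ^+ om l) = T%:R ^+ (\sum_l om l * posn (- wt B c l))%N.
    by rewrite expr_sum; apply: eq_bigr => l _; rewrite exprM.
  rewrite !normrX normr_nat /mpos /mneg !normr_prod.
  have lo : ep ^+ N <= \prod_l `|xi l ^+ posn (wt B c l)|.
    apply: (@le_trans _ _ (ep ^+ (\sum_l posn (wt B c l)))).
      by rewrite ler_wiXn2l // ltW.
    rewrite expr_sum ler_prod // => l _; rewrite exprn_ge0 ?(ltW ep0) //= normrX.
    have [->|w0] := eqVneq (wt B c l) 0; first by rewrite /posn maxxx expr0.
    by rewrite lerXn2r ?nnegrE ?(ltW ep0) // csmall.
  have hi : \prod_l `|xi l ^+ posn (- wt B c l)| <= M ^+ N.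
    apply: (@le_trans _ _ (M ^+ (\sum_l posn (- wt B c l)))).
      rewrite expr_sum ler_prod // => l _; rewrite normr_ge0 /= normrX.
      by rewrite lerXn2r ?nnegrE // (le_trans ler01).
    by rewrite ler_weXn2l.
  set u := (\sum_l om l * posn (wt B c l))%N; set v := (\sum_l om l * posn (- wt B c l))%N.
  have uv : (v < u)%N.
    rewrite -ltz_nat -subr_gt0 /u /v !sum_nat_int -sumrB.
    rewrite (_ : \sum_l _ = dot eta c) // -wt_eta; apply: eq_bigr => l _.
    by rewrite !PoszM -mulrBr -posnE.
  move=> E; rewrite ler_pdivlMr ?exprn_gt0 //.
  have T1 : 1 <= T%:R :> algC by rewrite ler1n.
  have Tv : 0 < T%:R ^+ v :> algC by rewrite exprn_gt0 // ltr0n.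
  rewrite -(ler_pM2l Tv) mulrA -exprSr.
  apply: (@le_trans _ _ (T%:R ^+ u * \prod_l `|xi l ^+ posn (wt B c l)|)).
    by apply: ler_pM => //; rewrite ?exprn_ge0 ?ler0n ?(ltW ep0) // ler_weXn2l.
  by rewrite E ler_pM2l.
have [[l0 l0n l0s]|N0] := classic (exists2 l, rowB B l != (0, 0) & `|xi l| < ep).
  have wpar (c : int * int) l : c = (- B l0 1, B l0 0) \/ c = (B l0 1, - B l0 0) ->
      wt B c l != 0 -> ep <= `|xi l|.
    move=> cE wl; rewrite real_leNgt ?(gtr0_real ep0) ?normr_real //; apply/negP => ls.
    case/eqP: wl; have [l00|ln] := eqVneq (rowB B l) (0, 0).
      by rewrite /wt l00 /dot !mul0r addr0.
    have := par _ _ l0n ln l0s ls; rewrite det2_int /wt /dot /rowB => D.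
    by case: cE => -> /=; [rewrite -[RHS]D | rewrite -[RHS]oppr0 -[in RHS]D]; ring.
  have := eta_gen l0n; rewrite /det2 /=; set D := _ - _ => D0.
  have [Dp|Dn] := ltP 0 D.
    exists (B l0 1, - B l0 0); split; first by rewrite inE mem_cat orbC (map_f (fun l => (B l 1, - B l 0))) ?mem_enum ?orbT.
      by rewrite /dot /= mulrN.
    by move=> l; apply: wpar; right.
  exists (- B l0 1, B l0 0); split; first by rewrite inE mem_cat (map_f (fun l => (- B l 1, B l 0))) ?mem_enum ?orbT.
    by rewrite /dot /= mulrN addrC -opprB oppr_gt0 lt_neqAle D0.
  by move=> l; apply: wpar; left.
exists eta; split; first exact: mem_head.
  have en : rowB B i0 != (0, 0).
    by apply: contraNneq ij0 => e; rewrite e /det2 !mul0r subrr.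
  have := eta_gen en; case: eta => x y /=; rewrite /det2 /dot /= => H.
  have : x != 0 \/ y != 0.
    have [x0|] := eqVneq x 0; last by left.
    by right; apply: contraNneq H => ->; rewrite x0 !mul0r subrr.
  by nia.
move=> l wl; rewrite real_leNgt ?(gtr0_real ep0) ?normr_real //; apply/negP => ls.
case: N0; exists l => //; apply: contraNneq wl => l00.
by rewrite /wt l00 /dot !mul0r addr0.
Qed.

Local Notation weight e := (\sum_l om l * e l)%N.

(** If the coefficient of e vanished at B, then for every large T some small perturbation of B, with
    row l scaled by T^(om l), would meet X_B. Undoing the scaling gives a bounded point xi close to
    B applied to a normalized vector; by Cramer's rule its small coordinates belong to parallel
    rows, and [degenerate_bound] bounds T. *)
Lemma extreme_coef e : rowexp C e ->
  (forall e', rowexp C e' -> e' != e -> (weight e' < weight e)%N) ->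
  (CF C (fB B 0) (fB B 1))@_e != 0.
Proof.
case=> p [q pq] emax; apply/eqP => e0.
pose b1 := fB B 0; pose b2 := fB B 1.
pose v1 l := p l - b1 l; pose v2 l := q l - b2 l.
have e1 : (CF C (fun l => b1 l + v1 l) (fun l => b2 l + v2 l))@_e != 0.
  by rewrite (@CF_coef_ext _ _ _ p _ q) // => l; rewrite subrKC.
have [M M1 [b1M b2M v1M v2M]] : exists2 M, 1 <= M & [/\ forall l, `|b1 l| <= M,
    forall l, `|b2 l| <= M, forall l, `|v1 l| <= M & forall l, `|v2 l| <= M].
  have [M1 ? H1] := fun_bound b1; have [M2 ? H2] := fun_bound b2.
  have [M3 ? H3] := fun_bound v1; have [M4 ? H4] := fun_bound v2.
  have M0 : [/\ 0 <= M1, 0 <= M2, 0 <= M3 & 0 <= M4] by split; apply: le_trans ler01 _.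
  have [? ? ? ?] := M0.
  exists (M1 + (M2 + (M3 + M4))); first by rewrite ler_wpDr // !addr_ge0.
  split=> l; apply: le_trans (_ : _ <= M1 + (M2 + (M3 + M4))) => //.
  - by rewrite ler_wpDr ?addr_ge0.
  - by rewrite ler_wpDl // ler_wpDr ?addr_ge0.
  - by rewrite ler_wpDl // ler_wpDl // ler_wpDr.
  - by rewrite ler_wpDl // ler_wpDl // ler_wpDl.
have M0 : 0 < M by apply: lt_le_trans M1.
(* With these choices ep = d M and d M^2 = 1/8. Both contradictions obtained through [fin] come from
   an integral determinant of absolute value at least 1 that would be at most 6 d M^2. *)
pose M8 := 8%:R * M; have M80 : 0 < M8 by rewrite mulr_gt0.
pose d := (M8 * M)^-1; have d0 : 0 < d by rewrite invr_gt0 mulr_gt0.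
pose ep := M8^-1; have ep0 : 0 < ep by rewrite invr_gt0.
have epd : ep = d * M by rewrite /d invfM mulfVK ?gt_eqF.
have ep1 : ep <= 1 by rewrite invf_le1 // (le_trans M1) // ler_peMl ?ler1n // ltW.
have dM2 : d * (M * M) <= 8%:R^-1.
  by rewrite /d /M8 -mulrA invfM mulrVK // unitfE gt_eqF // mulr_gt0.
have [T0 HT] := small_root emax e0 e1 d0.
have [|K [K0 HK]] := degenerate_bound (M := ep + ep + (M + M)) ep0 ep1.
  by rewrite ler_wpDl ?addr_ge0 ?(ltW ep0) // ler_wpDl // ltW.
pose T := (T0 + Num.bound K + 1)%N.
have TT0 : (T0 <= T)%N by rewrite /T -addnA leq_addr.
have Tp : (0 < T)%N by rewrite /T addn1.
have [s sd] := HT T TT0 Tp.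
set P1 := fun l => b1 l + s * v1 l; set P2 := fun l => b2 l + s * v2 l => CT.
have s1 : `|s| <= 1.
  apply: le_trans (ltW sd) _; rewrite invf_le1 ?mulr_gt0 // (le_trans M1) // ler_peMl ?(ltW M0) //.
  by rewrite (le_trans M1) // ler_peMl ?ler1n // ltW.
have sM : `|s| * M <= ep by rewrite epd ler_wpM2r // ltW.
have fin : ~ 1 <= 6%:R * (d * (M * M)).
  move=> H; have : (1 : algC) <= 6%:R * 8%:R^-1 by apply: le_trans H _; rewrite ler_wpM2l // ler0n.
  by rewrite ler_pdivlMr ?ltr0n // mul1r ler_nat.
have brP : br P1 P2 i0 j0 != 0.
  apply/eqP => br0; apply: fin; apply: le_trans (norm_int_ge1 ij0) _; rewrite -br_fB -/b1 -/b2.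
  pose X := (b1 i0 * v2 j0 + v1 i0 * b2 j0 + (v1 i0 * (s * v2 j0))) - (b2 i0 * v1 j0 + v2 i0 * b1 j0 + v2 i0 * (s * v1 j0)).
  have -> : br b1 b2 i0 j0 = - (s * X).
    by rewrite -[LHS]subr0 -br0 /br /P1 /P2 /X; ring.
  rewrite normrN (normrM s).
  have MM x y : `|x| <= M -> `|y| <= M -> `|x * y| <= M * M by move=> xM yM; rewrite normrM ler_pM.
  have sv x : `|x| <= M -> `|s * x| <= M by move=> xM; rewrite normrM -[M]mul1r ler_pM.
  have tri x y z : `|x| <= M * M -> `|y| <= M * M -> `|z| <= M * M -> `|x + y + z| <= 3%:R * (M * M).
    move=> h1 h2 h3; have -> : 3%:R * (M * M) = M * M + M * M + M * M by ring.
    by apply: le_trans (ler_normD _ _) _; apply: lerD => //; apply: le_trans (ler_normD _ _) _; apply: lerD.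
  have XM : `|X| <= 6%:R * (M * M).
    have -> : 6%:R * (M * M) = 3%:R * (M * M) + 3%:R * (M * M) by ring.
    by apply: le_trans (ler_normB _ _) _; apply: lerD; apply: tri; apply: MM => //; apply: sv.
  rewrite mulrCA; apply: ler_pM => //; exact: ltW.
have Tn0 : T%:R != 0 :> algC by rewrite pnatr_eq0 -lt0n.
have brT : br (fun l => T%:R ^+ om l * P1 l) (fun l => T%:R ^+ om l * P2 l) i0 j0 != 0.
  have -> : br (fun l => T%:R ^+ om l * P1 l) (fun l => T%:R ^+ om l * P2 l) i0 j0 =
    T%:R ^+ om i0 * T%:R ^+ om j0 * br P1 P2 i0 j0.
    rewrite /br; set x := T%:R ^+ om i0; set y := T%:R ^+ om j0; ring.
  by rewrite !mulf_neq0 ?expf_neq0.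
have /(Czero brT)[a [b [ab xX]]] := CT.
have [r r0 [ar br br']] := exists_real_max ab.
have rn0 := gt_eqF r0.
pose a' := r^-1 * a; pose b' := r^-1 * b.
have nrm (z : algC) : `|r^-1 * z| = `|z| / r by rewrite normrM ger0_norm ?invr_ge0 ?(ltW r0) // mulrC.
have a1 : `|a'| <= 1 by rewrite /a' nrm ler_pdivrMr // mul1r.
have b1' : `|b'| <= 1 by rewrite /b' nrm ler_pdivrMr // mul1r.
have ab1 : `|a'| = 1 \/ `|b'| = 1.
  by rewrite /a' /b' !nrm; case: br' => ->; [left|right]; rewrite divff ?rn0.
pose xi l := a' * P1 l + b' * P2 l.
have xiX : inX B (fun l => T%:R ^+ om l * xi l).
  apply: inX_ext (inX_scale sumB r^-1 xX) => l; rewrite /xi /a' /b'.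
  by set u := T%:R ^+ _; ring.
have one (x y : algC) : `|x| <= 1 -> 0 <= y -> y <= ep -> `|x| * y <= ep.
  by move=> x1 y0 ye; rewrite -[ep]mul1r; apply: ler_pM.
have pert l : `|xi l - (b1 l * a' + b2 l * b')| <= ep + ep.
  have -> : xi l - (b1 l * a' + b2 l * b') = a' * (s * v1 l) + b' * (s * v2 l).
    by rewrite /xi /P1 /P2; ring.
  apply: le_trans (ler_normD _ _) _; rewrite (normrM a') (normrM b') !(normrM s).
  by apply: lerD; apply: one => //; rewrite ?mulr_ge0 //; apply: le_trans sM; rewrite ler_wpM2l.
have : T%:R <= K.
  apply: (HK T xi) => //.
    move=> l; apply: le_trans (_ : `|xi l - (b1 l * a' + b2 l * b')| + `|b1 l * a' + b2 l * b'| <= _).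
      by rewrite -{1}[xi l](subrK (b1 l * a' + b2 l * b')) ler_normD.
    apply: lerD (pert l) _; apply: le_trans (ler_normD _ _) _; rewrite (normrM (b1 l)) (normrM (b2 l)).
    by apply: lerD; rewrite -[leRHS]mulr1; apply: ler_pM.
  move=> l l' ln l'n ls l's; apply/eqP/negPn/negP => D.
  have small k : `|xi k| < ep -> `|b1 k * a' + b2 k * b'| <= ep + (ep + ep).
    move=> /ltW xk; have -> : b1 k * a' + b2 k * b' = xi k - (xi k - (b1 k * a' + b2 k * b')) by rewrite opprB subrKC.
    by apply: le_trans (ler_normB _ _) _; apply: lerD.
  have := @cramer_bound (b1 l) (b2 l) (b1 l') (b2 l') a' b' M _ (b1M _) (b2M _) (b1M _) (b2M _) ab1 _ (small _ ls) (small _ l's).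
  have -> : b1 l * b2 l' - b2 l * b1 l' = (det2 (rowB B l) (rowB B l'))%:~R by rewrite -br_fB /br.
  rewrite norm_int_ge1 // => /(_ isT).
  have -> : (ep + (ep + ep)) * M + (ep + (ep + ep)) * M = 6%:R * (d * (M * M)) by rewrite epd; ring.
  exact: fin.
move=> TK; have : (Num.bound K)%:R < T%:R :> algC by rewrite ltr_nat /T addn1 ltnS leq_addl.
by move=> bT; have := lt_le_trans (lt_trans (archi_boundP K0) bT) TK; rewrite ltxx.
Qed.

End Degeneration.

(** * Exponents of F that vanish in a given coordinate *)

Lemma kernel_vector (x y s t : algC) : (x, y) != (0, 0) -> (s, t) != (0, 0) ->
  x * s + y * t = 0 -> exists2 r, r != 0 & s = - (y * r) /\ t = x * r.
Proof.
move=> xy st H; suff [r [sE tE]] : exists r, s = - (y * r) /\ t = x * r.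
  exists r => //; apply: contraNneq st => r0.
  by rewrite sE tE r0 !mulr0 oppr0.
have [x0|x0] := eqVneq x 0.
  have y0 : y != 0 by apply: contraNneq xy => ->; rewrite x0.
  exists (- (s / y)); split; first by rewrite mulrN opprK mulrC divfK.
  move: H; rewrite x0 !mul0r add0r => /eqP; rewrite mulf_eq0 (negPf y0) => /eqP //.
exists (t / x); split; last by rewrite mulrC divfK.
apply: (mulfI x0); rewrite mulrN [RHS](_ : _ = - (y * (t / x * x))); last by ring.
by rewrite divfK //; apply/eqP; rewrite -addr_eq0 H.
Qed.

Section RowGeometry.
Variables (n : nat) (B : 'M[int]_(n, 2)).
Hypothesis sumB : forall c, \sum_l wt B c l = 0.
Variables (i0 j0 : 'I_n).
Hypothesis ij0 : det2 (rowB B i0) (rowB B j0) != 0.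
Local Notation D i j := (det2 (rowB B i) (rowB B j)).
Definition perp (b : int * int) : int * int := (- b.2, b.1).

Lemma wt_perp i l : wt B (perp (rowB B i)) l = D i l.
Proof. by rewrite /wt /dot /perp /det2 /=; ring. Qed.

Lemma row_neq0P i : rowB B i != (0, 0) -> B i 0 != 0 \/ B i 1 != 0.
Proof. by rewrite xpair_eqE negb_and => /orP. Qed.

Lemma row0_det i l : rowB B i = (0, 0) -> D i l = 0.
Proof. by rewrite /det2 => ->; rewrite /= !mul0r subrr. Qed.

Lemma detC i j : D j i = - D i j.
Proof. by rewrite /det2; ring. Qed.

Lemma exists_indep i : rowB B i != (0, 0) -> exists j, D i j != 0.
Proof.
move=> i_n0; have [H|] := eqVneq (D i i0) 0; last by exists i0.
have [H'|] := eqVneq (D i j0) 0; last by exists j0.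
case/eqP: ij0; move: H H'; rewrite /det2 /=.
case: (row_neq0P i_n0); move: (B i 0) (B i 1) (B i0 0) (B i0 1) (B j0 0) (B j0 1) => a b c d e f ab H H'.
  by apply: (mulfI ab); rewrite mulr0 -[RHS](_ : c * (a * f - b * e) - e * (a * d - b * c) = _); [ring | rewrite H H' !mulr0 subrr].
by apply: (mulfI ab); rewrite mulr0 -[RHS](_ : d * (a * f - b * e) - f * (a * d - b * c) = _); [ring | rewrite H H' !mulr0 subrr].
Qed.

Lemma exists_indep_other i : exists a b, [/\ a != i, b != i & D a b != 0].
Proof.
have [i_0|i_n0] := eqVneq (rowB B i) (0, 0).
  exists i0, j0; split=> //; apply: contraNneq ij0 => ->; rewrite ?(row0_det _ i_0) //.
  by rewrite detC row0_det ?oppr0.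
have [j ij] := exists_indep i_n0.
have [l li lj] : exists2 l, l != i & D l j != 0.
  apply: NNPP => N; have := sumB (perp (rowB B j)).
  rewrite (bigD1 i) //= big1 => [|l li]; last first.
    rewrite wt_perp detC; apply/eqP; rewrite oppr_eq0; apply/negPn/negP => H.
    by apply: N; exists l.
  by rewrite addr0 wt_perp detC => /eqP; rewrite oppr_eq0 (negPf ij).
exists l, j; split=> //; apply: contraNneq ij => ->.
by rewrite /det2; apply/eqP; ring.
Qed.

Lemma det_of_kernel (a b : int * int) (s t : algC) : (s, t) != (0, 0) ->
  a.1%:~R * s + a.2%:~R * t = 0 -> b.1%:~R * s + b.2%:~R * t = 0 -> det2 a b = 0.
Proof.
move=> st ha hb; apply/eqP; rewrite -(intr_eq0 algC); apply/eqP.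
have : s != 0 \/ t != 0 by apply/orP; rewrite -negb_and -xpair_eqE.
rewrite /det2 rmorphB !rmorphM /=; move: (a.1%:~R) (a.2%:~R) (b.1%:~R) (b.2%:~R) ha hb => x y z w ha hb.
case=> n0; apply: (mulfI n0); rewrite mulr0.
  by rewrite -[RHS](_ : w * (x * s + y * t) - y * (z * s + w * t) = _); [ring | rewrite ha hb !mulr0 subrr].
by rewrite -[RHS](_ : x * (z * s + w * t) - z * (x * s + y * t) = _); [ring | rewrite ha hb !mulr0 subrr].
Qed.

Lemma kernel_of_det (a b : int * int) (s t : algC) : a != (0, 0) -> det2 a b = 0 ->
  a.1%:~R * s + a.2%:~R * t = 0 -> b.1%:~R * s + b.2%:~R * t = 0.
Proof.
move=> a0 D ha; have : a.1%:~R != 0 :> algC \/ a.2%:~R != 0 :> algC.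
  by apply/orP; rewrite !intr_eq0 -negb_and -xpair_eqE -surjective_pairing.
have D' : a.1%:~R * b.2%:~R - a.2%:~R * b.1%:~R = 0 :> algC by rewrite -!rmorphM -rmorphB /= -[_ - _]/(det2 a b) D.
move: D' ha; move: (a.1%:~R) (a.2%:~R) (b.1%:~R) (b.2%:~R) => x y z w D' ha.
case=> n0; apply: (mulfI n0); rewrite mulr0.
  by rewrite -[RHS](_ : z * (x * s + y * t) + t * (x * w - y * z) = _); [ring | rewrite ha D' !mulr0 addr0].
by rewrite -[RHS](_ : w * (x * s + y * t) - s * (x * w - y * z) = _); [ring | rewrite ha D' !mulr0 subr0].
Qed.

End RowGeometry.

Section MinExponent.
Variables (n : nat) (B : 'M[int]_(n, 2)) (C : {mpoly int[n * 2]}).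
Hypothesis Czero : forall p q i j, br p q i j != 0 ->
  CL C p q = 0 <-> exists s t, (s, t) != (0, 0) /\ inX B (fun l => s * p l + t * q l).
Hypothesis sumB : forall c, \sum_l wt B c l = 0.
Variables (i0 j0 : 'I_n).
Hypothesis ij0 : det2 (rowB B i0) (rowB B j0) != 0.
Local Notation D i j := (det2 (rowB B i) (rowB B j)).
Local Notation dotC b s t := (b.1%:~R * s + b.2%:~R * t : algC).

(** If (s, t) did not annihilate row i, some binomial would have x_i on its positive side and no
    vanishing coordinate on its negative side. The vector c is normal to a nonzero row annihilated
    by (s, t), or is b_i itself when there is none. *)
Lemma facet_point i (z : 'I_n -> algC) s t : rowB B i != (0, 0) -> z i = 0 ->
  (forall l, l != i -> z l != 0) -> (s, t) != (0, 0) ->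
  inX B (fun l => z l * dotC (rowB B l) s t) -> dotC (rowB B i) s t = 0.
Proof.
move=> i_n0 zi zl st xX; apply/eqP/negPn/negP => H.
suff [c ci cl] : exists2 c, 0 < wt B c i &
    forall l, wt B c l != 0 -> l != i -> dotC (rowB B l) s t != 0.
  have := xX c; rewrite /mpos (bigD1 i) //= zi mul0r expr0n.
  rewrite (_ : (posn (wt B c i) == 0%N) = false) ?mul0r; last first.
    by apply/negbTE; rewrite -(eqz_nat _ 0) posn_ge0 ?gt_eqF // ltW.
  move=> /esym/eqP; rewrite prodf_seq_eq0 => /hasP[l _] /=.
  rewrite expf_eq0 mulf_eq0 => /andP[p0 +].
  have wl : wt B c l < 0.
    by rewrite ltNge; apply/negP => wl; move: p0; rewrite posn_eq0 ?oppr_le0.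
  have li : l != i by apply: contraTneq wl => ->; rewrite -leNgt ltW.
  by rewrite (negPf (zl _ li)) (negPf (cl l _ li)) // lt_eqF.
have [[l0 l0n l0k]|N] := classic (exists2 l0, rowB B l0 != (0, 0) & dotC (rowB B l0) s t = 0).
  have D0 : D l0 i != 0.
    by apply: contraNneq H => D0; apply/eqP; apply: (kernel_of_det l0n D0).
  have ker l : D l0 l != 0 -> dotC (rowB B l) s t != 0.
    by apply: contraNneq => hl; apply/eqP; apply: (det_of_kernel st).
  have [Dp|Dn] := ltP 0 (D l0 i).
    by exists (perp (rowB B l0)) => [|l]; rewrite !wt_perp // => + _; apply: ker.
  have wN l : wt B (- (perp (rowB B l0)).1, - (perp (rowB B l0)).2) l = - D l0 l.
    by rewrite /wt /dot /perp /det2 /=; ring.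
  exists (- (perp (rowB B l0)).1, - (perp (rowB B l0)).2) => [|l]; rewrite wN.
    by rewrite oppr_gt0 lt_neqAle D0.
  by rewrite oppr_eq0 => + _; apply: ker.
exists (rowB B i) => [|l wl _].
  by have [] := row_neq0P i_n0; rewrite /wt /dot /=; nia.
apply/eqP => hl; apply: N; exists l => //; apply: contraNneq wl => l0.
by rewrite /wt l0 /dot !mul0r addr0.
Qed.

(** A monomial without x_i shows up as soon as F is nonzero at some z with z i = 0. Otherwise
    [facet_point] puts the point with coordinates z_l D i l on X_B for every [z k] with k > 0; its
    equation for the normal of b_i, compared at k = 1 and k = 2, gives 2^(D i j) = 1. *)
Lemma min_exponent i : rowB B i != (0, 0) ->
  exists2 e, e \in msupp (CF C (fB B 0) (fB B 1)) & e i = 0%N.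
Proof.
move=> i_n0; have [j ij] := exists_indep ij0 i_n0.
have [a [b [ai bi ab]]] := exists_indep_other sumB ij0 i.
pose z (k : nat) l : algC := if l == i then 0 else if l == j then k%:R else 1.
have zn k l : (0 < k)%N -> l != i -> z k l != 0.
  by move=> k0 li; rewrite /z (negPf li); case: ifP; rewrite ?oner_eq0 // pnatr_eq0 -lt0n.
have zi k : z k i = 0 by rewrite /z eqxx.
pose F := CF C (fB B 0) (fB B 1).
suff [k Fk] : exists k, F.@[z k] != 0.
  apply: NNPP => N; case/eqP: Fk; rewrite mevalE big1_seq // => m /andP[_ mF].
  rewrite (bigD1 i) //= zi expr0n (_ : (m i == 0%N) = false) ?mul0r ?mulr0 //.
  by apply/negP => /eqP mi; apply: N; exists m.
apply: NNPP => N; pose c := perp (rowB B i).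
have inXu k : (0 < k)%N -> inX B (fun l => z k l * (D i l)%:~R).
  move=> k0; have : F.@[z k] = 0 by apply/eqP; apply/negPn/negP => H; apply: N; exists k.
  rewrite CF_eval => /(Czero (i := a) (j := b)) [|s [t [st xX]]].
    have -> : br (fun l => z k l * fB B 0 l) (fun l => z k l * fB B 1 l) a b =
       z k a * z k b * br (fB B 0) (fB B 1) a b by rewrite /br; ring.
    by rewrite !mulf_neq0 ?zn // br_fB intr_eq0.
  have xX' : inX B (fun l => z k l * dotC (rowB B l) s t).
    by apply: inX_ext xX => l; rewrite /fB /=; ring.
  have H := facet_point i_n0 (zi k) (fun l => @zn k l k0) st xX'.
  have [r r0 rE] : exists2 r, r != 0 & forall l, dotC (rowB B l) s t = r * (D i l)%:~R.
    have dE l : (D i l)%:~R = (B i 0)%:~R * (B l 1)%:~R - (B i 1)%:~R * (B l 0)%:~R :> algC.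
      by rewrite /det2 rmorphB !rmorphM.
    have xy0 : ((B i 0)%:~R, (B i 1)%:~R) != (0, 0) :> algC * algC.
      by move: i_n0; rewrite /rowB !xpair_eqE !intr_eq0.
    have [r r0 [sE tE]] := kernel_vector xy0 st H.
    by exists r => // l; rewrite dE /= sE tE; ring.
  apply: inX_ext (inX_scale sumB r^-1 xX') => l.
  by rewrite rE mulrCA mulKf.
have zw k : mpos B c (z k) = k%:R ^+ posn (D i j) /\ mneg B c (z k) = k%:R ^+ posn (- D i j).
  have ji : j != i by apply: contraNneq ij => ->; rewrite /det2; apply/eqP; ring.
  split; rewrite /mpos /mneg (bigD1 j) //= wt_perp /z (negPf ji) eqxx big1 ?mulr1 // => l lj.
    rewrite wt_perp (negPf lj); case: eqP => [->|_]; last by rewrite expr1n.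
    by rewrite (_ : D i i = 0) ?posn_eq0 ?expr0 // /det2; ring.
  rewrite wt_perp (negPf lj); case: eqP => [->|_]; last by rewrite expr1n.
  by rewrite (_ : D i i = 0) ?oppr0 ?posn_eq0 ?expr0 // /det2; ring.
have := inXu 1%N isT c; have := inXu 2%N isT c.
rewrite !mposM !mnegM !(zw _).1 !(zw _).2 !expr1n !mul1r => + E; rewrite E.
have n0 : mneg B c (fun l => (D i l)%:~R) != 0.
  rewrite prodf_seq_neq0; apply/allP => l _ /=; rewrite wt_perp expf_eq0 intr_eq0 negb_and.
  have [->|] := eqVneq (D i l) 0; last by rewrite orbT.
  by rewrite oppr0 posn_eq0.
move=> /(mulIf n0) /eqP; rewrite -!natrX eqr_nat eqn_exp2l // => /eqP E2.
by case/eqP: ij; rewrite [LHS]posnE E2 subrr.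
Qed.

End MinExponent.

(** * Intersection points when a single row moves *)

Lemma prod_exprz (F : fieldType) (I : Type) (r : seq I) (f : I -> F) (z : int) :
  (\prod_(i <- r) f i) ^ z = \prod_(i <- r) f i ^ z.
Proof.
case: z => k; first by rewrite -exprnP -prodrXl.
by rewrite NegzE -exprnN -prodrXl -prodfV; apply: eq_bigr => i _; rewrite -exprnN.
Qed.

Section TorusEquations.
Variables (n : nat) (B : 'M[int]_(n, 2)).
Implicit Types (x : 'I_n -> algC) (c d : int * int).

Definition mz c x : algC := \prod_l x l ^ wt B c l.

Lemma posn_exprz (y : algC) (z : int) : (z != 0 -> y != 0) -> y ^+ posn z = y ^ z * y ^+ posn (- z).
Proof.
have [->|z0 /(_ isT) y0] := eqVneq z 0; first by rewrite oppr0 /posn maxxx /= expr0z mul1r.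
by rewrite !exprnP {2}[z]posnE -expfzDr // subrK.
Qed.

Lemma mpos_mz c x : (forall l, wt B c l != 0 -> x l != 0) -> mpos B c x = mz c x * mneg B c x.
Proof.
move=> H; rewrite /mpos /mz /mneg -big_split; apply: eq_bigr => l _ /=.
exact/posn_exprz/H.
Qed.

Lemma mneg_neq0 c x : (forall l, wt B c l != 0 -> x l != 0) -> mneg B c x != 0.
Proof.
move=> H; rewrite prodf_seq_neq0; apply/allP => l _ /=; rewrite expf_eq0 negb_and.
have [w0|/H ->] := eqVneq (wt B c l) 0; last by rewrite orbT.
by rewrite w0 oppr0 /posn maxxx.
Qed.

Lemma mz_eq1 c x : (forall l, wt B c l != 0 -> x l != 0) ->
  (mpos B c x = mneg B c x) <-> mz c x = 1.
Proof.
move=> H; rewrite mpos_mz //; split=> [|->]; last by rewrite mul1r.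
by rewrite -[X in _ = X -> _]mul1r => /(mulIf (mneg_neq0 H)).
Qed.

Definition row_regular x := forall l, rowB B l != (0, 0) -> x l != 0.

Lemma wt_row0 c l : rowB B l = (0, 0) -> wt B c l = 0.
Proof. by rewrite /wt /dot => ->; rewrite /= !mul0r addr0. Qed.

Lemma row_regular_wt c x : row_regular x -> forall l, wt B c l != 0 -> x l != 0.
Proof. by move=> H l wl; apply: H; apply: contraNneq wl => /(wt_row0 c) ->. Qed.

Variables (rho m : int * int).
Hypothesis rho_m : dot rho m = 1.
Local Notation c := (perp rho).

(** Since dot rho m = 1, the pair perp rho, m is a basis of Z^2; the two factors are the coordinates
    of d in it. *)
Lemma basis_decomp (d : int * int) l :
  wt B d l = wt B c l * (d.2 * m.1 - d.1 * m.2) + wt B m l * dot rho d.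
Proof.
rewrite /wt /dot /perp /=; move: rho_m; rewrite /dot.
move: (B l 0) (B l 1) rho m d => x y [r1 r2] [m1 m2] [d1 d2] /= e.
rewrite -[LHS]mulr1 -e; ring.
Qed.

Lemma inX_torus x : row_regular x -> mz c x = 1 -> mz m x = 1 -> inX B x.
Proof.
move=> xr hc hm d; apply/mz_eq1; first exact: row_regular_wt.
rewrite /mz; under eq_bigr => l _.
  have -> : x l ^ wt B d l = (x l ^ wt B c l) ^ (d.2 * m.1 - d.1 * m.2) * (x l ^ wt B m l) ^ dot rho d.
    have [r0|/xr x0] := eqVneq (rowB B l) (0, 0); first by rewrite !wt_row0 // !expr0z !exp1rz mulr1.
    by rewrite !exprz_exp -expfzDr // -basis_decomp.
  over.
by rewrite big_split /= -!prod_exprz -/(mz c x) -/(mz m x) hc hm !exp1rz mulr1.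
Qed.

End TorusEquations.

Section Fiber.
Variables (n : nat) (B : 'M[int]_(n, 2)) (C : {mpoly int[n * 2]}).
Hypothesis Czero : forall p q i j, br p q i j != 0 ->
  CL C p q = 0 <-> exists s t, (s, t) != (0, 0) /\ inX B (fun l => s * p l + t * q l).
Hypothesis sumB : forall c, \sum_l wt B c l = 0.
Variables (rho m : int * int).
Hypothesis rho_m : dot rho m = 1.
Local Notation c := (perp rho).
Variables (i : 'I_n) (g : nat).
Hypothesis g0 : (0 < g)%N.
Hypothesis rowi : rowB B i = (g%:Z * rho.1, g%:Z * rho.2).
Variable j0 : 'I_n.
Hypothesis j0pos : 0 < wt B c j0.
Implicit Types (p q : 'I_n -> algC) (al : algC).

Lemma wt_ci : wt B c i = 0.
Proof. by rewrite /wt rowi /dot /perp /=; ring. Qed.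

Lemma wt_mi : wt B m i = g.
Proof. by rewrite /wt rowi /dot /= -!mulrA -mulrDr -/(dot rho m) rho_m mulr1. Qed.

Definition lin p q al l := al * p l + q l.
Definition upd p (a : algC) l := if l == i then a else p l.

Definition posPol p q : {poly algC} := \prod_l (p l *: 'X + (q l)%:P) ^+ posn (wt B c l).
Definition negPol p q : {poly algC} := \prod_l (p l *: 'X + (q l)%:P) ^+ posn (- wt B c l).
Definition fpol p q := posPol p q - negPol p q.

Lemma posPol_E p q al : (posPol p q).[al] = mpos B c (lin p q al).
Proof.
rewrite /posPol horner_prod; apply: eq_bigr => l _.
by rewrite horner_exp !hornerE mulrC.
Qed.

Lemma negPol_E p q al : (negPol p q).[al] = mneg B c (lin p q al).
Proof.
rewrite /negPol horner_prod; apply: eq_bigr => l _.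
by rewrite horner_exp !hornerE mulrC.
Qed.

Lemma root_fpol p q al :
  root (fpol p q) al <-> mpos B c (lin p q al) = mneg B c (lin p q al).
Proof.
by rewrite rootE /fpol hornerD hornerN posPol_E negPol_E subr_eq0; split=> /eqP.
Qed.

(** Generic position: p itself does not satisfy the equation of [perp rho], so [fpol] keeps its full
    degree, and at a root of [fpol] no nonzero row other than i vanishes ([lin_neq0]). *)
Record good p q : Prop := Good {
  good_lc : mpos B c p != mneg B c p;
  good_br : forall l j, 0 < wt B c l -> wt B c j < 0 -> br p q l j != 0;
  good_ray : forall l, l != i -> rowB B l != (0, 0) -> wt B c l = 0 ->
     p l != 0 /\ mpos B c (br p q l) != mneg B c (br p q l) }.

Lemma mpos_const a : mpos B c (fun=> a) = mneg B c (fun=> a).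
Proof.
have := @inX_oneparam _ B (fun=> 1%N) a; apply => c'.
by rewrite -[RHS](sumB c'); apply: eq_bigr => l _; rewrite mul1r.
Qed.

Lemma j1_exists : exists j1, wt B c j1 < 0.
Proof.
apply: NNPP => N; have := sumB c; rewrite (bigD1 j0) //= => /eqP.
rewrite gt_eqF // ltr_wpDr // sumr_ge0 // => l _; rewrite leNgt; apply/negP => H.
by apply: N; exists l.
Qed.

(** A zero on one side of the equation of [perp rho] forces one on the other side and hence a
    vanishing bracket. If a row l of weight zero vanishes, the point is proportional to br p q l,
    which [good_ray] keeps off the equation. *)
Lemma lin_neq0 p q al l : good p q -> root (fpol p q) al -> l != i ->
  rowB B l != (0, 0) -> lin p q al l != 0.
Proof.
move=> [_ Hbr Hray] /root_fpol E li ln; apply/eqP => l0.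
have zero_factor j (k : 'I_n -> int) : lin p q al j = 0 -> 0 < k j ->
    \prod_l lin p q al l ^+ posn (k l) = 0.
  move=> j0' kj; rewrite (bigD1 j) //= j0' expr0n (_ : (posn (k j) == 0%N) = false) ?mul0r //.
  by apply/negbTE; rewrite -(eqz_nat _ 0) posn_ge0 ?gt_eqF // ltW.
have factor_zero (k : 'I_n -> int) : \prod_l lin p q al l ^+ posn (k l) = 0 ->
    exists2 j, lin p q al j = 0 & 0 < k j.
  move=> /eqP; rewrite prodf_seq_eq0 => /hasP[j _] /=.
  rewrite expf_eq0 => /andP[p0 /eqP j0']; exists j => //.
  by rewrite ltNge; apply/negP => wl; move: p0; rewrite posn_eq0.
have br0 j k : lin p q al j = 0 -> lin p q al k = 0 -> br p q j k = 0.
  rewrite /lin /br => /eqP; rewrite addrC addr_eq0 => /eqP -> /eqP; rewrite addrC addr_eq0 => /eqP ->.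
  ring.
case: (ltrgtP 0 (wt B c l)) => wl.
- have := E; rewrite /mpos (zero_factor l _ l0 wl) => /esym/factor_zero[j j0' wj].
  by have := Hbr l j wl; rewrite br0 ?eqxx // -oppr_gt0 wj => /(_ isT).
- have := E; rewrite /mneg (zero_factor l (fun l => - wt B c l) l0) ?oppr_gt0 // => /factor_zero[j j0' wj].
  by have := Hbr j l wj wl; rewrite br0 ?eqxx.
have [pl /eqP] := Hray l li ln (esym wl); apply.
have brE : br p q l =1 (fun j => p l * lin p q al j).
  move=> j; move: l0; rewrite /lin /br => /eqP; rewrite addrC addr_eq0 => /eqP ->; ring.
rewrite (_ : mpos B c (br p q l) = mpos B c (fun j => p l * lin p q al j)); last first.
  by apply: eq_bigr => j _; rewrite brE.
rewrite (_ : mneg B c (br p q l) = mneg B c (fun j => p l * lin p q al j)); last first.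
  by apply: eq_bigr => j _; rewrite brE.
by rewrite mposM mnegM E mpos_const.
Qed.

(** The value of x_i^g dictated by the equation of m once the other coordinates are given. *)
Definition hval p q al : algC := (\prod_(l | l != i) lin p q al l ^ wt B m l)^-1.

Lemma hval_neq0 p q al : good p q -> root (fpol p q) al -> hval p q al != 0.
Proof.
move=> H r; rewrite invr_eq0; apply/prodf_neq0 => l li.
have [r0|ln] := eqVneq (rowB B l) (0, 0); first by rewrite wt_row0 // expr0z oner_eq0.
by rewrite expfz_neq0 // lin_neq0.
Qed.

Lemma mpos_upd p a : mpos B c (upd p a) = mpos B c p.
Proof.
apply: eq_bigr => l _; rewrite /upd; case: eqP => // ->.
by rewrite wt_ci posn_eq0 ?expr0.
Qed.

Lemma mneg_upd p a : mneg B c (upd p a) = mneg B c p.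
Proof.
apply: eq_bigr => l _; rewrite /upd; case: eqP => // ->.
by rewrite wt_ci oppr0 posn_eq0 ?expr0.
Qed.

(** Since wt c i = 0 and wt m i = g, the equation of [perp rho] determines the parameter al
    independently of row i, and the equation of m then prescribes the g-th power of the coordinate
    i. *)
Lemma fiber p q a b : good p q ->
  CL C (upd p a) (upd q b) = 0 <->
  exists2 al, root (fpol p q) al & (al * a + b) ^+ g = hval p q al.
Proof.
move=> H; have [lc Hbr Hray] := H; have [j1 j1neg] := j1_exists.
have updE s t : (fun l => s * upd p a l + t * upd q b l) =1
    upd (fun l => s * p l + t * q l) (s * a + t * b).
  by move=> l; rewrite /upd; case: ifP.
have br01 : br (upd p a) (upd q b) j0 j1 != 0.
  have j0i : (j0 == i) = false by apply: contraTF j0pos => /eqP ->; rewrite wt_ci ltxx.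
  have j1i : (j1 == i) = false by apply: contraTF j1neg => /eqP ->; rewrite wt_ci ltxx.
  by rewrite /br /upd j0i j1i; apply: Hbr.
have mzi al x0 : mz B m (upd (lin p q al) x0) = x0 ^+ g * (hval p q al)^-1.
  rewrite /mz (bigD1 i) //= /upd eqxx wt_mi -exprnP invrK; congr (_ * _).
  by apply: eq_bigr => l /negPf ->.
rewrite (Czero br01); split.
  case=> s [t [st xX]].
  have t0 : t != 0.
    apply: contraNneq lc => t0; move: st; rewrite t0 xpair_eqE eqxx andbT => s0; apply/eqP.
    have := xX c; rewrite t0 => E.
    have E' : mpos B c (fun l => s * p l) = mneg B c (fun l => s * p l).
      rewrite -(mpos_upd _ (s * a)) -(mneg_upd _ (s * a)).
      rewrite (_ : mpos _ _ _ = mpos B c (fun l => s * upd p a l + 0 * upd q b l)); last first.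
        by apply: eq_bigr => l _; rewrite /upd; case: ifP => _; rewrite mul0r addr0.
      rewrite E; apply: eq_bigr => l _; rewrite /upd; case: ifP => _; by rewrite mul0r addr0.
    move: E'; rewrite mposM mnegM mpos_const => /mulfI; apply.
    rewrite /mneg prodf_seq_neq0; apply/allP => l _ /=.
    by rewrite expf_eq0 (negPf s0) andbF.
  pose al := s / t; pose y := upd (lin p q al) (al * a + b).
  have yX : inX B y.
    apply: inX_ext (inX_scale sumB t^-1 xX) => l.
    by rewrite /y /upd /lin /al; case: ifP => _; rewrite mulrDr mulKf // mulrA [t^-1 * s]mulrC.
  have r : root (fpol p q) al by apply/root_fpol; have := yX c; rewrite mpos_upd mneg_upd.
  exists al => //; have yl l : l != i -> wt B m l != 0 -> lin p q al l != 0.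
    by move=> li wl; apply: lin_neq0 => //; apply: contraNneq wl => /(wt_row0 m) ->.
  have := yX m; rewrite /mpos /mneg (bigD1 i) //= [RHS](bigD1 i) //= wt_mi /y {1 3}/upd eqxx.
  rewrite [posn (- _)]posn_eq0 ?oppr_le0 // expr0 mul1r.
  have -> : posn g = g by rewrite /posn max_l.
  have -> : \prod_(l < n | l != i) upd (lin p q al) (al * a + b) l ^+ posn (wt B m l) =
    \prod_(l < n | l != i) lin p q al l ^ wt B m l *
    \prod_(l < n | l != i) upd (lin p q al) (al * a + b) l ^+ posn (- wt B m l).
    rewrite -big_split; apply: eq_bigr => l li /=; rewrite /upd (negPf li).
    by rewrite posn_exprz // => wl; apply: yl.
  set P := \prod_(l < n | l != i) upd _ _ _ ^+ _; rewrite mulrA -[X in _ = X -> _]mul1r => /mulIf E.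
  rewrite /hval -[LHS]mulr1 -[X in _ * X](@mulfV _ (\prod_(l < n | l != i) lin p q al l ^ wt B m l)).
    rewrite mulrA E ?mul1r //; apply/prodf_neq0 => l li; rewrite /upd (negPf li) expf_eq0 negb_and.
    have [->|w0] := eqVneq (wt B m l) 0; last by rewrite yl ?orbT.
    by rewrite oppr0 posn_eq0.
  by have := hval_neq0 H r; rewrite invr_eq0.
case=> al r E; exists al, 1; split; first by rewrite xpair_eqE oner_eq0 andbF.
have x0 : al * a + b != 0.
  by apply: contraNneq (hval_neq0 H r) => x0; rewrite -E x0 expr0n gtn_eqF.
have reg : row_regular B (upd (lin p q al) (al * a + b)).
  move=> l ln; rewrite /upd; have [//|li] := eqVneq l i.
  exact: (lin_neq0 H r li ln).
apply: (@inX_ext _ _ (upd (lin p q al) (al * a + b))).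
  by move=> l; rewrite /upd /lin; case: ifP; rewrite !mul1r.
apply: (inX_torus rho_m) => //.
  apply/mz_eq1; first exact: row_regular_wt.
  by rewrite mpos_upd mneg_upd; apply/root_fpol.
by rewrite mzi E mulfV // hval_neq0.
Qed.

End Fiber.

(** * Generic pairs of columns *)

Section Generic.
Variable n : nat.
Implicit Types (Phi Psi : ('I_n -> algC) -> ('I_n -> algC) -> Prop).

Definition generic Phi := exists2 h : {mpoly algC[n * 2]}, h != 0 &
  forall p q, h.@[ptY p q] != 0 -> Phi p q.

Lemma generic_ex Phi : generic Phi -> exists p q, Phi p q.
Proof.
case=> h /mpoly_nonroot[y hy] H.
exists (fun i => y (mxvec_index i 0)), (fun i => y (mxvec_index i 1)); apply: H.
by rewrite (meval_eq (v2 := y)) // => l; rewrite -ptY_surj.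
Qed.

Lemma generic_and Phi Psi : generic Phi -> generic Psi -> generic (fun p q => Phi p q /\ Psi p q).
Proof.
case=> h h0 H [k k0 K]; exists (h * k); first by rewrite mulf_neq0.
by move=> p q; rewrite mevalM mulf_eq0 negb_or => /andP[/H ? /K ?].
Qed.

Lemma generic_imp Phi Psi : (forall p q, Phi p q -> Psi p q) -> generic Phi -> generic Psi.
Proof. by move=> H [h h0 K]; exists h => // p q /K/H. Qed.

Lemma generic_true Phi : (forall p q, Phi p q) -> generic Phi.
Proof. by move=> H; exists 1; rewrite ?oner_neq0. Qed.

Lemma generic_cond (P : Prop) Phi : (P -> generic Phi) -> generic (fun p q => P -> Phi p q).
Proof.
move=> H; have [p|np] := classic P; last by apply: generic_true.
by apply: generic_imp (H p).
Qed.

Lemma generic_forall (I : finType) (Phi : I -> ('I_n -> algC) -> ('I_n -> algC) -> Prop) :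
  (forall x, generic (Phi x)) -> generic (fun p q => forall x, Phi x p q).
Proof.
move=> H; suff : generic (fun p q => forall x, x \in enum I -> Phi x p q).
  by apply: generic_imp => p q K x; apply: K; rewrite mem_enum.
elim: (enum I) => [|x s IH]; first by apply: generic_true.
apply: generic_imp (generic_and (H x) IH) => p q [K L] y.
by rewrite inE => /predU1P[->|/L].
Qed.

Definition polyfun (phi : ('I_n -> algC) -> ('I_n -> algC) -> algC) :=
  exists h : {mpoly algC[n * 2]}, forall p q, phi p q = h.@[ptY p q].

Lemma polyfun_p l : polyfun (fun p q => p l).
Proof. by exists 'X_(mxvec_index l 0) => p q; rewrite mevalXU ptY_index. Qed.

Lemma polyfun_q l : polyfun (fun p q => q l).
Proof. by exists 'X_(mxvec_index l 1) => p q; rewrite mevalXU ptY_index. Qed.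

Lemma polyfunM f k : polyfun f -> polyfun k -> polyfun (fun p q => f p q * k p q).
Proof. by move=> [h H] [h' H']; exists (h * h') => p q; rewrite mevalM H H'. Qed.

Lemma polyfunB f k : polyfun f -> polyfun k -> polyfun (fun p q => f p q - k p q).
Proof. by move=> [h H] [h' H']; exists (h - h') => p q; rewrite mevalB H H'. Qed.

Lemma polyfun_prod (k : 'I_n -> nat) f : (forall l, polyfun (f l)) ->
  polyfun (fun p q => \prod_l f l p q ^+ k l).
Proof.
move=> H; suff : polyfun (fun p q => \prod_(l <- enum 'I_n) f l p q ^+ k l).
  by case=> h E; exists h => p q; rewrite -E big_enum.
elim: (enum 'I_n) => [|l s [h E]]; first by exists 1 => p q; rewrite big_nil meval1.
by have [h' E'] := H l; exists (h' ^+ k l * h) => p q; rewrite big_cons mevalM rmorphXn /= E E'.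
Qed.

Lemma polyfun_br l l' : polyfun (fun p q => br p q l l').
Proof. by apply: polyfunB; apply: polyfunM; (apply: polyfun_p || apply: polyfun_q). Qed.

Lemma generic_neq f k p0 q0 : polyfun f -> polyfun k -> f p0 q0 != k p0 q0 ->
  generic (fun p q => f p q != k p q).
Proof.
move=> pf pk fk; have [h H] := polyfunB pf pk; exists h.
  by apply: contraNneq fk => h0; rewrite -subr_eq0 H h0 meval0.
by move=> p q; rewrite -H subr_eq0.
Qed.

Lemma polyfun_const (a : algC) : polyfun (fun _ _ => a).
Proof. by exists a%:MP => p q; rewrite mevalC. Qed.

Lemma generic_p l : generic (fun p q => p l != 0).
Proof.
apply: (@generic_neq _ (fun _ _ => 0) (fun=> 1) (fun=> 0)); rewrite ?oner_eq0 //.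
  exact: polyfun_p.
exact: polyfun_const.
Qed.

Lemma generic_br l l' : l != l' -> generic (fun p q => br p q l l' != 0).
Proof.
move=> ll'; apply: (@generic_neq _ (fun _ _ => 0) (fun k => (k == l)%:R) (fun k => (k == l')%:R)).
- exact: polyfun_br.
- exact: polyfun_const.
by rewrite /br !eqxx (negPf ll') mul0r subr0 mulr1 oner_eq0.
Qed.

Variables (B : 'M[int]_(n, 2)) (c : int * int) (j0 : 'I_n).
Hypothesis j0pos : 0 < wt B c j0.
Hypothesis sumB : \sum_l wt B c l = 0.

(** Witness for the generic inequalities below: at this point the two monomials of c are a positive
    power of 2 and 1. *)
Let two l : algC := if l == j0 then 2%:R else 1.

Lemma mpos_two k : mpos B c (fun l => k * two l) = mpos B c (fun=> k) * 2%:R ^+ posn (wt B c j0).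
Proof.
rewrite mposM; congr (_ * _); rewrite /mpos (bigD1 j0) //= /two eqxx big1 ?mulr1 // => l /negPf ->.
by rewrite expr1n.
Qed.

Lemma mneg_two k : mneg B c (fun l => k * two l) = mneg B c (fun=> k).
Proof.
rewrite mnegM -[RHS]mulr1; congr (_ * _); rewrite /mneg big1 // => l _; rewrite /two.
by case: eqP => [->|_]; rewrite ?expr1n // posn_eq0 ?expr0 // oppr_le0 ltW.
Qed.

Lemma two_pow_neq1 : 2%:R ^+ posn (wt B c j0) != 1 :> algC.
Proof.
rewrite -natrX -[1]/(1%:R) eqr_nat -(expn0 2) eqn_exp2l //.
by rewrite -(eqz_nat _ 0) posn_ge0 ?gt_eqF // ltW.
Qed.

Lemma mpos_ext x x' : (forall l, wt B c l != 0 -> x l = x' l) -> mpos B c x = mpos B c x'.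
Proof.
move=> H; apply: eq_bigr => l _; have [w0|/H -> //] := eqVneq (wt B c l) 0.
by rewrite w0 posn_eq0.
Qed.

Lemma mneg_ext x x' : (forall l, wt B c l != 0 -> x l = x' l) -> mneg B c x = mneg B c x'.
Proof.
move=> H; apply: eq_bigr => l _; have [w0|/H -> //] := eqVneq (wt B c l) 0.
by rewrite w0 oppr0 posn_eq0.
Qed.

Lemma mpos_one : mpos B c (fun=> 1) = 1.
Proof. by rewrite /mpos big1 // => l _; rewrite expr1n. Qed.

Lemma mneg_one : mneg B c (fun=> 1) = 1.
Proof. by rewrite /mneg big1 // => l _; rewrite expr1n. Qed.

Lemma polyfun_mpos f : (forall l, polyfun (f l)) -> polyfun (fun p q => mpos B c (fun l => f l p q)).
Proof. exact: polyfun_prod. Qed.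

Lemma polyfun_mneg f : (forall l, polyfun (f l)) -> polyfun (fun p q => mneg B c (fun l => f l p q)).
Proof. exact: polyfun_prod. Qed.

Lemma mpos_two1 : mpos B c two = 2%:R ^+ posn (wt B c j0).
Proof.
by have := mpos_two 1; rewrite mpos_one mul1r => <-; apply: mpos_ext => l _; rewrite mul1r.
Qed.

Lemma mneg_two1 : mneg B c two = 1.
Proof. by have := mneg_two 1; rewrite mneg_one => <-; apply: mneg_ext => l _; rewrite mul1r. Qed.

Lemma generic_lc : generic (fun p q => mpos B c p != mneg B c p).
Proof.
apply: (@generic_neq _ (fun p _ => mneg B c p) two (fun=> 0)).
- by apply: (@polyfun_mpos (fun l p q => p l)) => l; apply: polyfun_p.
- by apply: (@polyfun_mneg (fun l p q => p l)) => l; apply: polyfun_p.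
by rewrite mpos_two1 mneg_two1 two_pow_neq1.
Qed.

Lemma generic_ray_lc l : wt B c l = 0 ->
  generic (fun p q => mpos B c (br p q l) * mneg B c p != mneg B c (br p q l) * mpos B c p).
Proof.
move=> wl; apply: (@generic_neq _ (fun p q => mneg B c (br p q l) * mpos B c p)
   (fun=> 1) (fun k => if k == l then 0 else two k)).
- by apply: polyfunM; [apply: polyfun_mpos => k; apply: polyfun_br |
    apply: (@polyfun_mneg (fun l p q => p l)) => k; apply: polyfun_p].
- by apply: polyfunM; [apply: polyfun_mneg => k; apply: polyfun_br |
    apply: (@polyfun_mpos (fun l p q => p l)) => k; apply: polyfun_p].
have E k : wt B c k != 0 -> br (fun=> 1) (fun k => if k == l then 0 else two k) l k = two k.
  move=> wk; rewrite /br eqxx mul0r subr0 mul1r; case: eqP => // kl.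
  by rewrite kl wl eqxx in wk.
by rewrite (mpos_ext E) (mneg_ext E) mpos_two1 mneg_two1 mpos_one mneg_one !mulr1 two_pow_neq1.
Qed.

Lemma generic_ray l : wt B c l = 0 ->
  generic (fun p q => mpos B c (br p q l) != mneg B c (br p q l)).
Proof.
move=> wl; apply: (@generic_neq _ (fun p q => mneg B c (br p q l))
   (fun=> 1) (fun k => if k == l then 0 else two k)).
- by apply: polyfun_mpos => k; apply: polyfun_br.
- by apply: polyfun_mneg => k; apply: polyfun_br.
have E k : wt B c k != 0 -> br (fun=> 1) (fun k => if k == l then 0 else two k) l k = two k.
  move=> wk; rewrite /br eqxx mul0r subr0 mul1r; case: eqP => // kl.
  by rewrite kl wl eqxx in wk.
by rewrite (mpos_ext E) (mneg_ext E) mpos_two1 mneg_two1 two_pow_neq1.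
Qed.

(** This makes the binomials [raybin] of distinct rows of weight zero coprime. For the witness, br p
    q l is [two] and br p q l' is -1 on all rows of nonzero weight. *)
Lemma generic_ray_ray l l' : l != l' -> wt B c l = 0 -> wt B c l' = 0 ->
  generic (fun p q => mpos B c (br p q l) * mneg B c (br p q l') !=
                      mneg B c (br p q l) * mpos B c (br p q l')).
Proof.
move=> ll' wl wl'; apply: (@generic_neq _ (fun p q => mneg B c (br p q l) * mpos B c (br p q l'))
   (fun k => if k == l' then 0 else 1) (fun k => if k == l then 0 else two k)).
- by apply: polyfunM; [apply: polyfun_mpos | apply: polyfun_mneg] => k; apply: polyfun_br.
- by apply: polyfunM; [apply: polyfun_mneg | apply: polyfun_mpos] => k; apply: polyfun_br.
set p := fun k => _; set q := fun k => _.
have ne k l1 : wt B c l1 = 0 -> wt B c k != 0 -> (k == l1) = false.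
  by move=> w1 wk; apply: contraNF wk => /eqP ->; rewrite w1.
have E k : wt B c k != 0 -> br p q l k = two k.
  by move=> wk; rewrite /br /p /q eqxx (negPf ll') !(ne k) // mul0r subr0 mul1r.
have t1 : two l' = 1 by rewrite /two; case: eqP => // e; move: j0pos; rewrite -e wl' ltxx.
have E' k : wt B c k != 0 -> br p q l' k = -1.
  by move=> wk; rewrite /br /p /q eqxx (eq_sym l' l) (negPf ll') !(ne k) // t1 mul0r sub0r mulr1.
have hc : mpos B c (fun=> -1) = mneg B c (fun=> -1).
  rewrite /mpos /mneg -!expr_sum; congr (_ ^+ _).
  have s0 : \sum_l (1%N)%:Z * wt B c l = 0 by rewrite -[RHS]sumB; apply: eq_bigr => k _; rewrite mul1r.
  have := @sum_posn _ B (fun=> 1%N) c s0; rewrite (eq_bigr _ (fun k _ => mul1n _)) => ->.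
  by apply: eq_bigr => k _; rewrite mul1n.
rewrite (mpos_ext E) (mneg_ext E) (mpos_ext E') (mneg_ext E') mpos_two1 mneg_two1 mul1r hc.
rewrite -[X in _ != X]mul1r (inj_eq (mulIf _)) ?two_pow_neq1 //.
by rewrite prodf_seq_neq0; apply/allP => k _ /=; rewrite expf_eq0 oppr_eq0 oner_eq0 andbF.
Qed.

End Generic.

(** * The degree of C in one row *)

Lemma size_linear_prod (I : Type) (r : seq I) (P : pred I) (k : I -> nat) (p q : I -> algC) :
  (forall l, p l != 0) ->
  size (\prod_(l <- r | P l) (p l *: 'X + (q l)%:P) ^+ k l) = (\sum_(l <- r | P l) k l).+1 /\
  lead_coef (\prod_(l <- r | P l) (p l *: 'X + (q l)%:P) ^+ k l) = \prod_(l <- r | P l) p l ^+ k l.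
Proof.
move=> p0; have E l : size (p l *: 'X + (q l)%:P) = 2%N /\ lead_coef (p l *: 'X + (q l)%:P) = p l.
  have sz : (size ((q l)%:P : {poly algC})%R < size (p l *: 'X)%R)%N.
    by rewrite size_scale // size_polyX ltnS size_polyC_leq1.
  by rewrite size_polyDl // lead_coefDl // lead_coefZ lead_coefX mulr1 size_scale // size_polyX.
have n0 l : (p l *: 'X + (q l)%:P) ^+ k l != 0 by rewrite expf_neq0 // -size_poly_eq0 (E l).1.
elim: r => [|l r [IHs IHl]]; first by rewrite !big_nil size_poly1 lead_coef1.
rewrite !big_cons; case: ifP => // _; rewrite lead_coefM lead_coef_exp (E l).2 IHl; split=> //.
rewrite size_mul // -?size_poly_eq0 ?IHs // addnS /=.
by have := size_exp (p l *: 'X + (q l)%:P) (k l); rewrite (E l).1 mul1n; move: (n0 l); rewrite -size_poly_gt0; case: (size _) => //= s _ ->.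
Qed.

Lemma mxvec_index_eq (m n : nat) (i k : 'I_m) (j l : 'I_n) :
  (mxvec_index i j == mxvec_index k l) = (i == k) && (j == l).
Proof. by rewrite /mxvec_index (inj_eq (@cast_ord_inj _ _ _)) (inj_eq enum_rank_inj) xpair_eqE. Qed.

Section RowDegree.
Variables (n : nat) (B : 'M[int]_(n, 2)) (C : {mpoly int[n * 2]}).
Hypothesis Cirr : mirreducible C.
Hypothesis Czero : forall p q i j, br p q i j != 0 ->
  CL C p q = 0 <-> exists s t, (s, t) != (0, 0) /\ inX B (fun l => s * p l + t * q l).
Hypothesis Cbr : forall p q p' q', (forall i j, br p q i j = br p' q' i j) -> CL C p q = CL C p' q'.
Hypothesis sumB : forall c, \sum_l wt B c l = 0.
Variables (rho m : int * int).
Hypothesis rho_m : dot rho m = 1.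
Local Notation c := (perp rho).
Variables (i : 'I_n) (g : nat).
Hypothesis g0 : (0 < g)%N.
Hypothesis rowi : rowB B i = (g%:Z * rho.1, g%:Z * rho.2).
Variable j0 : 'I_n.
Hypothesis j0pos : 0 < wt B c j0.
Implicit Types (p q : 'I_n -> algC) (al : algC) (P : {poly algC}).

(** The degree of [fpol]; multiplied by g it is the width of P_B in the direction b_i = g rho
    ([width_raydeg]). *)
Definition raydeg := (\sum_l posn (wt B c l))%N.

Lemma raydegN : raydeg = (\sum_l posn (- wt B c l))%N.
Proof.
have s0 : \sum_l (1%N)%:Z * wt B c l = 0 by rewrite -[RHS](sumB c); apply: eq_bigr => k _; rewrite mul1r.
have := @sum_posn _ B (fun=> 1%N) c s0; rewrite (eq_bigr _ (fun k _ => mul1n _)) /raydeg => ->.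
by apply: eq_bigr => k _; rewrite mul1n.
Qed.

Lemma size_fpol p q : (forall l, p l != 0) -> mpos B c p != mneg B c p ->
  size (fpol B rho p q) = raydeg.+1 /\ lead_coef (fpol B rho p q) = mpos B c p - mneg B c p.
Proof.
move=> p0 lc.
have [s1 l1] := size_linear_prod (index_enum 'I_n) predT (fun l => posn (wt B c l)) q p0.
have [s2 l2] := size_linear_prod (index_enum 'I_n) predT (fun l => posn (- wt B c l)) q p0.
rewrite -raydegN in s2.
have co : (fpol B rho p q)`_raydeg = mpos B c p - mneg B c p.
  rewrite /fpol coefB /posPol /negPol; rewrite /lead_coef s1 in l1; rewrite /lead_coef s2 in l2.
  by rewrite l1 l2.
have sz : size (fpol B rho p q) = raydeg.+1.
  apply/eqP; rewrite eqn_leq; apply/andP; split.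
    rewrite (leq_trans (size_polyD _ _)) // size_polyN geq_max /posPol /negPol.
    by rewrite s1 s2 leqnn.
  rewrite ltnNge; apply/negP => /leq_sizeP/(_ _ (leqnn _)) /eqP.
  by rewrite co subr_eq0 (negPf lc).
by rewrite sz; split=> //; rewrite /lead_coef sz.
Qed.

Definition rootseq (P : {poly algC}) : seq algC := sval (closed_field_poly_normal P).

Lemma rootseqE P : P = lead_coef P *: \prod_(z <- rootseq P) ('X - z%:P).
Proof. exact: svalP (closed_field_poly_normal P). Qed.

Lemma size_rootseq P : P != 0 -> size P = (size (rootseq P)).+1.
Proof. by move=> P0; rewrite {1}[P]rootseqE size_scale ?lead_coef_eq0 // size_prod_XsubC. Qed.

Lemma mem_rootseq P s : P != 0 -> (s \in rootseq P) = root P s.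
Proof.
by move=> P0; rewrite {2}[P]rootseqE rootZ ?lead_coef_eq0 // root_prod_XsubC.
Qed.

Definition fiberpol p q al : {poly algC} := 'X^g - (hval B m i p q al)%:P.

Lemma size_fiberpol p q al : size (fiberpol p q al) = g.+1.
Proof. by rewrite size_XnsubC. Qed.

Lemma root_fiberpol p q al x : root (fiberpol p q al) x = (x ^+ g == hval B m i p q al).
Proof. by rewrite rootE !hornerE subr_eq0. Qed.

Definition fiberpts p q : seq (algC * algC) :=
  [seq (al, x) | al <- rootseq (fpol B rho p q), x <- rootseq (fiberpol p q al)].

Lemma fiberpts_mem p q y : fpol B rho p q != 0 ->
  (y \in fiberpts p q) = root (fpol B rho p q) y.1 && (y.2 ^+ g == hval B m i p q y.1).
Proof.
have nz al : fiberpol p q al != 0 by rewrite -size_poly_eq0 size_fiberpol.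
move=> f0; apply/allpairsPdep/andP => [[al [x [h1 h2 ->]]]|[h1 h2]] /=.
  by rewrite -root_fiberpol -!mem_rootseq.
by exists y.1, y.2; rewrite !mem_rootseq // root_fiberpol; split=> //; case: y {h1 h2}.
Qed.

Lemma size_fiberpts p q : fpol B rho p q != 0 ->
  size (fiberpts p q) = (g * (size (fpol B rho p q)).-1)%N.
Proof.
move=> f0; rewrite size_allpairs_dep (size_rootseq f0) /= sumnE big_map.
under eq_bigr => al _.
  have -> : size (rootseq (fiberpol p q al)) = g.
    by apply/succn_inj; rewrite -size_rootseq ?size_fiberpol // -size_poly_eq0 size_fiberpol.
  over.
by rewrite big_const_seq count_predT iter_addn_0.
Qed.

Lemma generic_p_all : generic (fun p q => forall l : 'I_n, p l != 0).
Proof. by apply: generic_forall => l; apply: generic_p. Qed.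

Lemma generic_good : generic (good B rho i).
Proof.
have h1 := generic_lc j0pos.
have h2 : generic (fun p q => forall l j : 'I_n, l != j -> br p q l j != 0).
  by do 2![apply: generic_forall => ?]; apply: generic_cond; apply: generic_br.
have h3 : generic (fun p q => forall l : 'I_n, wt B c l = 0 -> mpos B c (br p q l) != mneg B c (br p q l)).
  by apply: generic_forall => l; apply: generic_cond => wl; apply: (generic_ray j0pos).
apply: generic_imp (generic_and (generic_and h1 h2) (generic_and h3 generic_p_all)) => p q.
move=> [[k1 k2] [k3 k4]]; split=> // [l j wl wj|l _ _ wl]; last by split; [apply: k4 | apply: k3].
by apply: k2; apply: contraTneq wl => ->; rewrite -leNgt ltW.
Qed.

Definition rowline p q : {poly algC} := line_restr (map_mpoly (fun z : int => z%:~R) C) (ptY p q)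
   (fun l => ((l == mxvec_index i 1)%:R : int)%:~R).

Lemma rowlineE p q s : (rowline p q).[s] = CL C p (upd i q (q i + s)).
Proof.
rewrite /rowline line_restrE -/(evC C _); apply: evC_ext => l; case/mxvec_indexP: l => l j.
rewrite !ptY_index /upd mxvec_index_eq; have [->|->] := ord2_cases j.
  by rewrite andbF mulr0 addr0.
by case: (eqVneq l i) => [->|li]; rewrite /= ?mulr1 // mulr0 addr0.
Qed.

(** For a generic pair the degree is maximal and the roots are simple, so it equals the number of
    roots; by [fiber] every root s has the form x - al p_i - q_i with (al, x) in [fiberpts], a list
    of g raydeg points. *)
Lemma rowline_size p q : (size (rowline p q) <= (g * raydeg).+1)%N.
Proof.
case: (classic (exists p' q', (1 < size (rowline p' q'))%N)) => [[p' [q' dep]]|N]; last first.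
  rewrite (leq_trans (_ : _ <= 1)%N) // leqNgt; apply/negP => H; apply: N.
  by exists p, q.
have Dk : ((mxvec_index i (1 : 'I_2) == mxvec_index i 1)%:R : int) = 1 by rewrite eqxx.
have [h [h0 H]] := line_separable (D := fun l => (l == mxvec_index i 1)%:R) Cirr Dk
  (ex_intro (fun y => _) (ptY p' q') dep).
have gH : generic (fun p q => (forall p' q', (size (rowline p' q') <= size (rowline p q))%N) /\
    coprimep (rowline p q) (rowline p q)^`()).
  by exists h => // p1 q1 /H[H1 H2]; split=> // p2 q2; apply: H1.
have [p1 [q1 [[smax cop] [p0 gd]]]] := generic_ex (generic_and gH (generic_and generic_p_all generic_good)).
apply: leq_trans (smax p q) _; set S := rowline p1 q1 in smax cop *.
have S0 : S != 0 by rewrite -size_poly_gt0 (leq_trans _ (smax p' q')) // ltnW.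
rewrite (size_rootseq S0) ltnS.
have [sf _] := size_fpol q1 p0 (good_lc gd).
have f0 : fpol B rho p1 q1 != 0 by rewrite -size_poly_eq0 sf.
have -> : (g * raydeg)%N = size [seq y.2 - y.1 * p1 i - q1 i | y <- fiberpts p1 q1].
  by rewrite size_map size_fiberpts // sf.
apply: uniq_leq_size => [|s].
  have eS : \prod_(z <- rootseq S) ('X - z%:P) %= S.
    apply/eqpP; exists (lead_coef S, 1); rewrite /= ?lead_coef_eq0 ?S0 ?oner_eq0 //.
    by rewrite scale1r -rootseqE.
  by rewrite -separable_prod_XsubC (eqp_separable eS) unlock.
rewrite mem_rootseq // rootE rowlineE => /eqP CL0.
have CL0' : CL C (upd i p1 (p1 i)) (upd i q1 (q1 i + s)) = 0.
  by rewrite -[RHS]CL0; apply: CL_ext => // l; rewrite /upd; case: eqP => // ->.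
have [al r E] := (fiber Czero sumB rho_m g0 rowi j0pos (p1 i) (q1 i + s) gd).1 CL0'.
apply/mapP; exists (al, al * p1 i + (q1 i + s)) => /=; last by ring.
by rewrite fiberpts_mem //= r E eqxx.
Qed.

Definition uni (F : {mpoly algC[n]}) (z : 'I_n -> algC) : {poly algC} :=
  \sum_(e <- msupp F) (F@_e * \prod_(l | l != i) z l ^+ e l) *: 'X^(e i).

Lemma uniE F z s : (uni F z).[s] = F.@[upd i z s].
Proof.
rewrite /uni mevalE horner_sum; apply: eq_bigr => e _.
rewrite hornerZ hornerXn -mulrA; congr (_ * _); rewrite [RHS](bigD1 i) //= /upd eqxx mulrC.
by congr (_ * _); apply: eq_bigr => l /negPf ->.
Qed.

Lemma uni_coef F e : F@_e != 0 -> exists z, (uni F z)`_(e i) != 0.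
Proof.
move=> Fe; have eF : e \in msupp F by rewrite mcoeff_msupp.
pose G : {mpoly algC[n]} := \sum_(e' <- msupp F | e' i == e i) F@_e' *: 'X_[e'].
have : G != 0.
  apply: contraNneq Fe => /(congr1 (mcoeff e)); rewrite mcoeff0 /G raddf_sum /= -big_filter.
  rewrite (bigD1_seq e) ?mem_filter ?eqxx ?filter_uniq ?msupp_uniq //=.
  rewrite mcoeffZ mcoeffX eqxx mulr1 big1 ?addr0 => [->//|e' ee'].
  by rewrite mcoeffZ mcoeffX (negPf ee') mulr0.
move=> /mpoly_nonroot[z]; rewrite /G raddf_sum /= => H; exists z.
apply: contraNneq H => U0; apply/eqP.
transitivity (z i ^+ e i * (uni F z)`_(e i)); last by rewrite U0 mulr0.
rewrite /uni coef_sum mulr_sumr big_mkcond; apply: eq_bigr => e' _ /=.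
rewrite coefZ coefXn eq_sym; case: eqP => [->|_]; last by rewrite mulr0 mulr0.
by rewrite mevalZ mevalX mulr1 mulrCA; congr (_ * _); rewrite (bigD1 i).
Qed.

Lemma uni_CF p q z s :
  (uni (CF C p q) z).[s] = CL C (fun l => upd i z s l * p l) (fun l => upd i z s l * q l).
Proof. by rewrite uniE CF_eval. Qed.

(** [rowline_size] controls only the entry q_i. A column operation that preserves all brackets makes
    p_i vanish, and scaling row i then moves q_i alone. *)
Lemma size_uni_CF p q z : (size (uni (CF C p q) z) <= (g * raydeg).+1)%N.
Proof.
have key p' q' ka : (forall s, CL C (fun l => upd i z s l * p l) (fun l => upd i z s l * q l) =
      CL C p' (upd i q' (q' i + ka * s))) -> (size (uni (CF C p q) z) <= (g * raydeg).+1)%N.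
  move=> H; have -> : uni (CF C p q) z = rowline p' q' \Po (ka *: 'X).
    by apply: poly_ext => s; rewrite uni_CF H -rowlineE horner_comp !hornerE.
  apply: leq_trans (size_comp_poly_leq _ _) _; rewrite ltnS.
  have s2 : (size (ka *: 'X : {poly algC})%R <= 2)%N by rewrite (leq_trans (size_scale_leq _ _)) ?size_polyX.
  apply: (@leq_trans ((size (rowline p' q')).-1 * 1)%N); first by rewrite leq_mul2l -[X in _ || (X <= _)%N]subn1 leq_subLR s2 orbT.
  by rewrite muln1; have := rowline_size p' q'; case: (size _).
have [qi|qi] := eqVneq (q i) 0; last first.
  pose ka := p i / q i.
  apply: (key (fun l => if l == i then 0 else z l * p l - ka * (z l * q l))
    (fun l => if l == i then 0 else z l * q l) (q i)) => s.
  rewrite (@Cbr _ _ (fun l => upd i z s l * p l - ka * (upd i z s l * q l)) (fun l => upd i z s l * q l)); last first.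
    by move=> a b; rewrite /br; ring.
  apply: CL_ext => l; rewrite /upd; case: eqP => [->|//].
    by rewrite /ka mulrCA divfK // subrr.
  by rewrite eqxx add0r mulrC.
have [pi|pi] := eqVneq (p i) 0.
  apply: (key (fun l => if l == i then 0 else z l * p l)
    (fun l => if l == i then 0 else z l * q l) 0) => s.
  apply: CL_ext => l; rewrite /upd; case: eqP => [->|//]; first by rewrite pi mulr0.
  by rewrite eqxx qi mulr0 mul0r addr0.
apply: (key (fun l => if l == i then 0 else - (z l * q l))
    (fun l => if l == i then 0 else z l * p l) (p i)) => s.
rewrite (@Cbr _ _ (fun l => - (upd i z s l * q l)) (fun l => upd i z s l * p l)); last first.
  by move=> a b; rewrite /br; ring.
apply: CL_ext => l; rewrite /upd; case: eqP => [->|//]; first by rewrite qi mulr0 oppr0.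
by rewrite eqxx add0r mulrC.
Qed.

Lemma row_degree_bound e : rowexp C e -> (e i <= g * raydeg)%N.
Proof.
case=> p [q /uni_coef[z]]; apply: contraNleq => H; apply/eqP/nth_default.
exact: leq_trans (size_uni_CF p q z) H.
Qed.

End RowDegree.

(** * The part of C of top degree in one row *)

Lemma uniq_rootseq (P : {poly algC}) : P != 0 ->
  (forall x, root P x -> ~~ root P^`() x) -> uniq (rootseq P).
Proof.
move=> P0 H; have eP : \prod_(z <- rootseq P) ('X - z%:P) %= P.
  apply/eqpP; exists (lead_coef P, 1); rewrite /= ?lead_coef_eq0 ?P0 ?oner_eq0 //.
  by rewrite scale1r -rootseqE.
rewrite -separable_prod_XsubC (eqp_separable eP) unlock.
by apply/Pdiv.ClosedField.coprimepP => x /H; rewrite rootE.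
Qed.

Lemma coef_prod_linear (I : Type) (s : seq I) (a b : I -> algC) :
  (size (\prod_(y <- s) (a y *: 'X + (b y)%:P))%R <= (size s).+1)%N /\
  (\prod_(y <- s) (a y *: 'X + (b y)%:P))`_(size s) = \prod_(y <- s) a y.
Proof.
elim: s => [|y s [IHs IHc]]; first by rewrite !big_nil size_poly1 coef1.
have s2 : (size (a y *: 'X + (b y)%:P)%R <= 2)%N.
  rewrite (leq_trans (size_polyD _ _)) // geq_max (leq_trans (size_scale_leq _ _)) ?size_polyX //=.
  by rewrite (leq_trans (size_polyC_leq1 _)).
rewrite !big_cons; split.
  rewrite (leq_trans (size_polyMleq _ _)) // -subn1 leq_subLR.
  by rewrite (leq_trans (leq_add s2 IHs)) // addSn addnS.
rewrite mulrDl coefD -scalerAl coefZ coefXM /= IHc coefCM.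
by rewrite [X in b y * X]nth_default ?mulr0 ?addr0.
Qed.

Section FiberIdentity.
Variables (n : nat) (B : 'M[int]_(n, 2)) (C : {mpoly int[n * 2]}).
Hypothesis Czero : forall p q i j, br p q i j != 0 ->
  CL C p q = 0 <-> exists s t, (s, t) != (0, 0) /\ inX B (fun l => s * p l + t * q l).
Hypothesis sumB : forall c, \sum_l wt B c l = 0.
Variables (rho m0 : int * int).
Hypothesis rho_m : dot rho m0 = 1.
Local Notation c := (perp rho).
Variables (i : 'I_n) (g : nat).
Hypothesis g0 : (0 < g)%N.
Hypothesis rowi : rowB B i = (g%:Z * rho.1, g%:Z * rho.2).
Variable j0 : 'I_n.
Hypothesis j0pos : 0 < wt B c j0.
Local Notation W := (g * raydeg B rho)%N.
Hypothesis degW : forall m, m \in msupp C -> (rowdeg m i <= W)%N.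
Implicit Types (p q : 'I_n -> algC) (al : algC) (S : pred 'X_{1..n * 2}).

Definition psum S p q : algC :=
  \sum_(m <- msupp C | S m) (C@_m)%:~R * \prod_l ptY p q l ^+ m l.

Lemma psum_CL p q : psum predT p q = CL C p q.
Proof. by rewrite /CL evCE. Qed.

Definition topsum := psum (fun m => rowdeg m i == W).
(** Setting row i to 1 removes it from the monomials: under [degW] this is the coefficient of b^W in
    CL C (upd i p a) (upd i q b). *)
Definition leadsum p q := psum (fun m => m (mxvec_index i 1) == W) (upd i p 1) (upd i q 1).

Lemma psum_upd S p q a b : psum S (upd i p a) (upd i q b) =
  \sum_(m <- msupp C | S m) ((C@_m)%:~R * \prod_l ptY (upd i p 1) (upd i q 1) l ^+ m l) *
     (a ^+ m (mxvec_index i 0) * b ^+ m (mxvec_index i 1)).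
Proof.
apply: eq_bigr => m _; rewrite -mulrA; congr (_ * _).
rewrite !prod_index (bigD1 i) //= [in RHS](bigD1 i) //= !ptY_index /= /upd eqxx !expr1n !mul1r mulrC.
by congr (_ * _); apply: eq_bigr => l /negPf li; rewrite !ptY_index li.
Qed.

Section Point.
Variables (p q : 'I_n -> algC).
Hypothesis gd : good B rho i p q.
Hypothesis p0 : forall l, p l != 0.
Hypothesis sep : forall x, root (fpol B rho p q) x -> ~~ root (fpol B rho p q)^`() x.
Local Notation f := (fpol B rho p q).
Local Notation pts := (fiberpts B rho m0 i g p q).
Local Notation lc := (mpos B c p - mneg B c p).

Lemma size_f : size f = (raydeg B rho).+1 /\ lead_coef f = lc.
Proof. exact: (size_fpol sumB q p0 (good_lc gd)). Qed.

Lemma f_neq0 : f != 0.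
Proof. by rewrite -size_poly_eq0 size_f.1. Qed.

Lemma size_pts : size pts = W.
Proof. by rewrite size_fiberpts ?f_neq0 // size_f.1. Qed.

Lemma uniq_pts : uniq pts.
Proof.
apply: allpairs_uniq_dep; first exact: uniq_rootseq f_neq0 sep.
  move=> al; rewrite mem_rootseq ?f_neq0 // => r; apply: uniq_rootseq.
    by rewrite -size_poly_eq0 size_fiberpol.
  move=> x; rewrite root_fiberpol => /eqP E.
  have x0 : x != 0.
    apply: contraNneq (hval_neq0 sumB m0 gd r) => x0.
    by rewrite -E x0 expr0n gtn_eqF.
  rewrite rootE /fiberpol derivB derivC subr0 derivXn hornerMn hornerXn.
  by rewrite mulrn_eq0 negb_or -lt0n g0 expf_neq0.
by move=> [al x] [al' x'] _ _ /= [-> ->].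
Qed.

Lemma fiber_factor a : (forall y y', y \in pts -> y' \in pts -> y.2 - y.1 * a = y'.2 - y'.1 * a -> y = y') ->
  forall b, CL C (upd i p a) (upd i q b) = leadsum p q * \prod_(y <- pts) (y.1 * a + b - y.2).
Proof.
move=> inj b.
pose cm m := (C@_m)%:~R * \prod_l ptY (upd i p 1) (upd i q 1) l ^+ m l.
pose Sp : {poly algC} := \sum_(m <- msupp C) (cm m * a ^+ m (mxvec_index i 0)) *: 'X^(m (mxvec_index i 1)).
have SpE x : Sp.[x] = CL C (upd i p a) (upd i q x).
  rewrite -psum_CL psum_upd /Sp horner_sum; apply: eq_bigr => m _.
  by rewrite hornerZ hornerXn /cm -!mulrA.
pose ys := [seq y.2 - y.1 * a | y <- pts].
have uys : uniq ys by rewrite map_inj_in_uniq ?uniq_pts.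
have sys : size ys = W by rewrite size_map size_pts.
pose Pp : {poly algC} := leadsum p q *: \prod_(z <- ys) ('X - z%:P).
have PpE x : Pp.[x] = leadsum p q * \prod_(y <- pts) (y.1 * a + x - y.2).
  rewrite /Pp hornerZ horner_prod big_map; congr (_ * _); apply: eq_bigr => y _.
  by rewrite !hornerE opprB addrCA addrA.
suff : Sp - Pp = 0 by move/eqP; rewrite subr_eq0 => /eqP e; rewrite -SpE e PpE.
have vdeg m : m \in msupp C -> (m (mxvec_index i 0%R) + m (mxvec_index i 1%R) <= W)%N.
  by move=> /degW; rewrite mnmE.
have sz : (size (Sp - Pp)%R <= W)%N.
  apply/leq_sizeP => k kW; rewrite coefB /Sp coef_sum.
  move: kW; rewrite leq_eqVlt => /predU1P[<-|kW].
    have -> : Pp`_W = leadsum p q.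
      rewrite /Pp coefZ (_ : (\prod_(z <- ys) ('X - z%:P))`_W = 1) ?mulr1 //.
      by have /monicP := monic_prod_XsubC ys predT id; rewrite /lead_coef size_prod_XsubC sys.
    apply/eqP; rewrite subr_eq0; apply/eqP; rewrite /leadsum /psum -/(cm _) [RHS]big_mkcond.
    rewrite [LHS]big_seq [RHS]big_seq; apply: eq_bigr => m mC.
    rewrite coefZ coefXn eq_sym; case: eqP => [vW|_]; last by rewrite mulr0.
    by rewrite mulr1 (_ : m _ = 0%N) ?mulr1 //; apply/eqP; have := vdeg _ mC; rewrite vW -[X in (_ <= X)%N]add0n leq_add2r leqn0.
  rewrite /Pp coefZ [X in _ * X]nth_default ?mulr0 ?subr0; last by rewrite size_prod_XsubC sys.
  rewrite big_seq big1 // => m mC; rewrite coefZ coefXn (_ : (k == _) = false) ?mulr0 //.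
  by apply: contraTF kW => /eqP ->; rewrite -leqNgt (leq_trans _ (vdeg _ mC)) // leq_addl.
apply/eqP/negPn/negP => N; have := max_poly_roots N _ uys; rewrite sys ltnNge sz => H.
suff /H : all (root (Sp - Pp)) ys by [].
apply/allP => x /mapP[y yp ->]; rewrite rootE hornerD hornerN SpE PpE.
rewrite (big_rem y) //= (_ : y.1 * a + (y.2 - y.1 * a) - y.2 = 0) ?mul0r ?mulr0 ?subr0; last by ring.
move: yp; rewrite fiberpts_mem ?f_neq0 // => /andP[r E].
apply/eqP; apply: (proj2 (fiber Czero sumB rho_m g0 rowi j0pos _ _ gd)); exists y.1 => //.
by rewrite -(eqP E); congr (_ ^+ _); ring.
Qed.

Definition collision : {poly algC} := \prod_(y <- pts) \prod_(y' <- pts | y' != y)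
  ((y.2 - y'.2)%:P - (y.1 - y'.1) *: 'X).

Lemma collision_neq0 : collision != 0.
Proof.
rewrite prodf_seq_neq0; apply/allP => y _ /=; rewrite prodf_seq_neq0; apply/allP => y' _ /=.
apply/implyP => yy'; apply: contraNneq yy' => /polyP E.
have := E 0%N; have := E 1%N; rewrite !coefB !coefZ !coefX !coefC /= mulr1 mulr0 subr0 sub0r.
move=> /eqP; rewrite oppr_eq0 subr_eq0 => /eqP e1 /eqP; rewrite subr_eq0 => /eqP e2.
by case: y y' e1 e2 {E} => [? ?] [? ?] /= -> ->.
Qed.

Lemma collisionP a : collision.[a] != 0 -> forall y y', y \in pts -> y' \in pts ->
  y.2 - y.1 * a = y'.2 - y'.1 * a -> y = y'.
Proof.
rewrite horner_prod prodf_seq_neq0 => /allP H y y' yp y'p E.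
apply/esym/eqP/negPn/negP => N; have /= := H y yp.
rewrite horner_prod prodf_seq_neq0 => /allP/(_ _ y'p)/implyP/(_ N)/eqP; apply.
rewrite !hornerE; apply/eqP; rewrite subr_eq0; apply/eqP.
by move/eqP: E; rewrite subr_eq -addrA => /eqP ->; ring.
Qed.

(** The variable scales row i. [fiber_factor] gives the identity at every z for which p_i z is not a
    root of [collision], which is enough for polynomials. *)
Lemma scaled_fiber : \sum_(m <- msupp C) ((C@_m)%:~R * \prod_l ptY p q l ^+ m l) *: 'X^(rowdeg m i) =
  leadsum p q *: \prod_(y <- pts) ((y.1 * p i + q i) *: 'X + (- y.2)%:P).
Proof.
apply/eqP; rewrite -subr_eq0; set D := _ - _.
have c0 : collision \Po (p i *: 'X) != 0.
  by rewrite comp_poly_eq0 ?collision_neq0 // size_scale // size_polyX.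
suff : D * (collision \Po (p i *: 'X)) = 0 by move/eqP; rewrite mulf_eq0 (negPf c0) orbF.
apply: poly_ext => z; rewrite horner0 hornerM horner_comp; apply/eqP; rewrite mulf_eq0 orbC -implyNb.
apply/implyP; rewrite hornerZ hornerX => /collisionP/fiber_factor/(_ (q i * z)) E.
rewrite /D hornerD hornerN subr_eq0 hornerZ; apply/eqP.
transitivity (CL C (upd i p (p i * z)) (upd i q (q i * z))).
  rewrite -psum_CL psum_upd horner_sum; apply: eq_bigr => m _; rewrite hornerZ hornerXn.
  rewrite -!mulrA; congr (_ * _); rewrite !prod_index (bigD1 i) //= [in RHS](bigD1 i) //= !ptY_index /= /upd eqxx.
  rewrite !expr1n !mul1r mnmE exprD !exprMn.
  rewrite (eq_bigr (fun l => p l ^+ m (mxvec_index l 0) * q l ^+ m (mxvec_index l 1))); last first.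
    by move=> l _; rewrite !ptY_index.
  rewrite [in RHS](eq_bigr (fun l => p l ^+ m (mxvec_index l 0) * q l ^+ m (mxvec_index l 1))); last first.
    by move=> l /negPf li; rewrite !ptY_index /= li.
  rewrite [_ * \prod_(_ | _) _]mulrC -mulrA; congr (_ * _).
  by rewrite mulrACA.
rewrite E; congr (_ * _); rewrite horner_prod; apply: eq_bigr => y _.
by rewrite hornerD hornerZ hornerX hornerC; ring.
Qed.

Lemma leadsum_eq0 : leadsum p q = 0 -> CL C p q = 0.
Proof.
move=> L0; have := congr1 (fun P : {poly algC} => P.[1]) scaled_fiber.
rewrite L0 scale0r horner0 horner_sum => H; rewrite -psum_CL -[RHS]H; apply: eq_bigr => m _.
by rewrite hornerZ hornerXn expr1n mulr1.
Qed.

Lemma topsumE : topsum p q = leadsum p q * (\prod_(al <- rootseq f) (al * p i + q i)) ^+ g.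
Proof.
have := congr1 (fun P : {poly algC} => P`_W) scaled_fiber.
have [_ ] := coef_prod_linear pts (fun y => y.1 * p i + q i) (fun y => - y.2).
rewrite size_pts coefZ => -> /=; rewrite coef_sum => H.
transitivity (\sum_(m <- msupp C) (((C@_m)%:~R * \prod_l ptY p q l ^+ m l) *: 'X^(rowdeg m i))`_W).
  rewrite /topsum /psum big_mkcond; apply: eq_bigr => m _; rewrite coefZ coefXn eq_sym.
  by case: eqP; rewrite ?mulr1 ?mulr0.
rewrite H; congr (_ * _); rewrite /fiberpts big_allpairs_dep /= -prodrXl; apply: eq_bigr => al _.
rewrite big_const_seq count_predT iter_mulr_1; congr (_ ^+ _).
by apply/succn_inj; rewrite -size_rootseq ?size_fiberpol // -size_poly_eq0 size_fiberpol.
Qed.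

(** br p q i is p_i times the point of the line whose coordinate i vanishes, at al = - q_i / p_i; so
    its binomial is, up to a power of p_i, the value of f there. *)
Lemma ray_value : mpos B c (br p q i) - mneg B c (br p q i) =
  lc * ((-1) ^+ raydeg B rho * \prod_(al <- rootseq f) (al * p i + q i)).
Proof.
have E : br p q i =1 (fun l => p i * lin p q (- q i / p i) l).
  move=> l; rewrite /br /lin.
  have -> : p i * (- q i / p i * p l + q l) = (- q i / p i * p i) * p l + p i * q l by ring.
  by rewrite divfK //; ring.
have e1 : mpos B c (br p q i) = p i ^+ raydeg B rho * mpos B c (lin p q (- q i / p i)).
  rewrite (mpos_ext (x' := fun l => p i * lin p q (- q i / p i) l)) // mposM; congr (_ * _).
  by rewrite /raydeg expr_sum.
have e2 : mneg B c (br p q i) = p i ^+ raydeg B rho * mneg B c (lin p q (- q i / p i)).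
  rewrite (mneg_ext (x' := fun l => p i * lin p q (- q i / p i) l)) // mnegM; congr (_ * _).
  by rewrite raydegN // expr_sum.
have fE : f.[- q i / p i] = mpos B c (lin p q (- q i / p i)) - mneg B c (lin p q (- q i / p i)).
  by rewrite /fpol hornerD hornerN posPol_E negPol_E.
rewrite e1 e2 -mulrBr -fE {1}[f]rootseqE size_f.2 hornerZ mulrCA; congr (_ * _).
have <- : size (rootseq f) = raydeg B rho by apply/succn_inj; rewrite -size_rootseq ?f_neq0 // size_f.1.
rewrite horner_prod.
elim: (rootseq f) => [|al s IH]; first by rewrite !big_nil !expr0.
rewrite !big_cons exprS mulrACA IH exprS; set X := \prod_(_ <- _) _.
have -> : p i * ('X - al%:P).[- q i / p i] = - (al * p i + q i).
  by rewrite hornerXsubC mulrBr [p i * (_ / _)]mulrC divfK //; ring.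
ring.
Qed.

(** Eliminates the roots of f between [topsumE] and [ray_value]; the g-th power of the binomial at
    br p q i is the factor that later divides the part of top degree. *)
Lemma fiber_identity : topsum p q * lc ^+ g = leadsum p q *
  ((-1) ^+ raydeg B rho * (mpos B c (br p q i) - mneg B c (br p q i))) ^+ g.
Proof.
rewrite topsumE ray_value -mulrA -exprMn; congr (_ * _ ^+ _).
set P := \prod_(_ <- _) _; have s1 : (-1) ^+ raydeg B rho * (-1) ^+ raydeg B rho = 1 :> algC.
  by rewrite -exprMn mulrNN mul1r expr1n.
by rewrite [RHS]mulrCA [X in _ = _ * X]mulrA s1 mul1r mulrC.
Qed.

End Point.
End FiberIdentity.

(** The lowest exponent of T is that of Q because K has a constant term, and the degree of T is deg
    Q + deg K. *)
Lemma poly_span (T Q K : {poly algC}) : T = Q * K -> T != 0 -> K`_0 != 0 ->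
  exists a b, [/\ T`_a != 0, T`_b != 0 & (a + (size K).-1 <= b)%N].
Proof.
move=> TE T0 K0; have Q0 : Q != 0 by apply: contraNneq T0 => Q0; rewrite TE Q0 mul0r.
have Kn0 : K != 0 by apply: contraNneq K0 => ->; rewrite coef0.
have ex : exists a, Q`_a != 0 by exists (size Q).-1; rewrite -lead_coefE lead_coef_eq0.
case: (ex_minnP ex) => a Qa amin; exists a, (size T).-1.
have lt0 k : (k < a)%N -> Q`_k = 0.
  by move=> ka; apply/eqP; apply: contraTT ka => /amin; rewrite leqNgt.
split; last first.
- rewrite TE size_mul //.
  have aQ : (a < size Q)%N by rewrite ltnNge; apply: contra Qa => /(nth_default 0) ->.
  move: Kn0 aQ; rewrite -size_poly_gt0; case: (size K) => // k _; case: (size Q) => // s.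
  by rewrite !addnS /= leq_add2r ltnS.
- by rewrite -lead_coefE lead_coef_eq0.
rewrite TE coefM (bigD1 ord_max) //= subnn big1 ?addr0 ?mulf_neq0 // => k ka.
by rewrite lt0 ?mul0r // ltn_neqAle -ltnS ltn_ord andbT.
Qed.

Lemma prod_dvdp (I : eqType) (s : seq I) (F : I -> {poly algC}) T : uniq s ->
  (forall x, x \in s -> F x %| T) ->
  (forall x y, x \in s -> y \in s -> x != y -> coprimep (F x) (F y)) ->
  \prod_(x <- s) F x %| T.
Proof.
elim: s => [|x s IH]; first by rewrite big_nil dvd1p.
move=> /= /andP[xs us] H co; rewrite big_cons Gauss_dvdp.
  rewrite H ?mem_head // IH // => [y ys|y z ys zs]; first by rewrite H // inE ys orbT.
  by apply: co; rewrite inE ?ys ?zs orbT.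
rewrite big_seq; apply: (big_ind (coprimep (F x))) => [|p q|y ys]; first exact: coprimep1.
  by rewrite coprimepMr => -> ->.
by apply: co; rewrite ?mem_head ?inE ?ys ?orbT //; apply: contraNneq xs => ->.
Qed.

Definition binom (U : nat) (a b : algC) : {poly algC} := a *: 'X^U - b%:P.

Lemma binomE U a b z : (binom U a b).[z] = a * z ^+ U - b.
Proof. by rewrite /binom hornerD hornerN hornerZ hornerXn hornerC. Qed.

Lemma binom_coprime U a b a' b' : a * b' != b * a' -> coprimep (binom U a b) (binom U a' b').
Proof.
move=> H; apply/Bezout_coprimepP; exists (a'%:P, - a%:P) => /=.
have -> : a'%:P * binom U a b + - a%:P * binom U a' b' = (a * b' - b * a')%:P.
  by rewrite /binom -!mul_polyC polyCB !polyCM; ring.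
by rewrite -[X in _ %= X]polyC1 polyC_eqp1 subr_eq0.
Qed.

Lemma binom_neq0 U a b : (0 < U)%N -> (a != 0) || (b != 0) -> binom U a b != 0.
Proof.
move=> U0 /orP[a0|b0]; apply/eqP => E.
  have := congr1 (fun p : {poly algC} => p`_U) E.
  rewrite /binom coefB coefZ coefXn eqxx coefC gtn_eqF // coef0 mulr1 subr0 => /eqP.
  by rewrite (negPf a0).
have := congr1 (fun p : {poly algC} => p`_0) E.
rewrite /binom coefB coefZ coefXn coefC ltn_eqF // coef0 mulr0 sub0r => /eqP.
by rewrite oppr_eq0 (negPf b0).
Qed.

Lemma size_binom U a b : (0 < U)%N -> a != 0 -> size (binom U a b) = U.+1.
Proof.
move=> U0 a0; rewrite /binom size_polyDl ?size_scale ?size_polyXn // size_polyN.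
by rewrite (leq_ltn_trans (size_polyC_leq1 _)).
Qed.

Lemma size_prod_pow (I : eqType) (s : seq I) (F : I -> {poly algC}) (k : I -> nat) U :
  (forall x, x \in s -> size (F x) = U.+1) ->
  size (\prod_(x <- s) F x ^+ k x) = (U * \sum_(x <- s) k x).+1.
Proof.
elim: s => [|x s IH] H; first by rewrite !big_nil size_poly1 muln0.
have Fn0 y : y \in x :: s -> F y ^+ k y != 0.
  by move=> ys; rewrite expf_neq0 // -size_poly_eq0 H.
rewrite !big_cons size_mul ?Fn0 ?mem_head //; last first.
  rewrite prodf_seq_neq0; apply/allP => y ys /=; apply: Fn0; by rewrite inE ys orbT.
rewrite IH => [|y ys]; last by rewrite H // inE ys orbT.
have := size_exp (F x) (k x); rewrite H ?mem_head // mulnDr => /= <-.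
by rewrite addnS /= -addSn prednK // size_poly_gt0 Fn0 ?mem_head.
Qed.

(** * Faces of V as long as the edges of P_B *)

Section Edge.
Variables (n : nat) (B : 'M[int]_(n, 2)) (C : {mpoly int[n * 2]}).
Hypothesis Czero : forall p q i j, br p q i j != 0 ->
  CL C p q = 0 <-> exists s t, (s, t) != (0, 0) /\ inX B (fun l => s * p l + t * q l).
Hypothesis sumB : forall c, \sum_l wt B c l = 0.
Variables (rho m0 : int * int).
Hypothesis rho_m : dot rho m0 = 1.
Local Notation c := (perp rho).
Variable j : 'I_n.
Hypothesis jpos : 0 < wt B c j.
Local Notation U := (posn (wt B c j)).
Local Notation N := (raydeg B rho).
Implicit Types (S : pred 'X_{1..n * 2}).

Definition sc (z : algC) (p : 'I_n -> algC) l := (if l == j then z else 1) * p l.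

Lemma U_gt0 : (0 < U)%N.
Proof. by rewrite -ltz_nat posn_ge0 // ltW. Qed.

Lemma mpos_sc z p : mpos B c (sc z p) = z ^+ U * mpos B c p.
Proof.
rewrite /sc mposM; congr (_ * _); rewrite /mpos (bigD1 j) //= eqxx big1 ?mulr1 // => l /negPf ->.
by rewrite expr1n.
Qed.

Lemma mneg_sc z p : mneg B c (sc z p) = mneg B c p.
Proof.
rewrite /sc mnegM -[RHS]mul1r; congr (_ * _); rewrite /mneg big1 // => l _.
by case: eqP => [->|_]; rewrite ?expr1n // posn_eq0 ?expr0 // oppr_le0 ltW.
Qed.

Lemma wt0_neqj l : wt B c l = 0 -> (l == j) = false.
Proof. by move=> wl; apply: contraTF jpos => /eqP <-; rewrite wl ltxx. Qed.

Lemma br_sc z p q l : wt B c l = 0 -> br (sc z p) (sc z q) l =1 sc z (br p q l).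
Proof. by move=> wl k; rewrite /br /sc wt0_neqj //; ring. Qed.

Definition psump S p q : {poly algC} :=
  \sum_(m <- msupp C | S m) ((C@_m)%:~R * \prod_l ptY p q l ^+ m l) *: 'X^(rowdeg m j).

Lemma psump_eval S p q z : (psump S p q).[z] = psum C S (sc z p) (sc z q).
Proof.
rewrite /psump horner_sum; apply: eq_bigr => m _; rewrite hornerZ hornerXn -mulrA; congr (_ * _).
rewrite !prod_index (bigD1 j) //= [in RHS](bigD1 j) //= !ptY_index /= /sc eqxx mulrC mulrA.
congr (_ * _); first by rewrite mnmE exprD !exprMn mulrACA.
by apply: eq_bigr => l /negPf lj; rewrite !ptY_index /= lj !mul1r.
Qed.

Section Base.
Variables (p q : 'I_n -> algC).
Hypothesis p0 : forall l, p l != 0.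
Hypothesis br0 : forall l l', l != l' -> br p q l l' != 0.
Hypothesis cross_lc : forall l, wt B c l = 0 ->
  mpos B c (br p q l) * mneg B c p != mneg B c (br p q l) * mpos B c p.
Hypothesis cross : forall l l', l != l' -> wt B c l = 0 -> wt B c l' = 0 ->
  mpos B c (br p q l) * mneg B c (br p q l') != mneg B c (br p q l) * mpos B c (br p q l').
Hypothesis CL0 : CL C p q != 0.

Definition lcbin := binom U (mpos B c p) (mneg B c p).
Definition raybin l := binom U (mpos B c (br p q l)) (mneg B c (br p q l)).
(** A double root of z^U posPol - negPol is a root of this polynomial, which does not depend on z;
    hence only finitely many z destroy separability. *)
Definition wronsk := (posPol B rho p q)^`() * negPol B rho p q - posPol B rho p q * (negPol B rho p q)^`().
Definition wrbin al := binom U (posPol B rho p q).[al] (negPol B rho p q).[al].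
(** Where it does not vanish, the pair with row j scaled by z satisfies the hypotheses of
    [fiber_identity] ([good_sc], [sc_neq0], [sep_sc]). *)
Definition badpol := 'X * lcbin * \prod_(l | wt B c l == 0) raybin l *
  \prod_(al <- rootseq wronsk) wrbin al.

Lemma mneg_n0 x : (forall l, wt B c l != 0 -> x l != 0) -> mneg B c x != 0.
Proof. exact: mneg_neq0. Qed.

Lemma mpos_n0 x : (forall l, wt B c l != 0 -> x l != 0) -> mpos B c x != 0.
Proof.
move=> H; rewrite prodf_seq_neq0; apply/allP => l _ /=; rewrite expf_eq0 negb_and.
have [w0|/H ->] := eqVneq (wt B c l) 0; last by rewrite orbT.
by rewrite w0 /posn maxxx.
Qed.

Lemma br_row_neq0 l : wt B c l = 0 -> forall k, wt B c k != 0 -> br p q l k != 0.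
Proof. by move=> wl k wk; apply: br0; apply: contraNneq wk => <-; apply/eqP. Qed.

Lemma raybin_neq0 l : wt B c l = 0 -> raybin l != 0.
Proof. by move=> wl; apply: binom_neq0 U_gt0 _; rewrite mpos_n0 //; apply: br_row_neq0. Qed.

Lemma lin_pair0 al l k : lin p q al l = 0 -> lin p q al k = 0 -> br p q l k = 0.
Proof.
rewrite /lin /br => /eqP; rewrite addrC addr_eq0 => /eqP -> /eqP; rewrite addrC addr_eq0 => /eqP ->.
ring.
Qed.

Lemma factor_zero (k : 'I_n -> int) x : \prod_l x l ^+ posn (k l) = 0 :> algC ->
  exists2 l, x l = 0 & 0 < k l.
Proof.
move=> /eqP; rewrite prodf_seq_eq0 => /hasP[l _] /=.
rewrite expf_eq0 => /andP[k0 /eqP xl]; exists l => //.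
by rewrite ltNge; apply/negP => wl; move: k0; rewrite posn_eq0.
Qed.

Lemma wrbin_neq0 al : wrbin al != 0.
Proof.
apply: binom_neq0 U_gt0 _; rewrite -negb_and; apply/negP => /andP[].
rewrite posPol_E negPol_E => /eqP/factor_zero[l xl wl] /eqP/factor_zero[k xk wk].
have : br p q l k != 0 by apply: br0; apply: contraTneq wk => <-; rewrite oppr_gt0 -leNgt ltW.
by rewrite (lin_pair0 xl xk) eqxx.
Qed.

Lemma posneg_coprime : coprimep (posPol B rho p q) (negPol B rho p q).
Proof.
apply/Pdiv.ClosedField.coprimepP => al; rewrite rootE posPol_E negPol_E => /eqP E.
apply/negP => /eqP E'; have [l xl wl] := factor_zero E; have [k xk wk] := factor_zero E'.
have : br p q l k != 0 by apply: br0; apply: contraTneq wk => <-; rewrite oppr_gt0 -leNgt ltW.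
by rewrite (lin_pair0 xl xk) eqxx.
Qed.

Lemma wronsk_neq0 : wronsk != 0.
Proof.
have [s1 _] := size_linear_prod (index_enum 'I_n) predT (fun l => posn (wt B c l)) q p0.
have N0 : (0 < N)%N by rewrite /raydeg (bigD1 j) //= addn_gt0 U_gt0.
apply/eqP => /eqP; rewrite subr_eq0 => /eqP E.
have : posPol B rho p q %| (posPol B rho p q)^`().
  by rewrite -(Gauss_dvdpl _ posneg_coprime) E dvdp_mulr.
have pp0 : posPol B rho p q != 0 by rewrite -size_poly_eq0 /posPol s1.
have d0 : (posPol B rho p q)^`() != 0.
  apply/eqP => d0; have := congr1 (fun P : {poly algC} => P`_N.-1) d0.
  rewrite coef_deriv coef0 prednK // => /eqP; rewrite mulrn_eq0 gtn_eqF //=.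
  have -> : (posPol B rho p q)`_N = lead_coef (posPol B rho p q) by rewrite lead_coefE /posPol s1.
  by rewrite lead_coef_eq0 (negPf pp0).
by move=> /(dvdp_leq d0); rewrite leqNgt lt_size_deriv.
Qed.

Lemma badpol_neq0 : badpol != 0.
Proof.
rewrite /badpol !mulf_neq0 ?polyX_eq0 //.
- by apply: binom_neq0 U_gt0 _; rewrite mpos_n0 // => l _; apply: p0.
- by apply/prodf_neq0 => l /eqP; apply: raybin_neq0.
- by rewrite prodf_seq_neq0; apply/allP => al _; apply: wrbin_neq0.
Qed.

Section Scaled.
Variable z : algC.
Hypothesis gz : badpol.[z] != 0.

Lemma badpol_spec : [/\ z != 0, z ^+ U * mpos B c p != mneg B c p,
  (forall l, wt B c l = 0 -> z ^+ U * mpos B c (br p q l) != mneg B c (br p q l)) &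
  (forall al, root wronsk al -> z ^+ U * (posPol B rho p q).[al] != (negPol B rho p q).[al])].
Proof.
move: gz; rewrite /badpol !hornerM hornerX !horner_prod !mulf_eq0 !negb_or -!andbA.
rewrite binomE => /and4P[z0 h1 h2 h3]; split=> //.
- by move: h1; rewrite subr_eq0 mulrC.
- move=> l wl; move: h2 => /prodf_neq0/(_ l); rewrite wl eqxx => /(_ isT).
  by rewrite binomE subr_eq0 mulrC.
- move=> al r; move: h3; rewrite prodf_seq_neq0 => /allP/(_ al).
  by rewrite mem_rootseq ?wronsk_neq0 // => /(_ r) /=; rewrite binomE subr_eq0 mulrC.
Qed.

Lemma sc_neq0 l : sc z p l != 0.
Proof. by have [z0 _ _ _] := badpol_spec; rewrite /sc mulf_neq0 //; case: ifP => _; rewrite ?oner_eq0. Qed.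

Lemma good_sc i : good B rho i (sc z p) (sc z q).
Proof.
have [z0 h1 h2 _] := badpol_spec; split.
- by rewrite mpos_sc mneg_sc.
- move=> l k wl wk; have -> : br (sc z p) (sc z q) l k =
    (if l == j then z else 1) * (if k == j then z else 1) * br p q l k by rewrite /br /sc; ring.
  rewrite !mulf_neq0 //; try by case: ifP => _; rewrite ?oner_eq0.
  by apply: br0; apply: contraTneq wl => ->; rewrite -leNgt ltW.
- move=> l _ _ wl; split; first exact: sc_neq0.
  rewrite (mpos_ext (x' := sc z (br p q l))) ?(mneg_ext (x' := sc z (br p q l))) ?mpos_sc ?mneg_sc ?h2 //.
  + by move=> k _; apply: br_sc.
  + by move=> k _; apply: br_sc.
Qed.

Lemma posPol_sc : posPol B rho (sc z p) (sc z q) = z ^+ U *: posPol B rho p q.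
Proof.
apply: poly_ext => al; rewrite hornerZ !posPol_E -mpos_sc.
by apply: mpos_ext => l _; rewrite /lin /sc; ring.
Qed.

Lemma negPol_sc : negPol B rho (sc z p) (sc z q) = negPol B rho p q.
Proof.
apply: poly_ext => al; rewrite !negPol_E -[RHS](mneg_sc z).
by apply: mneg_ext => l _; rewrite /lin /sc; ring.
Qed.

Lemma sep_sc x : root (fpol B rho (sc z p) (sc z q)) x -> ~~ root (fpol B rho (sc z p) (sc z q))^`() x.
Proof.
rewrite /fpol posPol_sc negPol_sc !rootE derivB derivZ !hornerD !hornerN !hornerZ !subr_eq0 => /eqP E.
apply/negP => /eqP E'; have [_ _ _ H] := badpol_spec.
have r : root wronsk x; last by have := H x r; rewrite E eqxx.
rewrite rootE /wronsk hornerD hornerN !hornerM -E -E' mulrCA [X in _ - X]mulrCA.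
by rewrite [X in _ - _ * X]mulrC subrr.
Qed.

End Scaled.
Section RayRow.
Variables (i : 'I_n) (g : nat).
Hypothesis g0 : (0 < g)%N.
Hypothesis rowi : rowB B i = (g%:Z * rho.1, g%:Z * rho.2).
Hypothesis degW : forall m, m \in msupp C -> (rowdeg m i <= g * N)%N.

Definition toppol := psump (fun m => rowdeg m i == (g * N)%N) p q.
Definition leadpol := psump (fun m => m (mxvec_index i 1) == (g * N)%N) (upd i p 1) (upd i q 1).

Lemma wt_i0 : wt B c i = 0.
Proof. exact: wt_ci rowi. Qed.

Lemma leadpol_eval z : leadpol.[z] = leadsum B C rho i g (sc z p) (sc z q).
Proof.
rewrite psump_eval /leadsum /psum; apply: eq_bigr => m _; congr (_ * _).
apply: eq_bigr => l _; congr (_ ^+ _); apply: ptY_ext => k; rewrite /upd /sc;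
  by have [->|//] := eqVneq k i; rewrite wt0_neqj ?mul1r ?wt_i0.
Qed.

(** [fiber_identity] for the pair with row j scaled by z, valid for all but finitely many z and
    hence as an identity of polynomials in z. *)
Lemma top_lead_identity :
  toppol * lcbin ^+ g = leadpol * ((-1) ^+ N *: raybin i) ^+ g.
Proof.
have wi := wt_i0.
apply/eqP; rewrite -subr_eq0; set D := _ - _.
suff : D * badpol = 0 by move/eqP; rewrite mulf_eq0 (negPf badpol_neq0) orbF.
apply: poly_ext => z; rewrite horner0 hornerM; apply/eqP; rewrite mulf_eq0 orbC -implyNb.
apply/implyP => gz; rewrite /D hornerD hornerN subr_eq0 !hornerM !horner_exp hornerZ psump_eval leadpol_eval.
have := fiber_identity Czero sumB rho_m g0 rowi jpos degW (good_sc gz i) (sc_neq0 gz) (sep_sc gz).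
rewrite mpos_sc mneg_sc !binomE (mulrC (mpos B c p)) /topsum => ->; apply/eqP; congr (_ * (_ * _) ^+ _).
have E k : wt B c k != 0 -> br (sc z p) (sc z q) i k = sc z (br p q i) k by move=> _; apply: br_sc.
by rewrite (mpos_ext E) (mneg_ext E) mpos_sc mneg_sc mulrC.
Qed.

(** Otherwise [leadsum_eq0] makes C vanish at almost all scaled pairs, hence also at z = 1, which is
    (p, q) itself. *)
Lemma leadpol_neq0 : leadpol != 0.
Proof.
apply/eqP => L0; have : psump predT p q * badpol = 0.
  apply: poly_ext => z; rewrite horner0 hornerM; apply/eqP; rewrite mulf_eq0 orbC -implyNb.
  apply/implyP => gz; rewrite psump_eval psum_CL; apply/eqP.
  apply: (leadsum_eq0 Czero sumB rho_m g0 rowi jpos degW (good_sc gz i) (sc_neq0 gz) (sep_sc gz)).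
  by rewrite -leadpol_eval L0 horner0.
move=> /eqP; rewrite mulf_eq0 (negPf badpol_neq0) orbF => /eqP E.
case/eqP: CL0; rewrite -psum_CL; have := congr1 (fun P : {poly algC} => P.[1]) E.
rewrite horner0 psump_eval => <-; apply: eq_bigr => m _; congr (_ * _).
by apply: eq_bigr => l _; congr (_ ^+ _); apply: ptY_ext => k; rewrite /sc; case: ifP; rewrite mul1r.
Qed.

Lemma toppol_neq0 : toppol != 0.
Proof.
have : leadpol * ((-1) ^+ N *: raybin i) ^+ g != 0.
  rewrite mulf_neq0 ?leadpol_neq0 // expf_neq0 // scaler_eq0 negb_or raybin_neq0 ?wt_i0 // andbT.
  by rewrite expf_neq0 // oppr_eq0 oner_eq0.
by rewrite -top_lead_identity mulf_eq0 negb_or => /andP[].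
Qed.

Lemma raybin_dvd : raybin i ^+ g %| toppol.
Proof.
have co : coprimep (raybin i ^+ g) (lcbin ^+ g).
  by apply/coprimep_expl/coprimep_expr/binom_coprime/cross_lc/wt_i0.
by rewrite -(Gauss_dvdpl _ co) top_lead_identity exprZn -scalerAr dvdpZr ?dvdp_mull // !expf_neq0 // oppr_eq0 oner_eq0.
Qed.

End RayRow.
End Base.

Hypothesis Cdeg : forall m i g, m \in msupp C -> (0 < g)%N ->
  rowB B i = (g%:Z * rho.1, g%:Z * rho.2) -> (rowdeg m i <= g * N)%N.
Hypothesis coset : forall m m', m \in msupp C -> m' \in msupp C ->
  exists k : int * int, forall l, (rowdeg m l)%:Z - (rowdeg m' l)%:Z = wt B k l.
Variable gr : 'I_n -> nat.
Hypothesis grE : forall l, (0 < gr l)%N -> rowB B l = ((gr l)%:Z * rho.1, (gr l)%:Z * rho.2).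
Hypothesis Cn0 : C != 0.

Lemma generic_CL : generic (fun p q => CL C p q != 0).
Proof.
by exists (map_mpoly (fun z : int => z%:~R : algC) C); rewrite ?map_intr_eq0.
Qed.

(** [gr l] is the multiplicity of a row on the ray of rho. The top parts for all these rows
    coincide, their binomials in z are pairwise coprime, and so the product of the corresponding
    powers divides the common top part. The degree of this product, U times the sum of [gr], is by
    [poly_span] a lower bound for the spread of the exponents in row j. *)
Lemma long_edge i : (0 < gr i)%N -> exists e e', [/\ rowexp C e, rowexp C e',
  e i = (gr i * N)%N, e' i = (gr i * N)%N & (e j + U * \sum_l gr l <= e' j)%N].
Proof.
move=> gi.
have h1 := generic_p_all n.
have h2 : generic (fun p q => forall l l' : 'I_n, l != l' -> br p q l l' != 0).
  by do 2![apply: generic_forall => ?]; apply: generic_cond; apply: generic_br.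
have h3 : generic (fun p q => forall l : 'I_n, wt B c l = 0 ->
    mpos B c (br p q l) * mneg B c p != mneg B c (br p q l) * mpos B c p).
  by apply: generic_forall => l; apply: generic_cond => wl; apply: (generic_ray_lc jpos).
have h4 : generic (fun p q => forall l l' : 'I_n, l != l' -> wt B c l = 0 -> wt B c l' = 0 ->
    mpos B c (br p q l) * mneg B c (br p q l') != mneg B c (br p q l) * mpos B c (br p q l')).
  do 2![apply: generic_forall => ?]; do 3![apply: generic_cond => ?].
  exact: (generic_ray_ray jpos).
have [p [q [p0 [br0 [cr_lc [cr CL0]]]]]] := generic_ex (generic_and h1 (generic_and h2
  (generic_and h3 (generic_and h4 generic_CL)))).
have wl0 l : (0 < gr l)%N -> wt B c l = 0 by move=> /grE/wt_ci.
have dW l (gl : (0 < gr l)%N) := fun m mC => @Cdeg m l _ mC gl (grE gl).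
pose T l := toppol p q l (gr l).
have Tn0 l (gl : (0 < gr l)%N) : T l != 0 := toppol_neq0 p0 br0 CL0 gl (grE gl) (dW l gl).
have topm l : (0 < gr l)%N -> exists2 m, m \in msupp C & rowdeg m l = (gr l * N)%N.
  move=> gl; apply: NNPP => N'; case/eqP: (Tn0 l gl).
  rewrite /T /toppol /psump big1_seq // => m /andP[/eqP ml mC].
  by case: N'; exists m.
have wray k l : (0 < gr l)%N -> wt B k l = (gr l)%:Z * dot rho k.
  by move=> /grE e; rewrite /wt e /dot /=; ring.
(* Exponents of top degree in row l and in row i differ by some [wt B k]; maximality forces dot rho
   k >= 0 and <= 0, so both are of top degree in both rows. *)
have Tsame l : (0 < gr l)%N -> T l = T i.
  move=> gl; have [m1 m1C m1l] := topm l gl; have [m2 m2C m2i] := topm i gi.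
  have [k Hk] := coset m1C m2C.
  have d0 : dot rho k = 0.
    have := Hk l; have := Hk i; rewrite !wray // m1l m2i => E1 E2.
    have := dW i gi m1 m1C; have := dW l gl m2 m2C.
    by move: (dot rho k) E1 E2 => d; nia.
  have m1i : rowdeg m1 i = (gr i * N)%N.
    by have := Hk i; rewrite wray // d0 mulr0 m2i; lia.
  rewrite /T /toppol /psump big_seq_cond [RHS]big_seq_cond; apply: eq_bigl => m.
  have [mC|] := boolP (m \in msupp C); rewrite //=.
  have [k' Hk'] := coset mC m1C; have := Hk' l; have := Hk' i; rewrite !wray // m1l m1i.
  by move: (dot rho k') => d; move: (rowdeg m l) (rowdeg m i) => x y E1 E2; apply/eqP/eqP => E; nia.
have div l : (0 < gr l)%N -> raybin p q l ^+ gr l %| T i.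
  by move=> gl; rewrite -(Tsame l gl); apply: (raybin_dvd p0 br0 cr_lc gl (grE gl) (dW l gl)).
pose s := [seq l <- enum 'I_n | (0 < gr l)%N].
pose K := \prod_(l <- s) raybin p q l ^+ gr l.
have KT : K %| T i.
  apply: prod_dvdp => [|l|l l']; first by rewrite filter_uniq ?enum_uniq.
    by rewrite mem_filter => /andP[/div].
  rewrite !mem_filter => /andP[gl _] /andP[gl' _] ll'.
  by apply/coprimep_expl/coprimep_expr/binom_coprime/cr => //; apply: wl0.
have An0 l : wt B c l = 0 -> mpos B c (br p q l) != 0 /\ mneg B c (br p q l) != 0.
  by move=> wl; split; [apply: mpos_n0 | apply: mneg_n0]; apply: br_row_neq0.
have K0 : K`_0 != 0.
  rewrite -horner_coef0 horner_prod prodf_seq_neq0; apply/allP => l; rewrite mem_filter => /andP[gl _] /=.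
  rewrite horner_exp expf_neq0 // binomE expr0n gtn_eqF ?U_gt0 // mulr0 sub0r oppr_eq0.
  by have [] := An0 l (wl0 l gl).
have sK : size K = (U * \sum_l gr l).+1.
  rewrite (size_prod_pow _ (U := U)) => [|l]; last first.
    by rewrite mem_filter => /andP[gl _]; rewrite size_binom ?U_gt0 //; have [] := An0 l (wl0 l gl).
  rewrite big_filter big_enum_cond /= [in RHS](bigID (fun l => 0 < gr l)%N) /=.
  by rewrite [X in (_ + X)%N]big1 ?addn0 // => l; rewrite lt0n negbK => /eqP.
move: KT; rewrite dvdp_eq => /eqP TE.
have [a [b [Ta Tb ab]]] := poly_span TE (Tn0 i gi) K0.
have coefT k : (T i)`_k != 0 -> exists e, [/\ rowexp C e, e i = (gr i * N)%N & e j = k].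
  move=> Tk; suff [m mC [mi mj]] : exists2 m, m \in msupp C & rowdeg m i = (gr i * N)%N /\ rowdeg m j = k.
    by exists (rowdeg m); split=> //; apply: supp_rowexp.
  apply: NNPP => N'; case/eqP: Tk; rewrite /T /toppol /psump coef_sum big1_seq // => m /andP[/eqP mi mC].
  rewrite coefZ coefXn (_ : (k == _) = false) ?mulr0 //.
  by apply/eqP => kj; apply: N'; exists m.
have [e [eC ei ej]] := coefT a Ta; have [e' [eC' ei' ej']] := coefT b Tb.
by exists e, e'; split=> //; rewrite ej ej' -[(U * _)%N]/(_.+1.-1) -sK.
Qed.

End Edge.

(** * Degree in Plücker coordinates *)

Section Homogeneity.
Variables (n : nat) (B : 'M[int]_(n, 2)) (C : {mpoly int[n * 2]}).
Hypothesis n3 : (2 < n)%N.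
Hypothesis Cirr : mirreducible C.
Hypothesis Czero : forall p q i j, br p q i j != 0 ->
  CL C p q = 0 <-> exists s t, (s, t) != (0, 0) /\ inX B (fun l => s * p l + t * q l).
Hypothesis Cbr : forall p q p' q', (forall i j, br p q i j = br p' q' i j) -> CL C p q = CL C p' q'.
Hypothesis sumB : forall c, \sum_l wt B c l = 0.
Implicit Types (p q r : 'I_n -> algC).

Lemma C_neq0 : C != 0.
Proof. by case: Cirr. Qed.

Lemma CL_nonzero : exists p q, CL C p q != 0.
Proof.
have : map_mpoly (fun z : int => z%:~R : algC) C != 0 by rewrite map_intr_eq0 C_neq0.
move=> /mpoly_nonroot[y]; rewrite -/(evC C y) (evC_ext _ (ptY_surj y)) => H.
by exists (fun i => y (mxvec_index i 0)), (fun i => y (mxvec_index i 1)).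
Qed.

Lemma total_degree : exists t, forall e, rowexp C e -> (\sum_l e l = t)%N.
Proof.
case E : (msupp C) => [|m s]; first by move: C_neq0; rewrite -msupp_eq0 E.
exists (\sum_l rowdeg m l)%N => e eC.
have := @rowexp_graded _ _ _ n3 Cirr Czero (fun=> 1%N) _ e (rowdeg m) eC.
rewrite (eq_bigr _ (fun l _ => mul1n _)) [in RHS](eq_bigr _ (fun l _ => mul1n _)); apply.
  by move=> c; rewrite -[RHS](sumB c); apply: eq_bigr => l _; rewrite mul1r.
by apply: supp_rowexp; rewrite E mem_head.
Qed.

Lemma CL_scale t0 a p q : (forall e, rowexp C e -> (\sum_l e l = t0)%N) ->
  CL C (fun l => a * p l) (fun l => a * q l) = a ^+ t0 * CL C p q.
Proof.
move=> H; rewrite -(CF_eval C p q (fun=> a)) /CF raddf_sum /CL evCE mulr_sumr.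
rewrite big_seq [RHS]big_seq; apply: eq_bigr => m mC /=; rewrite mevalZ mevalX mulrC; congr (_ * _).
by rewrite -(H _ (supp_rowexp mC)) expr_sum.
Qed.

(** Multiplying q by a^2 changes the brackets exactly as multiplying both columns by a, so it
    multiplies C by a^t. The case a = -1 shows that t is even, and square roots in algC reach all
    scalars. *)
Lemma plucker_degree : exists2 D : nat, (0 < D)%N & (forall e, rowexp C e -> (\sum_l e l = D + D)%N) /\
  forall a p q, CL C p (fun l => a * q l) = a ^+ D * CL C p q.
Proof.
have [t tE] := total_degree; have [p [q pq]] := CL_nonzero.
have sq a p' q' : CL C p' (fun l => a ^+ 2 * q' l) = a ^+ t * CL C p' q'.
  by rewrite -(CL_scale _ _ _ tE); apply: Cbr => i j; rewrite /br; ring.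
have ev : ~~ odd t.
  apply/negP => ot; have := sq (-1) p q; rewrite (CL_ext C (p' := p) (q' := q)) // => [|l]; last by rewrite sqrrN expr1n mul1r.
  rewrite -signr_odd ot expr1 mulN1r => /eqP; rewrite -subr_eq0 opprK -mulr2n mulrn_eq0 /=.
  by rewrite (negPf pq).
have tD : t = (t./2 + t./2)%N by rewrite addnn -[LHS](odd_double_half t) (negPf ev).
exists t./2; last split.
- rewrite lt0n; apply/eqP => t20; have [y y0] := CL_zero_exists n3 Czero.
  have t0 : t = 0%N by rewrite tD t20.
  have cst p' q' : CL C p' q' = CL C (fun=> 0) (fun=> 0).
    rewrite -[LHS]mul1r -[1](expr0 0) -t0 -(CL_scale _ _ _ tE).
    by apply: CL_ext => l; rewrite mul0r.
  by case/eqP: pq; rewrite cst -(cst (fun i => y (mxvec_index i 0)) (fun i => y (mxvec_index i 1))) /CL -(evC_ext C (ptY_surj y)).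
- by move=> e /tE; rewrite -tD.
move=> a p' q'; have := sq (sqrtC a) p' q'; rewrite sqrtCK => ->.
by rewrite {1}tD addnn -mul2n exprM sqrtCK.
Qed.

Section Pencil.
Variable D : nat.
Hypothesis D0 : (0 < D)%N.
Hypothesis CLD : forall a p q, CL C p (fun l => a * q l) = a ^+ D * CL C p q.

(** Geometrically, C on the pencil of lines through p in the plane of p, q, r. *)
Definition pencil p q r : {poly algC} :=
  line_restr (map_mpoly (fun z : int => z%:~R) C) (ptY p q) (ptY (fun=> 0) r).

Lemma pencilE p q r s : (pencil p q r).[s] = CL C p (fun l => q l + s * r l).
Proof.
rewrite /pencil line_restrE -/(evC C _); apply: evC_ext => l; case/mxvec_indexP: l => l j.
by rewrite !ptY_index; case: ifP; rewrite ?mulr0 ?addr0.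
Qed.

(** Exchanging q and r turns s into 1/s: P(s) = s^D Q(1/s). Clearing denominators allows the
    coefficients to be compared, and the coefficient of s^D in P is Q(0). *)
Lemma pencil_size p q r : (size (pencil p q r) <= D.+1)%N /\ (pencil p q r)`_D = CL C p r.
Proof.
pose P := pencil p q r; pose Q := pencil p r q.
have e s : s != 0 -> P.[s] = s ^+ D * Q.[s^-1].
  move=> s0; rewrite !pencilE -CLD; apply: CL_ext => // l.
  by rewrite mulrDr mulrA divff // mul1r addrC.
pose M := size Q; pose Rv : {poly algC} := \sum_(k < M) Q`_k *: 'X^(D + (M - k)).
have E : P * 'X^M = Rv.
  apply/eqP; rewrite -subr_eq0; set X := _ - _.
  suff : X * 'X = 0 by move/eqP; rewrite mulf_eq0 polyX_eq0 orbF.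
  apply: poly_ext => s; rewrite hornerM hornerX horner0.
  have [->|s0] := eqVneq s 0; first by rewrite mulr0.
  apply/eqP; rewrite mulf_eq0 (negPf s0) orbF /X hornerD hornerN subr_eq0 hornerM hornerXn e //.
  have -> : Q.[s^-1] = \sum_(k < M) Q`_k * s^-1 ^+ k by rewrite horner_coef.
  rewrite /Rv horner_sum mulrAC mulr_sumr; apply/eqP/eq_bigr => k _.
  rewrite hornerZ hornerXn mulrCA; congr (_ * _).
  rewrite exprD (expfB _ (ltn_ord k)) exprVn.
  by move: (s ^+ D) (s ^+ M) ((s ^+ k)^-1) => x y z; rewrite mulrA.
have cf k : P`_k = Rv`_(k + M) by rewrite -E coefMXn ltnNge leq_addl addnK.
have cR k : Rv`_k = \sum_(j < M) Q`_j * (k == D + (M - j))%N%:R.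
  by rewrite coef_sum; apply: eq_bigr => j _; rewrite coefZ coefXn.
split.
  apply/leq_sizeP => k Dk; rewrite cf cR big1 // => j _.
  by rewrite (_ : (_ == _) = false) ?mulr0 //; have := ltn_ord j; lia.
have -> : CL C p r = Q`_0.
  rewrite -horner_coef0 pencilE; apply: CL_ext => // l; by rewrite mul0r addr0.
rewrite cf cR; case M0 : M => [|M'].
  by rewrite big_ord0 nth_default // -/M M0.
rewrite big_ord_recl big1 => [|j _].
  by rewrite addr0 subn0 eqxx mulr1.
by rewrite (_ : (_ == _) = false) ?mulr0 // lift0; have := ltn_ord j; lia.
Qed.

End Pencil.

End Homogeneity.

(** * The degree of the toric variety *)

Section Family.
Variables (N : nat) (C : {mpoly int[N]}) (Y E : 'I_N -> {poly algC}).

(** The inner variable is the parameter u of the family, the outer one the parameter along each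
    line. *)
Definition line_family : {poly {poly algC}} :=
  \sum_(m <- msupp C) (C@_m)%:~R%:P * \prod_l ((Y l)%:P + (E l)%:P * 'X) ^+ m l.

Lemma line_familyE u : map_poly (horner_eval u) line_family =
  line_restr (map_mpoly (fun z : int => z%:~R) C) (fun l => (Y l).[u]) (fun l => (E l).[u]).
Proof.
apply: poly_ext => s; rewrite line_restrE -/(evC C _) evCE rmorph_sum /= horner_sum.
apply: eq_bigr => m _; rewrite rmorphM hornerM /= map_polyC hornerC /= horner_evalE.
congr (_ * _); first by rewrite -[RHS](rmorph_int (horner_eval u)).
rewrite rmorph_prod horner_prod; apply: eq_bigr => l _.
rewrite rmorphXn horner_exp rmorphD rmorphM /= !map_polyC map_polyX !hornerE /= /horner_eval.
by rewrite [_ * s]mulrC.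
Qed.

End Family.

Section ToricDegree.
Variables (n : nat) (B : 'M[int]_(n, 2)) (C : {mpoly int[n * 2]}).
Hypothesis n3 : (2 < n)%N.
Hypothesis Cirr : mirreducible C.
Hypothesis Czero : forall p q i j, br p q i j != 0 ->
  CL C p q = 0 <-> exists s t, (s, t) != (0, 0) /\ inX B (fun l => s * p l + t * q l).
Hypothesis Cbr : forall p q p' q', (forall i j, br p q i j = br p' q' i j) -> CL C p q = CL C p' q'.
Hypothesis sumB : forall c, \sum_l wt B c l = 0.
Variable D : nat.
Hypothesis D0 : (0 < D)%N.
Hypothesis CLD : forall a p q, CL C p (fun l => a * q l) = a ^+ D * CL C p q.
Implicit Types (p q r : 'I_n -> algC).

Lemma CL_br0 p q : (forall i j, br p q i j = 0) -> CL C p q = 0.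
Proof.
move=> b0; rewrite (Cbr (p' := p) (q' := fun l => 0 * p l)) => [|i j].
  by rewrite CLD expr0n gtn_eqF // mul0r.
by rewrite b0 /br; ring.
Qed.

Lemma CL_meet p q s t : (s, t) != (0, 0) -> inX B (fun l => s * p l + t * q l) -> CL C p q = 0.
Proof.
move=> st xX; case: (classic (exists i j, br p q i j != 0)) => [[i [j b0]]|N].
  by apply/(Czero b0); exists s, t.
by apply: CL_br0 => i j; apply/eqP/negPn/negP => b0; apply: N; exists i, j.
Qed.

Lemma CL_br_neq0 p q : CL C p q != 0 -> exists i j, br p q i j != 0.
Proof.
move=> c0; apply: NNPP => N; case/eqP: c0; apply: CL_br0 => i j.
by apply/eqP/negPn/negP => b0; apply: N; exists i, j.
Qed.

Lemma CL_shear p r la : CL C (fun l => p l + la * r l) r = CL C p r.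
Proof. by apply: Cbr => i j; rewrite /br; ring. Qed.

(** A pencil is a restriction of C in the direction (0, r), so [line_separable] applies once r is
    integral with an entry 1. As C is homogeneous in q, the entry k of q may be set to 1 without
    killing C (this is [T]), and a natural nonzero of the result provides r. *)
Lemma separable_pencil : exists p q r,
  CL C p r != 0 /\ coprimep (pencil C p q r) (pencil C p q r)^`().
Proof.
have [p [q pq]] := CL_nonzero Cirr.
have [k qk] : exists k, q k != 0.
  apply: NNPP => N; case/eqP: pq; rewrite (CL_ext C (p' := p) (q' := fun l => 0 * q l)) => // [|l].
    by rewrite CLD expr0n gtn_eqF // mul0r.
  by rewrite mul0r; apply/eqP/negPn/negP => ql; apply: N; exists l.
pose T : (n * 2).-tuple {mpoly int[n * 2]} :=
  [tuple if l == mxvec_index k 1 then 1 else 'X_l | l < n * 2].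
have TE y : evC (comp_mpoly T C) y = evC C (fun l => if l == mxvec_index k 1 then 1 else y l).
  rewrite evC_comp; apply: evC_ext => l; rewrite tnth_mktuple; case: ifP => _; last exact: evC_var.
  by rewrite -mpolyC1 evC_const.
have : map_mpoly (fun z : int => z%:~R : algC) (comp_mpoly T C) != 0.
  apply: contra_neq pq => T0.
  have H : CL C p (fun l => (q k)^-1 * q l) = 0.
    rewrite /CL -[RHS](meval0 (ptY p (fun l => (q k)^-1 * q l))) -T0 -/(evC _ _) TE.
    apply: evC_ext => l; case: eqP => // ->; by rewrite ptY_index /= mulVf.
  by move/eqP: H; rewrite CLD mulf_eq0 expf_eq0 invr_eq0 (negPf qk) andbF => /eqP.
case/mpoly_nonroot_nat=> y; rewrite -/(evC _ _) TE => y0.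
pose y' l := if l == mxvec_index k 1 then 1%N else y l.
pose r (l : 'I_n) := y' (mxvec_index l 1).
pose Dr (l : 'I_(n * 2)) : int := if l == mxvec_index (vrow l) 1 then (r (vrow l))%:Z else 0.
have DrE l : (Dr l)%:~R = ptY (fun=> 0) (fun l => (r l)%:R) l :> algC.
  case/mxvec_indexP: l => l j; rewrite ptY_index /Dr vrow_index.
  have [->|->] := ord2_cases j; last by rewrite eqxx.
  case: eqP => // e; move: (congr1 (fun z => ptY (fun=> 0) (fun=> 1) z : algC) e).
  by rewrite !ptY_index /= => /esym/eqP; rewrite oner_eq0.
have CLr : CL C (fun l => (y' (mxvec_index l 0))%:R) (fun l => (r l)%:R) != 0.
  apply: contra_neq y0 => <-; rewrite /CL.
  apply: evC_ext => l; case/mxvec_indexP: l => l j; rewrite ptY_index /r /y'.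
  by have [->|->] := ord2_cases j => /=; case: ifP.
pose p0 (l : 'I_n) : algC := (y' (mxvec_index l 0))%:R; pose r0 (l : 'I_n) : algC := (r l)%:R.
have lrE z : line_restr (map_mpoly (fun z : int => z%:~R) C) z (fun l => (Dr l)%:~R) =
    pencil C (fun i => z (mxvec_index i 0)) (fun i => z (mxvec_index i 1)) r0.
  apply: poly_ext => s; rewrite pencilE line_restrE -/(evC _ _); apply: evC_ext => l.
  rewrite DrE; case/mxvec_indexP: l => l j; rewrite !ptY_index.
  by have [->|->] := ord2_cases j => //=; rewrite mulr0 addr0.
have sz z : CL C (fun i => z (mxvec_index i 0)) r0 != 0 ->
    size (line_restr (map_mpoly (fun z : int => z%:~R) C) z (fun l => (Dr l)%:~R)) = D.+1.
  move=> c0; rewrite lrE; have [s1 s2] := pencil_size n3 D0 CLD (fun i => z (mxvec_index i 0)) (fun i => z (mxvec_index i 1)) r0.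
  apply/eqP; rewrite eqn_leq s1 ltnNge; apply/negP => /leq_sizeP/(_ _ (leqnn D)).
  by rewrite s2; apply/eqP.
have Dk : Dr (mxvec_index k 1) = 1 by rewrite /Dr vrow_index eqxx /r /y' eqxx.
have [|h [h0 H]] := line_separable Cirr Dk.
  exists (ptY p0 (fun=> 0)); rewrite sz ?ltnS //; apply: contra_neq CLr => <-.
  by apply: CL_ext => // l; rewrite ptY_index.
have [z /H[smax]] := mpoly_nonroot h0; rewrite lrE => cop.
exists (fun i => z (mxvec_index i 0)), (fun i => z (mxvec_index i 1)), r0; split=> //.
have [s1 s2] := pencil_size n3 D0 CLD (fun i => z (mxvec_index i 0)) (fun i => z (mxvec_index i 1)) r0.
rewrite -s2; have := smax (ptY p0 (fun=> 0)); rewrite sz => [|]; last first.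
  by apply: contra_neq CLr => <-; apply: CL_ext => // l; rewrite ptY_index.
rewrite lrE => s3; have sD : size (pencil C (fun i => z (mxvec_index i 0)) (fun i => z (mxvec_index i 1)) r0) = D.+1.
  by apply/eqP; rewrite eqn_leq s1.
by rewrite -[D]/(D.+1.-1) -sD -[_`_ _]/(lead_coef _) lead_coef_eq0 -size_poly_eq0 sD.
Qed.

Section PointCount.
Variables (k d : nat) (A : 'M[int]_(k, n)).
Hypothesis coneE : forall x : 'cV[algC]_n, in_cone_XB A x <-> inX B (fun l => x l 0).

Definition vec3 (x y z : algC) : 'cV[algC]_3 := \col_i (if i == 0 then x else if i == 1 then y else z).

Lemma vec3_mul (M : 'M[algC]_(n, 3)) x y z l :
  (M *m vec3 x y z) l 0 = x * M l 0 + y * M l 1 + z * M l ord_max.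
Proof.
rewrite mxE !big_ord_recl big_ord0 !mxE /= addr0.
have -> : lift 0 0 = 1 :> 'I_3 by apply/val_inj.
have -> : lift 0 (lift 0 0) = ord_max :> 'I_3 by apply/val_inj.
by rewrite mulrC [_ * y]mulrC [_ * z]mulrC addrA.
Qed.

Lemma vec3_eta (t : 'cV_3) : t = vec3 (t 0 0) (t 1 0) (t ord_max 0).
Proof.
apply/colP => i; rewrite !mxE.
by case: i => [[|[|[|//]]] hi] /=; congr (t _ 0); apply/val_inj.
Qed.

Variable M : 'M[algC]_(n, 3).
Let p (l : 'I_n) : algC := M l 0.
Let q (l : 'I_n) : algC := M l 1.
Let r (l : 'I_n) : algC := M l ord_max.
Hypothesis rM : \rank M = 3%N.
Hypothesis prN0 : CL C p r != 0.

Lemma frame_inj (t : 'cV_3) : M *m t = 0 -> t = 0.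
Proof.
move=> Mt; have /row_fullP[L LM] : row_full M by rewrite /row_full rM.
by rewrite -[t]mul1mx -LM -mulmxA Mt mulmx0.
Qed.

Lemma pencil_root x y z s la : inX B (fun l => x * p l + y * q l + z * r l) -> y != 0 ->
  s = (z - la * x) / y -> root (pencil C (fun l => p l + la * r l) q r) s.
Proof.
move=> xX y0 se; rewrite rootE pencilE; apply/eqP.
apply: (@CL_meet _ _ x y); first by rewrite xpair_eqE (negPf y0) andbF.
by apply: inX_ext xX => l; rewrite se; field.
Qed.

Lemma point_middle x y z : (x, y, z) != (0, 0, 0) -> inX B (fun l => x * p l + y * q l + z * r l) -> y != 0.
Proof.
move=> xyz xX; apply: contraNneq prN0 => y0; apply/eqP/(@CL_meet _ _ x z).
  by apply: contraNneq xyz => -[-> ->]; rewrite y0.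
by apply: inX_ext xX => l; rewrite y0 mul0r addr0.
Qed.

(** After p is sheared by a generic multiple la of r, different points of X_B in the plane lie on
    different lines of the pencil, and these lines are roots of a polynomial of degree at most D. *)
Lemma count_upper : meets_in_exactly A M d -> (d <= D)%N.
Proof.
case=> pts [pX [pinj _]].
have /(fin_all_exists (U := fun=> _))[t tE] a : exists t, tnth pts a = M *m t by case: (pX a) => _ [_].
have xX a : inX B (fun l => t a 0 0 * p l + t a 1 0 * q l + t a ord_max 0 * r l).
  have [_ [/coneE xX _]] := pX a; apply: inX_ext xX => l.
  by rewrite tE [t a]vec3_eta vec3_mul !mxE.
have y0 a : t a 1 0 != 0.
  apply: point_middle (xX a); have [/eqP pa0 _] := pX a; apply: contra_notN pa0 => /eqP[e0 e1 e2].
  have ta0 : t a = 0.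
    by rewrite [t a]vec3_eta e0 e1 e2; apply/colP=> i; rewrite !mxE; case: ifP => // _; case: ifP.
  by rewrite tE ta0 mulmx0.
pose X a := t a 0 0 / t a 1 0; pose Z a := t a ord_max 0 / t a 1 0.
have XZ a b : X a = X b -> Z a = Z b -> a = b.
  move=> eX eZ; apply: pinj; exists (t a 1 0 / t b 1 0).
  rewrite !tE scalemxAr; congr (_ *m _); apply/colP => i; rewrite mxE.
  rewrite [t a]vec3_eta [t b]vec3_eta !mxE.
  case: ifP => _; last case: ifP => _.
  - by rewrite -mulrA [_^-1 * _]mulrC -/(X b) -eX mulrC divfK.
  - by rewrite divfK.
  - by rewrite -mulrA [_^-1 * _]mulrC -/(Z b) -eZ mulrC divfK.
pose W : {poly algC} := \prod_a \prod_(b | b != a) ((Z a - Z b)%:P - (X a - X b) *: 'X).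
have /poly_nonroot[la] : W != 0.
  apply/prodf_neq0 => a _; apply/prodf_neq0 => b ba; apply: contra_neq ba => W0.
  apply/esym/XZ; apply/eqP; rewrite -subr_eq0; apply/eqP.
    by move: (congr1 (fun P : {poly algC} => - P`_1) W0); rewrite coef0 oppr0 coefB coefC coefZ coefX /= sub0r opprK mulr1.
  by move: (congr1 (fun P : {poly algC} => P`_0) W0); rewrite coef0 coefB coefC coefZ coefX /= mulr0 subr0.
rewrite horner_prod => /prodf_neq0 la0.
pose s a := Z a - la * X a.
have s_inj : injective s.
  move=> a b sab; apply/eqP/negPn/negP => ab; move: (la0 a isT); rewrite horner_prod => /prodf_neq0/(_ b).
  rewrite eq_sym ab => /(_ isT)/eqP; case; rewrite !hornerE.
  by move: sab; rewrite /s => /eqP; rewrite -subr_eq0 => /eqP <-; ring.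
have [s1 s2] := pencil_size n3 D0 CLD (fun l => p l + la * r l) q r.
have P0 : pencil C (fun l => p l + la * r l) q r != 0.
  by apply: contraNneq prN0 => P0; rewrite -(CL_shear p r la) -s2 P0 coef0.
have := max_poly_roots P0 (rs := [seq s a | a : 'I_d]).
rewrite map_inj_uniq ?enum_uniq // size_map size_enum_ord => H.
rewrite -ltnS; apply: leq_trans (H _ isT) s1.
apply/allP => _ /mapP[a _ ->]; apply: (pencil_root (xX a) (y0 a)).
by rewrite /s /X /Z; have := y0 a => ?; field.
Qed.

(** Each of the D distinct roots is a line of the pencil that meets X_B, and not at p, since the
    line through p and r misses X_B; away from p the intersection point determines the line. *)
Lemma count_lower : coprimep (pencil C p q r) (pencil C p q r)^`() ->
  meets_in_exactly A M d -> (D <= d)%N.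
Proof.
move=> cop [pts [_ [_ pall]]]; set P := pencil C p q r in cop.
have [s1 s2] := pencil_size n3 D0 CLD p q r.
have P0 : P != 0 by apply: contraNneq prN0 => P0; rewrite -s2 -/P P0 coef0.
have sP : size P = D.+1.
  apply/eqP; rewrite eqn_leq s1 ltnNge; apply/negP => /leq_sizeP/(_ _ (leqnn D)).
  by rewrite s2; apply/eqP.
have sr : size (rootseq P) = D by apply/succn_inj; rewrite -size_rootseq.
have ur : uniq (rootseq P).
  have eS : \prod_(z <- rootseq P) ('X - z%:P) %= P.
    apply/eqpP; exists (lead_coef P, 1); rewrite /= ?lead_coef_eq0 ?P0 ?oner_eq0 //.
    by rewrite scale1r -rootseqE.
  by rewrite -separable_prod_XsubC (eqp_separable eS) unlock.
have key (a : 'I_D) : exists b : 'I_d, exists al c : algC,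
    M *m vec3 al 1 (rootseq P)`_a = c *: tnth pts b.
  set s := _`_a; have : root P s by rewrite -mem_rootseq // mem_nth ?sr.
  rewrite rootE pencilE => /eqP CL0.
  have [i [j b0]] : exists i j, br p (fun l => q l + s * r l) i j != 0.
    apply: NNPP => N; have [i [j pr]] := CL_br_neq0 prN0.
    have [m pm] : exists m, p m != 0.
      case: (eqVneq (p i) 0) => [pi|]; last by exists i.
      by exists j; apply: contraNneq pr => pj; rewrite /br pi pj mulr0 mul0r subrr.
    have /frame_inj/colP/(_ 1) : M *m vec3 (- (q m + s * r m)) (p m) (s * p m) = 0.
      apply/colP => l; rewrite vec3_mul mxE -/(p l) -/(q l) -/(r l).
      have : br p (fun l => q l + s * r l) m l = 0.
        by apply/eqP/negPn/negP => b0; apply: N; exists m, l.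
      by rewrite /br => <-; ring.
    by rewrite !mxE /=; apply/eqP.
  have [x [t [xt xX]]] := (Czero b0).1 CL0.
  have t0 : t != 0.
    apply: contraNneq prN0 => t0; apply/eqP; apply: (@CL_meet _ _ x 0).
      by rewrite t0 in xt.
    by apply: inX_ext xX => l; rewrite t0 !mul0r.
  pose v := M *m vec3 (x / t) 1 s.
  have vN0 : v != 0.
    apply/eqP => /frame_inj/colP/(_ 1); rewrite !mxE /=; apply/eqP; exact: oner_neq0.
  have vX : in_cone_XB A v.
    apply/coneE; apply: inX_ext (inX_scale sumB t^-1 xX) => l.
    by rewrite /v vec3_mul -/(p l) -/(q l) -/(r l); field.
  have [b [c E]] := pall v vN0 vX (ex_intro _ _ erefl).
  by exists b, (x / t), c; rewrite -E.
have [f /(fin_all_exists (U := fun=> _))[al /(fin_all_exists (U := fun=> _))[c E]]] := fin_all_exists key.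
suff /leq_card : injective f by rewrite !card_ord.
move=> a b fab; have ca : c b != 0.
  apply/eqP => cb; have /frame_inj/colP/(_ 1) : M *m vec3 (al b) 1 (rootseq P)`_b = 0.
    by rewrite E cb scale0r.
  by rewrite !mxE /=; apply/eqP; exact: oner_neq0.
have /frame_inj/colP e : M *m (vec3 (al a) 1 (rootseq P)`_a - (c a / c b) *: vec3 (al b) 1 (rootseq P)`_b) = 0.
  by rewrite mulmxBr -scalemxAr !E scalerA divfK // fab subrr.
have e1 : c a / c b = 1 by apply/esym/eqP; rewrite -subr_eq0; have := e 1; rewrite !mxE /= mulr1 => /eqP.
have : (rootseq P)`_a = (rootseq P)`_b.
  by apply/eqP; rewrite -subr_eq0; have := e ord_max; rewrite !mxE /= e1 mul1r => /eqP.
by move/eqP; rewrite nth_uniq ?sr // => /eqP/val_inj.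
Qed.

End PointCount.

Lemma size_deriv_lead (F : idomainType) (P : {poly F}) m : m.+1%:R != 0 :> F -> size P = m.+2 ->
  size P^`() = m.+1 /\ lead_coef P^`() = lead_coef P *+ m.+1.
Proof.
move=> m0 sP; have P0 : P != 0 by rewrite -size_poly_eq0 sP.
have s1 : size P^`() = m.+1.
  apply/eqP; rewrite eqn_leq -ltnS -[X in (_ < X)%N]sP lt_size_deriv //= ltnNge; apply/negP.
  move=> /leq_sizeP/(_ m (leqnn m)); rewrite coef_deriv => /eqP; rewrite -mulr_natr mulf_eq0 (negPf m0) orbF.
  by rewrite -[m.+1]/(m.+2.-1) -sP -/(lead_coef P) lead_coef_eq0 (negPf P0).
by split=> //; rewrite /lead_coef s1 sP coef_deriv.
Qed.

(** The given condition h is nonzero at y1, while separability is known only at the frame y0. On the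
    line joining them both become the nonvanishing of polynomials in one parameter u, separability
    through the resultant W of the pencil and its derivative, so some u satisfies both. *)
Theorem degree_XB k d (A : 'M[int]_(k, n)) :
  (forall x : 'cV[algC]_n, in_cone_XB A x <-> inX B (fun l => x l 0)) ->
  is_degree_XB A d -> d = D.
Proof.
move=> coneE [h [h0 H]].
have [y1 hy1] := mpoly_nonroot h0.
have [p0 [q0 [r0 [pr0 cop0]]]] := separable_pencil.
pose y0 l := mxvec (\matrix_(i < n, j < 3) if j == 0 then p0 i else if j == 1 then q0 i else r0 i) 0 l.
pose Z l : {poly algC} := (y0 l)%:P + (y1 l - y0 l) *: 'X.
have ZE u l : (Z l).[u] = y0 l + u * (y1 l - y0 l) by rewrite !hornerE mulrC.
pose pu u i := (Z (mxvec_index i 0)).[u]; pose qu u i := (Z (mxvec_index i 1)).[u].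
pose ru u i := (Z (mxvec_index i ord_max)).[u].
pose first (l : 'I_(n * 2)) := l == mxvec_index (vrow l) (0 : 'I_2).
have firstE (i : 'I_n) (j : 'I_2) : first (mxvec_index i j) = (j == 0).
  rewrite /first vrow_index; apply/eqP/eqP => [e|->] //.
  apply/eqP/negPn/negP => j0; move: (congr1 (ptY (fun=> 0) (fun=> 1)) e).
  by rewrite !ptY_index (negPf j0) /= => /eqP; rewrite oner_eq0.
pose P2 := line_family C
  (fun l => if first l then Z (mxvec_index (vrow l) 0) else Z (mxvec_index (vrow l) 1))
  (fun l => if first l then 0 else Z (mxvec_index (vrow l) ord_max)).
have P2E u : map_poly (horner_eval u) P2 = pencil C (pu u) (qu u) (ru u).
  rewrite line_familyE; apply: poly_ext => s; rewrite pencilE line_restrE -/(evC _ _).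
  apply: evC_ext => l; case/mxvec_indexP: l => i j; rewrite firstE vrow_index ptY_index.
  by case: ifP => _; rewrite ?horner0 ?mulr0 ?addr0.
have cE u m : (P2`_m).[u] = (pencil C (pu u) (qu u) (ru u))`_m.
  by rewrite -P2E coef_map.
have LE u : (P2`_D).[u] = CL C (pu u) (ru u).
  by rewrite cE; case: (pencil_size n3 D0 CLD (pu u) (qu u) (ru u)).
have at0 : [/\ pu 0 =1 p0, qu 0 =1 q0 & ru 0 =1 r0].
  by split=> i; rewrite /pu /qu /ru ZE mul0r addr0 /y0 mxvecE mxE.
have [at0p at0q at0r] := at0.
have L0 : (P2`_D).[0] != 0 by rewrite LE (CL_ext C at0p at0r).
have pen0 : pencil C (pu 0) (qu 0) (ru 0) = pencil C p0 q0 r0.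
  by apply: poly_ext => s; rewrite !pencilE; apply: CL_ext => // l; rewrite at0q at0r.
have sP2 : size P2 = D.+1.
  apply/eqP; rewrite eqn_leq; apply/andP; split.
    apply/leq_sizeP => m Dm; apply: poly_ext => u; rewrite horner0 cE.
    have [/leq_sizeP s1 _] := pencil_size n3 D0 CLD (pu u) (qu u) (ru u); exact: s1.
  rewrite ltnNge; apply/negP => /leq_sizeP/(_ _ (leqnn D)) e.
  by rewrite e horner0 eqxx in L0.
have lP2 : lead_coef P2 = P2`_D by rewrite lead_coefE sP2.
have [s2 lP2'] : size P2^`() = D /\ lead_coef P2^`() = P2`_D *+ D.
  by rewrite -lP2; move: D0 sP2; case: D => // m _; apply: size_deriv_lead; rewrite // -polyC_natr polyC_eq0 pnatr_eq0.
pose W := resultant P2 P2^`().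
have WE u : CL C (pu u) (ru u) != 0 ->
    W.[u] = resultant (pencil C (pu u) (qu u) (ru u)) (pencil C (pu u) (qu u) (ru u))^`().
  move=> c0; rewrite -P2E deriv_map -map_resultant //.
    by rewrite lP2 /= horner_evalE LE.
  by rewrite lP2' raddfMn /= horner_evalE LE mulrn_eq0 negb_or c0 -lt0n D0.
have copE u : CL C (pu u) (ru u) != 0 ->
    (W.[u] != 0) = coprimep (pencil C (pu u) (qu u) (ru u)) (pencil C (pu u) (qu u) (ru u))^`().
  move=> c0; have P0 : pencil C (pu u) (qu u) (ru u) != 0.
    by apply: contraNneq c0 => e; rewrite -LE cE e coef0.
  by rewrite WE // resultant_eq0 -leqNgt /coprimep [RHS]eqn_leq size_poly_gt0 gcdp_eq0 (negPf P0) andbT.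
have W0 : W != 0.
  have : W.[0] != 0 by rewrite copE ?pen0 // -LE.
  by apply: contraNneq => ->; rewrite horner0.
pose H1 := line_restr h y0 (fun l => y1 l - y0 l).
have H10 : H1 != 0.
  apply: contraNneq hy1 => e; have := line_restrE h y0 (fun l => y1 l - y0 l) 1.
  rewrite -/H1 e horner0 => ->; apply/eqP.
  by apply: meval_eq => l; rewrite mul1r addrC subrK.
have L0' : P2`_D != 0 by apply: contraNneq L0 => ->; rewrite horner0.
have /poly_nonroot[u] : H1 * P2`_D * W != 0 by rewrite !mulf_neq0.
rewrite !hornerM !mulf_eq0 !negb_or LE -andbA => /and3P[H1u Lu Wu].
pose M : 'M[algC]_(n, 3) := \matrix_(i, j) (Z (mxvec_index i j)).[u].
have [|rM mM] := H M.
  apply: contraNneq H1u => e; apply/eqP; rewrite /H1 line_restrE -[RHS]e; apply: meval_eq => l.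
  by case/mxvec_indexP: l => i j; rewrite mxvecE mxE ZE.
have prM : CL C (fun l => M l 0) (fun l => M l ord_max) != 0.
  by apply: contraNneq Lu => <-; apply/eqP/CL_ext => l; rewrite mxE.
apply/eqP; rewrite eqn_leq (count_upper coneE prM mM) /=.
apply: (count_lower coneE rM prM _ mM).
rewrite (_ : pencil _ _ _ _ = pencil C (pu u) (qu u) (ru u)) -?copE //.
by apply: poly_ext => s; rewrite !pencilE; apply: CL_ext => l; rewrite !mxE.
Qed.

End ToricDegree.

(** * Plane geometry of the edge vectors *)

Section PlaneVectors.
Implicit Types x y z e : int * int.

Lemma det2D x y z : det2 x (y + z) = det2 x y + det2 x z.
Proof. by case: x y z => ? ? [? ?] [? ?]; rewrite /det2 /=; ring. Qed.

Lemma det2N x y : det2 x (- y) = - det2 x y.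
Proof. by case: x y => ? ? [? ?]; rewrite /det2 /=; ring. Qed.

Lemma det2Dl x y z : det2 (x + y) z = det2 x z + det2 y z.
Proof. by case: x y z => ? ? [? ?] [? ?]; rewrite /det2 /=; ring. Qed.

Lemma det2Nl x y : det2 (- x) y = - det2 x y.
Proof. by case: x y => ? ? [? ?]; rewrite /det2 /=; ring. Qed.

Lemma det2Mn x y k : det2 x (y *+ k) = det2 x y *+ k.
Proof.
by elim: k => [|k IH]; [rewrite !mulr0n; case: x => a c; rewrite /det2 /=; ring|rewrite !mulrS det2D IH].
Qed.

Lemma det2_sum x (I : finType) (F : I -> int * int) : det2 x (\sum_l F l) = \sum_l det2 x (F l).
Proof.
apply: (big_morph (det2 x) (det2D x)); case: x => a c; rewrite /det2 /=; ring.
Qed.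

Lemma det2_plucker x y z e : det2 x y * det2 z e = det2 x z * det2 y e + det2 x e * det2 z y.
Proof. by case: x y z e => ? ? [? ?] [? ?] [? ?]; rewrite /det2 /=; ring. Qed.

Lemma dot_det2 x y z : dot x x * det2 y z = det2 y x * dot x z + dot y x * det2 x z.
Proof. by case: x y z => ? ? [? ?] [? ?]; rewrite /det2 /dot /=; ring. Qed.

Lemma dot_plucker x y z e : det2 x y * dot z e = det2 x z * dot y e + det2 z y * dot x e.
Proof. by case: x y z e => ? ? [? ?] [? ?] [? ?]; rewrite /det2 /dot /=; ring. Qed.

Lemma dotC x y : dot x y = dot y x.
Proof. by rewrite /dot; ring. Qed.

Lemma dot_gt0 x : x != 0 -> 0 < dot x x.
Proof.
case: x => a c; rewrite xpair_eqE negb_and /dot /= => /orP[]; nia.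
Qed.

Lemma det2_skew x y : det2 y x = - det2 x y.
Proof. by rewrite /det2; ring. Qed.

Lemma det2xx x : det2 x x = 0.
Proof. by case: x => ? ?; rewrite /det2 /=; ring. Qed.

Lemma det2_eq0 x y z : det2 x y != 0 -> det2 x z = 0 -> det2 y z = 0 -> z = 0.
Proof.
case: x y z => [a c] [d e] [u v]; rewrite /det2 /= => H h1 h2.
congr (_, _); apply: (mulfI H); rewrite mulr0.
  by rewrite (_ : _ * u = d * (a * v - c * u) - a * (d * v - e * u)); [rewrite h1 h2 !mulr0 subr0|ring].
by rewrite (_ : _ * v = e * (a * v - c * u) - c * (d * v - e * u)); [rewrite h1 h2 !mulr0 subr0|ring].
Qed.

End PlaneVectors.

(** * Chains of extreme points *)

Section Chain.
Variables (n : nat) (b : 'I_n -> int * int).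
Hypothesis sumb : \sum_l b l = 0.
Local Notation D i j := (det2 (b i) (b j)).
Definition bsum (P : 'I_n -> bool) : int * int := \sum_l b l *+ P l.
(** The rows with the direction of b_i; their sum is the edge of P_B in that direction. *)
Definition ray (i l : 'I_n) := (D i l == 0) && (0 < dot (b i) (b l)).
Definition btw (i r l : 'I_n) := (0 < D i l) && (0 < D l r).

Lemma bsumD (P Q R : 'I_n -> bool) : (forall l, b l != 0 -> (P l : nat) = (Q l + R l)%N) ->
  bsum P = bsum Q + bsum R.
Proof.
move=> H; rewrite -big_split; apply: eq_bigr => l _ /=.
have [->|bl] := eqVneq (b l) 0; first by rewrite !mul0rn addr0.
by rewrite H // mulrnDr.
Qed.

Lemma bsum0 (P : 'I_n -> bool) : (forall l, b l != 0 -> ~~ P l) -> bsum P = 0.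
Proof.
move=> H; apply: big1 => l _; have [->|/H/negPf->] := eqVneq (b l) 0; first by rewrite mul0rn.
by rewrite mulr0n.
Qed.

Lemma det_bsum x (P : 'I_n -> bool) : det2 x (bsum P) = \sum_(l | P l) det2 x (b l).
Proof.
rewrite det2_sum [RHS]big_mkcond; apply: eq_bigr => l _.
by rewrite det2Mn; case: (P l).
Qed.

Lemma D_skew i j : D j i = - D i j.
Proof. exact: det2_skew. Qed.

Lemma D_neq0l i j : 0 < D i j -> b i != 0.
Proof. by apply: contraTneq => ->; rewrite /det2 /= !mul0r subrr ltxx. Qed.

Lemma D_neq0r i j : 0 < D i j -> b j != 0.
Proof. by apply: contraTneq => ->; rewrite /det2 /= !mulr0 subrr ltxx. Qed.

Lemma ray_pos i r l : 0 < D i r -> 0 < D i l -> ray r l = (D r l == 0).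
Proof.
move=> ir il; rewrite /ray; case: eqP => //= rl.
have := dot_plucker (b i) (b r) (b l) (b r); have := dot_gt0 (D_neq0r ir).
rewrite [D l r]D_skew rl oppr0 mul0r addr0 dotC; nia.
Qed.

Lemma ray_half i r l : 0 < D i r -> ray r l -> 0 < D i l.
Proof.
move=> ir /andP[/eqP rl dl].
have := dot_plucker (b i) (b r) (b l) (b r); have := dot_gt0 (D_neq0r ir).
rewrite [D l r]D_skew rl oppr0 mul0r addr0 dotC; nia.
Qed.

Lemma half_trans i x y z : 0 < D i x -> 0 < D i y -> 0 < D i z -> 0 <= D x y -> 0 <= D y z ->
  0 <= D x z /\ (0 < D x y \/ 0 < D y z -> 0 < D x z).
Proof.
move=> ix iy iz xy yz; have := det2_plucker (b i) (b y) (b x) (b z).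
split; [nia|case; nia].
Qed.

(** The last direction maximizes the number of rows passed on the way from b_i. *)
Lemma last_dir i (P : pred 'I_n) : (exists l, P l) -> (forall l, P l -> 0 < D i l) ->
  (forall l m k, P m -> P l -> 0 < D i k -> 0 < D k l -> 0 < D l m -> 0 < D k m) ->
  exists2 m, P m & forall l, P l -> D m l <= 0.
Proof.
move=> [l0 P0] Pi tr; case: (@arg_maxnP _ l0 P (fun l => #|btw i l|) P0) => m Pm mmax.
exists m => // l Pl; rewrite leNgt; apply/negP => ml.
have : (#|btw i m| < #|btw i l|)%N.
  apply/proper_card/properP; split.
    by apply/subsetP => k /andP[ik km]; apply/andP; split=> //; apply: tr km ml.
  exists m; first by apply/andP; rewrite Pi.
  by apply/negP => /andP[_]; rewrite det2xx ltxx.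
by apply/negP; rewrite -leqNgt; apply: mmax.
Qed.

Lemma btw_last i r : 0 < D i r -> (exists l, btw i r l) ->
  exists2 l, btw i r l & bsum (btw i r) = bsum (btw i l) + bsum (ray l) /\ forall k, ~~ btw l r k.
Proof.
move=> ir ex; have [||l lP lmax] := @last_dir i (btw i r) ex.
- by move=> l /andP[].
- move=> l m k /andP[im _] /andP[il _] ik kl lm.
  by have [_] := half_trans ik il im (ltW kl) (ltW lm); apply; left.
have /andP[il lr] := lP; exists l => //; split=> [|k]; last first.
  apply/negP => /andP[lk kr]; have := det2_plucker (b i) (b k) (b l) (b r) => e.
  have ik : 0 < D i k by rewrite -(pmulr_lgt0 _ lr) e addr_gt0 ?mulr_gt0.
  by have := lmax k; rewrite /btw ik kr leNgt lk => /(_ isT).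
apply: bsumD => k bk.
case: (boolP (btw i r k)) => [ik|].
  have := lmax _ ik; move: ik => /andP[ik kr].
  by rewrite (ray_pos il ik) /btw ik /= [D k l]D_skew oppr_gt0; case: ltgtP.
case: (boolP (btw i l k)) => [/andP[ik kl]|_].
  rewrite /btw ik /=; have [_ H] := half_trans ik il ir (ltW kl) (ltW lr).
  by rewrite H //; left.
case: (boolP (ray l k)) => // lk; have ik := ray_half il lk; rewrite /btw ik /=.
move: lk; rewrite (ray_pos il ik) => /eqP lk.
have kl0 : 0 <= D k l by rewrite D_skew lk oppr0.
by have [_ H] := half_trans ik il ir kl0 (ltW lr); rewrite H //; right.
Qed.

(** [s i] and [t i] stand for the first and the last point of the face of V on which det2 (b i) is
    minimal. *)
Variables (V : seq (int * int)) (s t : 'I_n -> int * int).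
Hypothesis sV : forall i, b i != 0 -> s i \in V.
Hypothesis tV : forall i, b i != 0 -> t i \in V.
Hypothesis s_min : forall i v, b i != 0 -> v \in V -> 0 <= det2 (b i) (v - s i).
Hypothesis t_min : forall i v, b i != 0 -> v \in V -> 0 <= det2 (b i) (v - t i).
Hypothesis t_last : forall i v, b i != 0 -> v \in V -> det2 (b i) (v - t i) = 0 ->
  dot (b i) (v - t i) <= 0.
Hypothesis st_long : forall i j, 0 < D i j -> det2 (bsum (ray i)) (b j) <= det2 (t i - s i) (b j).
Hypothesis width : forall i v, b i != 0 -> v \in V ->
  det2 (b i) (v - t i) <= \sum_(l | 0 < D i l) D i l.

Definition in_cone (p q x : int * int) := 0 <= det2 p x /\ 0 <= det2 x q.

Lemma in_coneD p q x y : in_cone p q x -> in_cone p q y -> in_cone p q (x + y).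
Proof. by move=> [p1 p2] [q1 q2]; split; rewrite ?det2D ?det2Dl addr_ge0. Qed.

Lemma cone_det p q x z : 0 < det2 p q -> in_cone p q x -> 0 <= det2 z p -> 0 <= det2 z q ->
  0 <= det2 z x.
Proof.
move=> pq [px xq] zp zq; rewrite -(pmulr_lge0 _ pq) det2_plucker.
by rewrite addr_ge0 ?mulr_ge0.
Qed.

Lemma cone_detr p q x z : 0 < det2 p q -> in_cone p q x -> 0 <= det2 p z -> 0 <= det2 q z ->
  0 <= det2 x z.
Proof.
move=> pq xC pz qz; rewrite det2_skew -det2Nl.
by apply: cone_det xC _ _; rewrite // det2Nl -det2_skew.
Qed.

(* The increments of [det2 (b i)] along the chain of extreme points t i, s r, t r, ... add up to at
   most the width in direction i, which is already exhausted by the rows themselves: gaps and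
   excesses vanish. *)
Definition gap q r := s r - t q - bsum (btw q r).
Definition excess r := t r - s r - bsum (ray r).

Lemma exists_pos i : (exists j, D i j != 0) -> exists j, 0 < D i j.
Proof.
move=> [j]; rewrite neq_lt => /orP[ij|]; last by exists j.
apply: NNPP => N; have : det2 (b i) (\sum_l b l) = 0 by rewrite sumb /det2 /=; ring.
rewrite det2_sum (bigD1 j) //= => /eqP; rewrite addrC addr_eq0 => /eqP e.
have : \sum_(l | l != j) D i l <= 0.
  by apply: sumr_le0 => l _; rewrite leNgt; apply/negP => H; apply: N; exists l.
by rewrite e oppr_le0 leNgt ij.
Qed.

Lemma exists_neg i : (exists j, D i j != 0) -> exists j, 0 < D j i.
Proof.
move=> [j]; rewrite neq_lt => /orP[ij|ij]; first by exists j; rewrite D_skew oppr_gt0.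
apply: NNPP => N; have : det2 (b i) (\sum_l b l) = 0 by rewrite sumb /det2 /=; ring.
rewrite det2_sum (bigD1 j) //= => /eqP; rewrite addrC addr_eq0 => /eqP e.
have : 0 <= \sum_(l | l != j) D i l.
  by apply: sumr_ge0 => l _; rewrite -oppr_le0 -D_skew leNgt; apply/negP => H; apply: N; exists l.
by rewrite e oppr_ge0 leNgt ij.
Qed.

Hypothesis indep : forall i, b i != 0 -> exists j, D i j != 0.

Lemma st_parallel i : b i != 0 -> det2 (b i) (t i - s i) = 0.
Proof.
move=> bi; apply/eqP; rewrite eq_le -oppr_ge0 -det2N opprB.
by rewrite t_min ?s_min ?sV ?tV.
Qed.

Lemma det_ray i : det2 (b i) (bsum (ray i)) = 0.
Proof. by rewrite det_bsum big1 // => l /andP[/eqP]. Qed.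

(** Both t r - s r and the ray sum are parallel to b_r, and by [st_long] their difference points
    forward along b_r, a boundary ray of both cones. *)
Lemma excess_cone p r q : 0 < D p r -> 0 < D r q -> in_cone (b p) (b r) (excess r) /\ in_cone (b r) (b q) (excess r).
Proof.
move=> pr rq; have br := D_neq0r pr.
have par : det2 (b r) (excess r) = 0.
  by rewrite /excess det2D det2N det_ray st_parallel // subr0.
have H : 0 <= det2 (excess r) (b q).
  by rewrite /excess det2Dl det2Nl; rewrite subr_ge0 st_long.
have par' : det2 (excess r) (b r) = 0 by rewrite -[RHS]oppr0 -par /det2; ring.
split; split; rewrite ?par ?par' //.
rewrite -(pmulr_lge0 _ rq) (det2_plucker (b p) (excess r) (b r) (b q)) par mulr0 addr0.
by rewrite mulr_ge0 // ltW.
Qed.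

(** Splitting at the last direction l before r gives gap q r = gap q l + excess l + (s r - t l), and
    each summand lies in the cone from b_q to b_r; the last one by the minimality of t l and s r. *)
Lemma gap_cone q r : 0 < D q r -> in_cone (b q) (b r) (gap q r).
Proof.
have [m] := ubnP #|btw q r|; elim: m r => // m IH r card qr.
have bq := D_neq0l qr; have br := D_neq0r qr.
have base l : 0 < D l r -> in_cone (b l) (b r) (s r - t l).
  move=> lr; split; first by rewrite t_min ?sV // (D_neq0l lr).
  by rewrite -[s r - t l]opprB det2Nl -det2_skew s_min ?tV // (D_neq0l lr).
case: (classic (exists l, btw q r l)) => [ex|N]; last first.
  rewrite /gap bsum0 ?subr0; first exact: base.
  by move=> l _; apply/negP => H; apply: N; exists l.
have [l lP [E _]] := btw_last qr ex; have /andP[ql lr] := lP; have bl := D_neq0r ql.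
have cardl : (#|btw q l| < m)%N.
  rewrite -ltnS; apply: leq_trans card; rewrite ltnS; apply/proper_card/properP; split.
    apply/subsetP => k /andP[qk kl]; apply/andP; split=> //.
    by have [_] := half_trans qk ql qr (ltW kl) (ltW lr); apply; left.
  by exists l => //; apply/negP => /andP[_]; rewrite det2xx ltxx.
have [g1 g2] := IH l cardl ql; have [e1 e2] := base l lr.
have [[x1 x2] [x3 x4]] := excess_cone ql lr.
have -> : gap q r = gap q l + excess l + (s r - t l).
  by rewrite /gap /excess E; apply/eqP; rewrite -subr_eq0; apply/eqP; ring.
have qr0 : 0 <= D q r by apply: ltW.
apply: in_coneD; first apply: in_coneD.
- by split=> //; apply: cone_detr ql (conj g1 g2) _ _; rewrite ltW.
- by [].
- by split=> //; apply: cone_det lr (conj e1 e2) _ _; rewrite ltW.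
Qed.

Lemma half_plane_sum i r m : 0 < D i r -> 0 < D i m -> (forall l, 0 < D i l -> D m l <= 0) ->
  bsum (fun l => 0 < D i l) = bsum (btw i r) + bsum (ray r) +
    (if 0 < D r m then bsum (btw r m) + bsum (ray m) else 0).
Proof.
move=> ir im mmax.
have lm l : 0 < D i l -> 0 <= D l m by move=> il; rewrite D_skew oppr_ge0 mmax.
have nray x l : 0 < D i x -> ~~ (0 < D i l) -> ray x l = false.
  by move=> ix il; apply: contraNF il; apply: ray_half.
case: ifP => [rm|/negbT]; last first.
  rewrite -leNgt => rm; have rm0 : D r m = 0 by apply/eqP; rewrite eq_le rm lm.
  rewrite addr0; apply: bsumD => l _; case: (boolP (0 < D i l)) => [il|il]; last first.
    by rewrite /btw (negPf il) nray.
  rewrite /btw il (ray_pos ir il) [D l r]D_skew oppr_gt0; case: ltgtP => //= rl.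
  by have [_] := half_trans ir il im (ltW rl) (lm _ il); rewrite rm0 ltxx => /(_ (or_introl rl)).
rewrite /bsum -!big_split; apply: eq_bigr => l _ /=; rewrite -!mulrnDr; congr (_ *+ _).
case: (boolP (0 < D i l)) => [il|il]; last first.
  rewrite !nray // /btw (negPf il) /=; case: (boolP (0 < D r l)) => //= rl.
  rewrite (_ : (0 < D l m) = false) //; apply: contraNF il => lm0.
  have := det2_plucker (b i) (b l) (b r) (b m) => e; rewrite -(pmulr_lgt0 _ rm) e.
  by rewrite addr_gt0 ?mulr_gt0.
rewrite /btw il (ray_pos ir il) (ray_pos im il) [D l r]D_skew oppr_gt0 /=.
have := lm l il; rewrite [D m l]D_skew oppr_eq0 => lm0.
have noray : D r l <= 0 -> (D l m == 0) = false.
  move=> rl; apply/negP => /eqP lm1; have ml : 0 <= D m l by rewrite D_skew lm1 oppr0.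
  have [_ /(_ (or_introl rm))] := half_trans ir im il (ltW rm) ml.
  by rewrite ltNge rl.
case: (ltgtP (D r l)) => /= rl.
- by rewrite noray ?ltW.
- by case: ltgtP lm0.
- by rewrite noray // rl.
Qed.

Lemma no_gap i r : 0 < D i r -> det2 (b i) (gap i r) = 0 /\ excess r = 0.
Proof.
move=> ir; have bi := D_neq0l ir; have br := D_neq0r ir.
(* m is the last direction in the half plane to the left of b_i. All rows of this half plane are
   passed on the way to it, and they alone already exhaust the width. *)
have [|||m im mmax] := @last_dir i (fun l => 0 < D i l).
- by exists r.
- by [].
- move=> l m k im il ik kl lm.
  by have [_] := half_trans ik il im (ltW kl) (ltW lm); apply; left.
have bm := D_neq0r im.
have [g1 g2] := gap_cone ir.
have exc x : 0 < D i x -> 0 <= det2 (b i) (excess x).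
  move=> ix; have [q xq] := exists_pos (indep (D_neq0r ix)).
  by have [[]] := excess_cone ix xq.
have tot : det2 (b i) (gap i r) + det2 (b i) (excess r) <= 0.
  case: (boolP (0 < D r m)) => rm; have := half_plane_sum ir im mmax; rewrite ?rm ?(negPf rm) => hs.
    have E : t m - t i = gap i r + excess r + (gap r m + excess m) + bsum (fun l => 0 < D i l).
      by rewrite hs /gap /excess; ring.
    have := width bi (tV bm); rewrite -det_bsum E det2D gerDr; apply: le_trans.
    rewrite [leRHS]det2D det2D lerDl det2D addr_ge0 ?exc //.
    by apply: cone_det rm (gap_cone rm) _ _; apply: ltW.
  have E : t r - t i = gap i r + excess r + bsum (fun l => 0 < D i l).
    by rewrite hs /gap /excess; ring.
  by have := width bi (tV br); rewrite -det_bsum E det2D gerDr det2D.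
have e0 : det2 (b i) (excess r) = 0.
  by apply/eqP; rewrite eq_le exc // andbT; apply: le_trans tot; rewrite lerDr.
split; first by apply/eqP; rewrite eq_le g1 andbT; move: tot; rewrite e0 addr0.
have r0 : det2 (b r) (excess r) = 0.
  by rewrite /excess det2D det2N det_ray st_parallel // subr0.
exact: det2_eq0 (lt0r_neq0 ir) e0 r0.
Qed.

Lemma edge_exact r : b r != 0 -> t r = s r + bsum (ray r).
Proof.
move=> br; have [i ir] := exists_neg (indep br); have [_ e] := no_gap ir.
by apply/eqP; rewrite -subr_eq0 opprD addrA -/(excess r) e.
Qed.

(** [no_gap] only kills det2 (b i) of the gap. For neighbouring directions l, r the gap s r - t l is
    parallel to b_l; [t_last] forbids it to point forward, and the cone of [gap_cone] forbids it to
    point backward. Induction adds up the neighbours. *)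
Lemma chain_exact i r : 0 < D i r -> s r = t i + bsum (btw i r).
Proof.
move=> ir; suff : gap i r = 0.
  by rewrite /gap => e; apply/eqP; rewrite -subr_eq0 opprD addrA e.
have [m] := ubnP #|btw i r|; elim: m r ir => // m IH r ir card.
have bi := D_neq0l ir; have br := D_neq0r ir.
have base l : 0 < D l r -> (forall k, ~~ btw l r k) -> gap l r = 0.
  move=> lr N; have [e _] := no_gap lr; have [_ g2] := gap_cone lr.
  have bl := D_neq0l lr.
  have gE : gap l r = s r - t l by rewrite /gap bsum0 ?subr0 // => k _; apply: N.
  rewrite gE in e g2 *; have := t_last bl (sV br) e; have d0 := dot_gt0 bl => dn.
  have := dot_plucker (b l) (b r) (s r - t l) (b l); rewrite e mul0r add0r dotC => E.
  have s0 : det2 (s r - t l) (b r) = 0.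
    apply/eqP; rewrite eq_le g2 andbT -(pmulr_lle0 _ d0) -E.
    by rewrite mulr_ge0_le0 // ltW.
  by apply: det2_eq0 (lt0r_neq0 lr) e _; rewrite det2_skew s0 oppr0.
case: (classic (exists l, btw i r l)) => [ex|N]; last first.
  by apply: base => // l; apply/negP => H; apply: N; exists l.
have [l lP [E Nlr]] := btw_last ir ex; have /andP[il lr] := lP; have bl := D_neq0r il.
have cardl : (#|btw i l| < m)%N.
  rewrite -ltnS; apply: leq_trans card; rewrite ltnS; apply/proper_card/properP; split.
    apply/subsetP => k /andP[qk kl]; apply/andP; split=> //.
    by have [_] := half_trans qk il ir (ltW kl) (ltW lr); apply; left.
  by exists l => //; apply/negP => /andP[_]; rewrite det2xx ltxx.
have -> : gap i r = gap i l + excess l + gap l r.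
  by rewrite /gap /excess E (@bsum0 (btw l r)) //; ring.
have [_ ->] := no_gap il.
by rewrite (IH l) // base.
Qed.

End Chain.

(** * Sorting by angle *)

Section Angles.
Variables (n : nat) (b : 'I_n -> int * int).
Hypothesis sumb : \sum_l b l = 0.
Local Notation D i j := (det2 (b i) (b j)).
Let N : int := (\sum_l `|(b l).1|%N)%:Z + 1.
Definition refdir : int * int := (N, -1).
Local Notation U i := (det2 refdir (b i)).
Definition al i j := angle_le (b i) (b j).

Lemma refdir_large i : - N < (b i).1 < N.
Proof.
have : (`|(b i).1| <= \sum_l `|(b l).1|)%N by rewrite (bigD1 i) //= leq_addr.
rewrite /N; set S := (\sum_l _)%N; lia.
Qed.

(* The reference direction lies just before the angle 0, so that upper_half becomes a linear condition. *)
Lemma upperE i : b i != 0 -> upper_half (b i) = (0 < U i) /\ U i != 0.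
Proof.
have := refdir_large i; rewrite /det2 /refdir /upper_half; move: N => M.
case: (b i) => x y /= H; rewrite -[0]/(0, 0) xpair_eqE negb_and => xy.
have [y0|y0|y0] := ltgtP y 0; split; move: xy; rewrite ?y0 ?eqxx ?orbT //= ?orbF; nia.
Qed.

Lemma al_U i j : b i != 0 -> b j != 0 ->
  al i j = if (0 < U i) == (0 < U j) then 0 <= D i j else 0 < U i.
Proof. by move=> bi bj; rewrite /al /angle_le (upperE bi).1 (upperE bj).1. Qed.

Lemma al_total i j : b i != 0 -> b j != 0 -> al i j || al j i.
Proof.
move=> bi bj; rewrite !al_U // [D j i]det2_skew oppr_ge0.
by case: (0 < U i); case: (0 < U j) => //=; apply: le_total.
Qed.

Lemma al_trans i j k : b i != 0 -> b j != 0 -> b k != 0 -> al i j -> al j k -> al i k.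
Proof.
move=> bi bj bk; rewrite !al_U //.
have := det2_plucker refdir (b j) (b i) (b k).
have [_] := upperE bi; have [_] := upperE bj; have [_] := upperE bk.
move: (U i) (U j) (U k) (D i j) (D j k) (D i k) => p q r X Y Z.
case: (ltgtP 0 p) => //; case: (ltgtP 0 q) => //; case: (ltgtP 0 r) => //=; nia.
Qed.

Lemma rayE i l : b i != 0 -> b l != 0 -> ray b i l = (D i l == 0) && ((0 < U i) == (0 < U l)).
Proof.
move=> bi bl; rewrite /ray; case: eqP => //= il.
have [_ ui] := upperE bi; have [_ ul] := upperE bl.
have := dot_plucker refdir (b i) (b l) (b i); rewrite [D l i]det2_skew il oppr0 mul0r addr0 dotC.
have := dot_gt0 bi; move: ui ul.
case: (ltgtP 0 (U i)) => //; case: (ltgtP 0 (U l)) => //= h1 h2 _ _ h3 h4; nia.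
Qed.

Variables (s t : 'I_n -> int * int) (i0 : 'I_n).
Hypothesis edge : forall r, b r != 0 -> t r = s r + bsum b (ray b r).
Hypothesis chain : forall i r, 0 < D i r -> s r = t i + bsum b (btw b i r).
Hypothesis s_ray : forall i r, b i != 0 -> ray b i r -> s r = s i.
Hypothesis bi0 : b i0 != 0.
Hypothesis indep0 : exists j, D i0 j != 0.
Hypothesis first : forall l, b l != 0 -> al i0 l.

Lemma first_upper : 0 < U i0.
Proof.
have [_ u0] := upperE bi0; rewrite lt_neqAle eq_sym u0 leNgt; apply/negP => ui0.
have neg l : U l <= 0.
  have [bl|bl] := eqVneq (b l) 0; first by rewrite bl /det2 /= !mulr0 subrr.
  by have := first bl; rewrite al_U // ltNge (ltW ui0) /=; case: ltP.
have : det2 refdir (\sum_l b l) = 0 by rewrite sumb /det2 /= !mulr0 subrr.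
rewrite det2_sum (bigD1 i0) //= => /eqP; rewrite addrC addr_eq0 => /eqP e.
have : \sum_(l | l != i0) U l <= 0 by apply: sumr_le0.
by rewrite e oppr_le0 leNgt ui0.
Qed.

Lemma first_det l : b l != 0 -> 0 < U l -> 0 <= D i0 l.
Proof. by move=> bl ul; have := first bl; rewrite al_U // first_upper ul. Qed.

(** A row to the left of b_i0 is reached from i0 by [chain]; for a row to the right, the chain from
    r back to i0 is used, because all rows sum to zero; a row opposite to b_i0 is reached through an
    intermediate row m. *)
Lemma start_point r : b r != 0 -> s r = s i0 + bsum b (fun l => ~~ al r l).
Proof.
move=> br; have u0 := first_upper; have [_ ur] := upperE br.
have [neg|pos|zero] := ltgtP (D i0 r) 0.
- have ri : 0 < D r i0 by rewrite det2_skew oppr_gt0.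
  have -> : bsum b (fun l => ~~ al r l) = - (bsum b (ray b r) + bsum b (btw b r i0)).
    apply/eqP; rewrite -addr_eq0 addrA; apply/eqP; rewrite -[RHS]sumb /bsum -!big_split.
    apply: eq_bigr => l _ /=; rewrite -!mulrnDr.
    have [->|bl] := eqVneq (b l) 0; first by rewrite mul0rn.
    rewrite -[RHS]mulr1n; congr (_ *+ _); rewrite (al_U br bl) (rayE br bl) /btw.
    have [_ ul] := upperE bl; have := first_det bl; have := first_det br.
    have := det2_plucker refdir (b l) (b r) (b i0).
    rewrite [D l i0]det2_skew [D i0 r]det2_skew.
    move: (U i0) (U r) (U l) (D r i0) (D i0 l) (D r l) u0 ur ul ri => p q m A B1 C1.
    move=> p0 q0 m0 A0 e Aq Bm; move: q0 m0 Aq Bm.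
    case: (ltgtP 0 q) => //; case: (ltgtP 0 m) => //; case: (ltgtP 0 B1) => //=;
      rewrite ?oppr_gt0; case: (ltgtP 0 C1) => //=; nia.
  by rewrite (chain ri) (edge br) -[s r + _ + _]addrA addrK.
- rewrite (chain pos) (edge bi0) -addrA; congr (_ + _); apply/esym/bsumD => l bl.
  rewrite (al_U br bl) (rayE bi0 bl) u0 /btw.
  have [_ ul] := upperE bl; have := first_det bl; have := first_det br.
  have := det2_plucker refdir (b l) (b i0) (b r).
  rewrite [D r l]det2_skew; move: (U i0) (U r) (U l) (D i0 r) (D i0 l) (D l r) u0 ur ul pos => p q m A B1 C1.
  move=> p0 q0 m0 A0 e Aq Bm; move: q0 m0 Aq Bm.
  case: (ltgtP 0 q) => //; case: (ltgtP 0 m) => //; case: (ltgtP 0 B1) => //=; rewrite ?oppr_ge0; case: (ltgtP 0 C1) => //=; nia.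
case: (boolP (0 < U r)) => pr.
  rewrite (s_ray bi0) ?rayE // ?zero ?eqxx ?u0 ?pr // bsum0 ?addr0 // => l bl.
  have [_ ul] := upperE bl; have := first_det bl.
  have := det2_plucker refdir (b l) (b i0) (b r); rewrite zero mulr0 (al_U br bl) pr [D r l]det2_skew.
  move: (U i0) (U r) (U l) (D i0 l) (D l r) u0 pr ul => p q m B1 C1 p0 q0 m0 e Bm; move: m0 Bm.
  by case: (ltgtP 0 m) => //= m0 _ Bm; rewrite negbK oppr_ge0; nia.
have [m im] := exists_pos sumb indep0.
have {}pr : U r < 0 by rewrite lt_neqAle ur leNgt.
have mr : 0 < D m r.
  have := det2_plucker refdir (b i0) (b m) (b r); rewrite zero mulr0 add0r [D m i0]det2_skew.
  by move: (U i0) (U r) (D m r) (D i0 m) u0 pr im => p q A X; nia.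
have bm := D_neq0r im.
rewrite (chain mr) (edge bm) (chain im) (edge bi0) -!addrA; congr (_ + _).
rewrite /bsum -!big_split; apply: eq_bigr => l _ /=; rewrite -!mulrnDr.
have [->|bl] := eqVneq (b l) 0; first by rewrite !mul0rn.
congr (_ *+ _); rewrite (al_U br bl) (rayE bi0 bl) (rayE bm bl) /btw u0.
have [_ ul] := upperE bl; have := first_det bl; have [_ um] := upperE bm.
have := det2_plucker refdir (b l) (b i0) (b m); have := det2_plucker refdir (b l) (b i0) (b r).
rewrite zero mulr0 [D r l]det2_skew [D m l]det2_skew oppr_gt0 oppr_eq0.
move: (U i0) (U r) (U l) (U m) (D i0 l) (D l r) (D i0 m) (D l m) u0 pr ul um im => p q v w B1 C1 X Y.
move=> p0 q0 v0 w0 X0 e1 e2 Bm; move: v0 w0 Bm; rewrite oppr_ge0 (ltNge 0 q) (ltW q0) /=.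
have C1B : C1 = 0 <-> B1 = 0 by split; nia.
have C1P : 0 < C1 <-> 0 < B1 by split; nia.
case: (ltgtP 0 v) => //; case: (ltgtP 0 w) => //= w0 v0 _ _ Bm;
  case: (ltgtP 0 B1) => //= B0; case: (ltgtP 0 C1) => //= C0; case: (ltgtP 0 Y) => //= Y0; nia.
Qed.

End Angles.

(** * Convex hulls *)

Section Convex.
Variables (R : realFieldType) (m : nat).
Implicit Types (pts : seq 'rV[R]_m) (v w : 'rV[R]_m).

Lemma conv_mem pts v : v \in pts -> in_conv pts v.
Proof.
move=> vp; have h : (index v pts < size pts)%N by rewrite index_mem.
exists (fun k => (k == Ordinal h)%:R); split=> [k|]; first by rewrite ler0n.
split; first by rewrite (bigD1 (Ordinal h)) //= eqxx big1 ?addr0 // => k /negPf->.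
rewrite (bigD1 (Ordinal h)) //= eqxx scale1r nth_index // big1 ?addr0 // => k /negPf->.
by rewrite scale0r.
Qed.

Lemma conv_comb pts (I : finType) (lam : I -> R) (w : I -> 'rV[R]_m) :
  (forall k, 0 <= lam k) -> \sum_k lam k = 1 -> (forall k, in_conv pts (w k)) ->
  in_conv pts (\sum_k lam k *: w k).
Proof.
move=> l0 l1 /(fin_all_exists (U := fun=> _))[mu muP].
exists (fun j => \sum_k lam k * mu k j); split=> [j|].
  by apply: sumr_ge0 => k _; rewrite mulr_ge0 //; case: (muP k).
split.
  rewrite exchange_big /= -l1; apply: eq_bigr => k _.
  by have [_ [e _]] := muP k; rewrite -mulr_sumr e mulr1.
under [RHS]eq_bigr do rewrite scaler_suml.
rewrite exchange_big /=; apply: eq_bigr => k _.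
have [_ [_ ->]] := muP k; rewrite scaler_sumr; apply: eq_bigr => j _.
by rewrite scalerA.
Qed.

Lemma conv_sub pts pts' v : (forall w, w \in pts -> in_conv pts' w) -> in_conv pts v -> in_conv pts' v.
Proof. by move=> H [lam [l0 [l1 ->]]]; apply: conv_comb => // k; apply: H; apply: mem_nth. Qed.

Lemma conv_triangle pts u v w a c : 0 <= a -> 0 <= c -> a + c <= 1 ->
  in_conv pts u -> in_conv pts v -> in_conv pts w ->
  in_conv pts ((1 - a - c) *: u + a *: v + c *: w).
Proof.
move=> a0 c0 ac up vp wp.
have -> : (1 - a - c) *: u + a *: v + c *: w =
    \sum_(k < 3) nth 0 [:: 1 - a - c; a; c] k *: nth 0 [:: u; v; w] k.
  by rewrite !big_ord_recl big_ord0 /= addr0 addrA.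
apply: conv_comb => [[[|[|[|//]]] hk] //=||[[|[|[|//]]] hk] //].
  by rewrite -addrA -opprD subr_ge0.
by rewrite !big_ord_recl big_ord0 /=; ring.
Qed.

End Convex.

Lemma conv_affine (R : realFieldType) (m m' : nat) (L : 'rV[R]_m -> 'rV[R]_m')
    (pts : seq 'rV[R]_m) x :
  (forall (I : finType) (lam : I -> R) (w : I -> 'rV[R]_m), \sum_k lam k = 1 ->
    L (\sum_k lam k *: w k) = \sum_k lam k *: L (w k)) ->
  in_conv (map L pts) x <-> exists2 w, in_conv pts w & x = L w.
Proof.
move=> HL; split=> [[lam [l0 [l1 ->]]]|[w [lam [l0 [l1 ->]]] ->]].
  move: lam l0 l1; rewrite /in_conv size_map => lam l0 l1.
  exists (\sum_k lam k *: nth 0 pts k); first by exists lam.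
  by rewrite HL //; apply: eq_bigr => k _; rewrite (nth_map 0).
rewrite HL //; apply: conv_comb => // k; apply: conv_mem.
by apply/map_f/mem_nth.
Qed.

Section Hull.
Variables (n : nat) (B : 'M[int]_(n, 2)).
Local Notation b := (rowB B).
Local Notation ss := (sorted_rows B).
Local Notation D i j := (det2 (b i) (b j)).
Hypothesis sumb : \sum_l b l = 0.

Lemma mem_sorted_rows l : (l \in ss) = (b l != 0).
Proof. by rewrite mem_sort mem_filter mem_enum andbT. Qed.

Lemma sorted_rows_uniq : uniq ss.
Proof. by rewrite sort_uniq filter_uniq // enum_uniq. Qed.

Lemma sorted_rows_pairwise : pairwise (al b) ss.
Proof.
pose P := [pred i | b i != 0].
have aP : all P [seq i <- enum 'I_n | b i != (0, 0)] by apply: filter_all.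
rewrite -(@sorted_pairwise_in _ P).
- apply: (@sort_sorted_in _ P) => // i j bi bj; exact: al_total.
- move=> j i k bj bi bk; exact: al_trans.
- by rewrite (perm_all P (_ : perm_eq ss [seq i <- enum 'I_n | b i != (0, 0)])) // perm_sort.
Qed.

Definition edge_sum k := \sum_(i <- take k ss) b i.

Lemma edge_sum_rec k r : (k < size ss)%N -> edge_sum k.+1 = edge_sum k + b (nth r ss k).
Proof.
move=> h; rewrite /edge_sum (take_nth r) // -cats1 big_cat /= big_seq1; congr (_ + _).
Qed.

Lemma edge_sum_bsum k : edge_sum k = bsum b (fun l => l \in take k ss).
Proof.
rewrite /edge_sum (big_uniq _ (take_uniq k sorted_rows_uniq)) big_mkcond; apply: eq_bigr => l _ /=.
by case: (l \in take k ss).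
Qed.

Lemma edge_sum_size : edge_sum (size ss) = 0.
Proof.
rewrite edge_sum_bsum -sumb; apply: eq_bigr => l _; rewrite take_size mem_sorted_rows.
by have [->|] := eqVneq (b l) 0; rewrite ?mul0rn.
Qed.

(** Sorting leaves the order of the rows on one ray open, so a partial sum may stop inside an edge:
    it consists of all rows strictly before the k-th and some of those on its ray. *)
Lemma edge_sum_ray k r0 : (k < size ss)%N ->
  edge_sum k = bsum b (fun l => ~~ al b (nth r0 ss k) l) +
           bsum b (fun l => (l \in take k ss) && ray b (nth r0 ss k) l).
Proof.
move=> h; set r := nth r0 ss k; have br : b r != 0 by rewrite -mem_sorted_rows mem_nth.
rewrite edge_sum_bsum; apply: bsumD => l bl.
have pw := sorted_rows_pairwise; move: pw; rewrite -{1}(cat_take_drop k ss) pairwise_cat.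
rewrite (drop_nth r0 h) -/r => /and3P[/allrelP ar _ /= /andP[/allP rl _]].
have := mem_sorted_rows l; rewrite bl -{1}(cat_take_drop k ss) mem_cat (drop_nth r0 h) -/r.
case: (boolP (l \in take k ss)) => [lt _|lt /= ld].
  have lr : al b l r by apply: ar => //; rewrite mem_head.
  rewrite /=; case: (boolP (al b r l)) => [rl'|N]; last first.
    rewrite (_ : ray b r l = false) //; apply: contraNF N.
    by rewrite (rayE br bl) (al_U br bl) => /andP[/eqP->->].
  move: lr rl'; rewrite (rayE br bl) !al_U // [D l r]det2_skew oppr_ge0.
  rewrite [(0 < det2 _ (b l)) == _]eq_sym; case: eqP => e; last first.
    by case: (0 < det2 _ (b l)) e; case: (0 < det2 _ (b r)).
  by case: ltgtP.
have -> : al b r l.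
  move: ld; rewrite inE => /predU1P[->|/rl //]; by have := al_total br br; rewrite orbb.
by [].
Qed.

Variables (V VF : seq (int * int)) (s t : 'I_n -> int * int).
Hypothesis VFV : {subset VF <= V}.
Hypothesis sVF : forall i, b i != 0 -> s i \in VF.
Hypothesis tVF : forall i, b i != 0 -> t i \in VF.
Hypothesis s_min : forall i v, b i != 0 -> v \in V -> 0 <= det2 (b i) (v - s i).
Hypothesis edge : forall r, b r != 0 -> t r = s r + bsum b (ray b r).
Hypothesis chain : forall i r, 0 < D i r -> s r = t i + bsum b (btw b i r).
Hypothesis s_ray : forall i r, b i != 0 -> ray b i r -> s r = s i.
Hypothesis indep : forall i, b i != 0 -> exists j, D i j != 0.
Variable r0 : 'I_n.
Hypothesis br0 : b r0 != 0.
Let i0 := nth r0 ss 0.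

Lemma size_sorted_rows : (0 < size ss)%N.
Proof. by have := mem_sorted_rows r0; rewrite br0; case: ss. Qed.

Lemma vertex_point k : (k < size ss)%N -> s i0 + edge_sum k =
  s (nth r0 ss k) + bsum b (fun l => (l \in take k ss) && ray b (nth r0 ss k) l).
Proof.
move=> h; have br : b (nth r0 ss k) != 0 by rewrite -mem_sorted_rows mem_nth.
have bi0 : b i0 != 0 by rewrite -mem_sorted_rows mem_nth // size_sorted_rows.
rewrite (edge_sum_ray r0 h) addrA; congr (_ + _); apply/esym.
apply: (start_point sumb edge chain s_ray bi0 (indep bi0)) => // l bl.
have := sorted_rows_pairwise; have := mem_sorted_rows l; rewrite bl.
rewrite /i0; case E : ss => [|a s'] /=; first by [].
rewrite inE => /predU1P[->|ls] /andP[/allP ar _]; last exact: ar.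
have ba : b a != 0 by rewrite -mem_sorted_rows E mem_head.
by have := al_total ba ba; rewrite orbb.
Qed.

(** In [points_in_PB] the value f k is det2 of the k-th vertex with the given point: a sign change
    selects a triangle of the fan from the first vertex, and if all values vanish the point is that
    vertex. *)
Lemma discrete_ivt (f : nat -> int) N : 0 <= f 0%N -> f N <= 0 ->
  (exists2 k, (k < N)%N & [/\ 0 <= f k, f k.+1 <= 0 & f k.+1 < f k]) \/
  (forall k, (k <= N)%N -> f k = 0).
Proof.
move=> f0 fN; case: (classic (exists2 k, (k < N)%N & [/\ 0 <= f k, f k.+1 <= 0 & f k.+1 < f k])) => [?|H]; [by left|right].
have ge0 k : (k <= N)%N -> 0 <= f k.
  elim: k => // k IH kN; rewrite leNgt; apply/negP => fk; have fk0 := IH (ltnW kN).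
  by apply: H; exists k => //; split=> //; [exact: ltW|exact: lt_le_trans fk fk0].
suff down k : (k <= N)%N -> f (N - k)%N = 0 by move=> k kN; rewrite -(subKn kN) down ?leq_subr.
elim: k => [|k IH] kN; first by apply/eqP; rewrite subn0 eq_le fN ge0.
have e : (N - k = (N - k.+1).+1)%N by lia.
have := IH (ltnW kN); rewrite e => f1; apply/eqP; rewrite eq_le ge0 ?leq_subr // andbT leNgt.
apply/negP => fk; apply: H; exists (N - k.+1)%N; first by lia.
by rewrite f1; split=> //; exact: ltW.
Qed.

Variable R : realFieldType.
Local Notation pt := (to_pt R).

Lemma to_ptD x y : pt (x + y) = pt x + pt y.
Proof. by apply/rowP => j; rewrite !mxE; case: ifP => _; rewrite -intrD. Qed.

Lemma to_pt0 : pt 0 = 0.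
Proof. by apply/rowP => j; rewrite !mxE; case: ifP. Qed.

Lemma to_ptB x y : pt (x - y) = pt x - pt y.
Proof. by apply/eqP; rewrite eq_sym subr_eq -to_ptD subrK. Qed.

Lemma detR_pt x y : detR x (pt y) = (det2 x y)%:~R.
Proof. by rewrite /detR !mxE /= /det2 intrB !intrM. Qed.

Lemma PB_ptsE : PB_pts R B = [seq pt (edge_sum k) | k <- iota 0 (size ss).+1].
Proof.
apply: eq_map => k; rewrite /edge_sum; apply/esym/(big_morph pt to_ptD to_pt0).
Qed.

Lemma parallel_scale x c be : x != 0 -> det2 x c = 0 -> det2 x be = 0 -> dot x be != 0 ->
  pt c = ((dot x c)%:~R / (dot x be)%:~R) *: pt be.
Proof.
move=> x0 xc xbe d0; have cb : det2 c be = 0.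
  have := dot_det2 x c be; rewrite xbe mulr0 addr0 [det2 c x]det2_skew xc oppr0 mul0r => /eqP.
  by rewrite mulf_eq0 gt_eqF ?dot_gt0 //= => /eqP.
have d0' : (dot x be)%:~R != 0 :> R by rewrite intr_eq0.
apply/rowP => j; rewrite !mxE mulrAC; apply: (mulIf d0'); rewrite divfK //.
move: xc xbe cb; rewrite /det2 /dot; case: x c be {x0 d0 d0'} => [x1 x2] [c1 c2] [e1 e2] /= h1 h2 h3.
have g1 : x1 * (c1 * e2 - c2 * e1) = 0 by rewrite h3 mulr0.
have g2 : x2 * (c1 * e2 - c2 * e1) = 0 by rewrite h3 mulr0.
by case: ifP => _; rewrite -!intrM; congr (_%:~R); move: g1 g2; clear; nia.
Qed.

Lemma dot_bsum x (Q : 'I_n -> bool) : dot x (bsum b Q) = \sum_(l | Q l) dot x (b l).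
Proof.
rewrite (big_morph (dot x) (id1 := 0) (op1 := +%R)) => [|y z|]; last 2 first.
- by rewrite /dot /=; ring.
- by rewrite /dot /=; ring.
rewrite [RHS]big_mkcond; apply: eq_bigr => l _.
by case: (Q l); rewrite ?mulr1n ?mulr0n // /dot /= !mulr0 addr0.
Qed.

(** By [vertex_point] a partial sum lies on the segment from s r to t r, at the fraction th of the
    edge already covered. *)
Lemma vertices_in_hull k : (k <= size ss)%N ->
  in_conv [seq pt v | v <- VF] (pt (s i0) + pt (edge_sum k)).
Proof.
have lt_case j : (j < size ss)%N -> in_conv [seq pt v | v <- VF] (pt (s i0) + pt (edge_sum j)).
  move=> h; rewrite -to_ptD (vertex_point h); set r := nth _ _ _; set P := fun l => _ && _.
  have br : b r != 0 by rewrite -mem_sorted_rows mem_nth.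
  have PR l : P l -> ray b r l by case/andP.
  have dc : det2 (b r) (bsum b P) = 0.
    by rewrite det_bsum big1 // => l /PR/andP[/eqP].
  have dbe : 0 < dot (b r) (bsum b (ray b r)).
    rewrite dot_bsum (bigD1 r) /=; last by rewrite /ray det2xx eqxx dot_gt0.
    by rewrite ltr_wpDr ?dot_gt0 // sumr_ge0 // => l /andP[/andP[_ /ltW]].
  have c0 : 0 <= dot (b r) (bsum b P).
    by rewrite dot_bsum sumr_ge0 // => l /PR/andP[_ /ltW].
  have cle : dot (b r) (bsum b P) <= dot (b r) (bsum b (ray b r)).
    rewrite !dot_bsum [leRHS](bigID P) /= [X in _ <= X + _](eq_bigl P) => [|l]; last first.
      by apply/andP/idP => [[]//|pl]; split=> //; exact: PR.
    by rewrite lerDl sumr_ge0 // => l /andP[/andP[_ /ltW]].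
  have := parallel_scale br dc (det_ray b r) (lt0r_neq0 dbe).
  set th := _ / _ => e.
  have d0' : 0 < (dot (b r) (bsum b (ray b r)))%:~R :> R by rewrite ltr0z.
  have -> : pt (s r + bsum b P) = (1 - th - 0) *: pt (s r) + th *: pt (t r) + 0 *: pt (s r).
    by rewrite edge // !to_ptD e scalerDr subr0 scale0r addr0 scalerBl scale1r addrA subrK.
  apply: conv_triangle => //; first by rewrite divr_ge0 ?ler0z // ltW.
  - by rewrite addr0 ler_pdivrMr // mul1r ler_int.
  - by apply/conv_mem/map_f/sVF.
  - by apply/conv_mem/map_f/tVF.
  - by apply/conv_mem/map_f/sVF.
rewrite leq_eqVlt => /predU1P[->|]; last exact: lt_case.
by have := lt_case 0%N size_sorted_rows; rewrite edge_sum_size {1}/edge_sum take0 big_nil.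
Qed.

Lemma det2_cramer (p q x : int * int) :
  x.1 * det2 p q = - det2 q x * p.1 + det2 p x * q.1 /\
  x.2 * det2 p q = - det2 q x * p.2 + det2 p x * q.2.
Proof. by split; rewrite /det2; ring. Qed.

(** Where the sign changes, x is by Cramer's rule a nonnegative combination of two consecutive
    vertices; [s_min] for the edge joining them gives a + c <= 1, so x lies in the triangle they
    form with the first vertex. *)
Lemma points_in_PB v : v \in V -> in_PB B (pt (v - s i0)).
Proof.
move=> vV; set x := v - s i0; pose f k := det2 (edge_sum k) x.
have edge_sumP k : (k <= size ss)%N -> pt (edge_sum k) \in PB_pts R B.
  by move=> kN; rewrite PB_ptsE; apply/mapP; exists k; rewrite ?mem_iota.
have p0 : edge_sum 0 = 0 by rewrite /edge_sum take0 big_nil.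
have f0 : f 0%N = 0 by rewrite /f p0 /det2 /= !mul0r subrr.
have fN : f (size ss) = 0 by rewrite /f edge_sum_size /det2 /= !mul0r subrr.
have frec k : (k < size ss)%N -> f k - f k.+1 <= det2 (edge_sum k) (edge_sum k.+1).
  move=> h; have br : b (nth r0 ss k) != 0 by rewrite -mem_sorted_rows mem_nth.
  rewrite /f (edge_sum_rec r0 h) det2Dl [det2 (edge_sum k) (edge_sum k + _)]det2D det2xx add0r.
  have := s_min br vV; rewrite (_ : v - s _ = x - edge_sum k + bsum b (fun l => (l \in take k ss) && ray b (nth r0 ss k) l)).
    rewrite [det2 _ (x - _ + _)]det2D [det2 _ (x - _)]det2D [det2 _ (- edge_sum k)]det2N (det2_skew (edge_sum k)) det_bsum.
    rewrite big1 ?addr0; last by move=> l /andP[_ /andP[/eqP]].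
    move: (det2 (b _) x) (det2 (edge_sum k) x) (det2 (edge_sum k) (b _)); clear; lia.
  have := vertex_point h => /eqP; rewrite addrC eq_sym -subr_eq => /eqP <-.
  rewrite /x; ring.
have [|||fz] := @discrete_ivt f (size ss); rewrite ?f0 ?fN //.
  case=> k h [fk fk1 fkk]; have W0 : 0 < det2 (edge_sum k) (edge_sum k.+1).
    by apply: lt_le_trans (frec k h); rewrite subr_gt0.
  have W0' : 0 < (det2 (edge_sum k) (edge_sum k.+1))%:~R :> R by rewrite ltr0z.
  pose a : R := - (f k.+1)%:~R / (det2 (edge_sum k) (edge_sum k.+1))%:~R.
  pose c : R := (f k)%:~R / (det2 (edge_sum k) (edge_sum k.+1))%:~R.
  have -> : pt x = (1 - a - c) *: pt (edge_sum 0) + a *: pt (edge_sum k) + c *: pt (edge_sum k.+1).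
    rewrite p0 to_pt0 scaler0 add0r; apply/rowP => j; rewrite !mxE.
    apply: (mulIf (lt0r_neq0 W0')); rewrite mulrDl mulrAC [c * _ * _]mulrAC !divfK ?lt0r_neq0 //.
    have [c1 c2] := det2_cramer (edge_sum k) (edge_sum k.+1) x.
    by case: ifP => _; rewrite -intrN -!intrM -intrD ?c1 ?c2.
  have a0 : 0 <= a by apply: divr_ge0; [rewrite -intrN ler0z oppr_ge0|exact: ltW].
  have c0 : 0 <= c by apply: divr_ge0; [rewrite ler0z|exact: ltW].
  have ac : a + c <= 1.
    by rewrite -mulrDl ler_pdivrMr // mul1r -intrN -intrD ler_int addrC frec.
  by apply: conv_triangle a0 c0 ac _ _ _; apply/conv_mem/edge_sumP => //; exact: ltnW.
have dr r : b r != 0 -> det2 (b r) x = 0.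
  rewrite -mem_sorted_rows => /(nthP r0)[k h <-].
  have := fz _ h; rewrite /f (edge_sum_rec r0 h) det2Dl -/(f k) fz ?add0r //; exact: ltnW.
have [j ij] := indep br0; have bj : b j != 0 by apply: contraNneq ij => ->; rewrite /det2 /= !mulr0 subrr.
rewrite (det2_eq0 ij (dr _ br0) (dr _ bj)) -p0; exact/conv_mem/edge_sumP.
Qed.

Lemma hull_PB u : in_conv [seq pt v | v <- VF] (pt (s i0) + u) <-> in_PB B u.
Proof.
split=> [|[lam [l0 [l1 ->]]]].
  case=> lam [l0 [l1 e]].
  have -> : u = \sum_k lam k *: (nth 0 [seq pt v | v <- VF] k - pt (s i0)).
    under eq_bigr do rewrite scalerBr.
    by rewrite sumrB -e -scaler_suml l1 scale1r addrC addKr.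
  apply: conv_comb => // k; have /mapP[v vF ->] := mem_nth 0 (ltn_ord k).
  by rewrite -to_ptB; apply/points_in_PB/VFV.
have -> : pt (s i0) + \sum_k lam k *: nth 0 (PB_pts R B) k =
    \sum_k lam k *: (pt (s i0) + nth 0 (PB_pts R B) k).
  by under [RHS]eq_bigr do rewrite scalerDr; rewrite big_split -scaler_suml l1 scale1r.
apply: conv_comb => // k; have := mem_nth 0 (ltn_ord k); set w := nth _ _ _.
rewrite PB_ptsE => /mapP[j]; rewrite mem_iota => /andP[_ jN] ->.
by apply: vertices_in_hull.
Qed.

End Hull.

(** * The polygon of exponents *)

Lemma seq_max (T : eqType) (s : seq T) (f : T -> int) : (exists x, x \in s) ->
  exists2 x, x \in s & forall y, y \in s -> f y <= f x.
Proof.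
elim: s => [[x]//|a s IH _].
case: (classic (exists x, x \in s)) => [/IH[x xs xm]|N]; last first.
  exists a; first exact: mem_head.
  by move=> y; rewrite inE => /predU1P[->//|ys]; case: N; exists y.
have [h|h] := leP (f a) (f x).
  exists x; first by rewrite inE xs orbT.
  by move=> y; rewrite inE => /predU1P[->|/xm].
exists a; first exact: mem_head.
move=> y; rewrite inE => /predU1P[->//|/xm yx]; exact: le_trans yx (ltW h).
Qed.

Section Extremes.
Variables (n : nat) (B : 'M[int]_(n, 2)).
Local Notation b := (rowB B).
Local Notation D i j := (det2 (b i) (b j)).
Hypothesis sumb : \sum_l b l = 0.
Hypothesis indep : forall i, b i != 0 -> exists j, D i j != 0.
(** V parametrizes the row exponents of C, and VF those that occur in F; [ex v] is the exponent
    belonging to v. *)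
Variables (kap : 'I_n -> int) (V VF : seq (int * int)).
Definition ex (v : int * int) (l : 'I_n) : int := kap l - det2 (b l) v.
Let w i := \sum_(l | 0 < D i l) D i l.
Hypothesis VFV : {subset VF <= V}.
Hypothesis ex_ge0 : forall v l, v \in V -> 0 <= ex v l.
Hypothesis ex_le : forall v i, v \in V -> b i != 0 -> ex v i <= w i.
Hypothesis ex_long : forall i, b i != 0 -> exists v v', [/\ v \in V, v' \in V, ex v i = w i, ex v' i = w i &
  forall j, 0 < D i j -> ex v j + det2 (bsum b (ray b i)) (b j) <= ex v' j].
Hypothesis ex_extreme : forall om : 'I_n -> nat,
  (forall l, b l != 0 -> det2 (\sum_k b k *+ om k) (b l) != 0) ->
  forall v, v \in V -> (forall v', v' \in V -> v' != v ->
    \sum_l (om l)%:Z * ex v' l < \sum_l (om l)%:Z * ex v l) -> v \in VF.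

Lemma ex_sub v v' l : ex v l - ex v' l = - det2 (b l) (v - v').
Proof. by rewrite /ex det2D det2N; ring. Qed.

(** The weight N at i and 1 at j maximizes first the exponent in row i and then the one in row j. N
    is at least M1, so that row j cannot outweigh row i, and exceeds all |D j l|, so that the weight
    is in general position for [ex_extreme]. *)
Lemma extreme_point i j : D i j != 0 -> exists2 v, v \in VF &
  ex v i = w i /\ forall v', v' \in V -> ex v' i = w i -> ex v' j <= ex v j.
Proof.
move=> ij; have bi : b i != 0 by apply: contraNneq ij => ->; rewrite /det2 /= !mul0r subrr.
have [v0 [_ [v0V _ v0i _ _]]] := ex_long bi.
have [M1 M1P] : exists M1 : int, forall v, v \in V -> ex v j < M1.
  have [x _ xm] := @seq_max _ V (fun v => ex v j) (ex_intro _ v0 v0V).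
  by exists (ex x j + 1) => v /xm; lia.
pose N : nat := (`|M1| + \sum_l `|D j l| + 1)%N.
have NM : M1 <= N%:Z by rewrite /N; lia.
have ND l : (`|D j l| < N)%N.
  by rewrite /N addn1 ltnS (leq_trans _ (leq_addl _ _)) // (bigD1 l) //= leq_addr.
pose om (k : 'I_n) : nat := ((k == i) * N + (k == j))%N.
have omE v : \sum_l (om l)%:Z * ex v l = N%:Z * ex v i + ex v j.
  under eq_bigr do rewrite /om PoszD mulrDl.
  rewrite big_split /= (bigD1 i) //= eqxx mul1n big1 ?addr0 => [|l /negPf->]; last by rewrite mul0n mul0r.
  rewrite (bigD1 j) //= eqxx mul1r big1 ?addr0 // => l /negPf->; by rewrite mul0r.
have [v vV vmax] := @seq_max _ V (fun v => N%:Z * ex v i + ex v j) (ex_intro _ v0 v0V).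
have vi : ex v i = w i.
  apply/eqP; rewrite eq_le ex_le //= leNgt; apply/negP => lt.
  have := vmax _ v0V; rewrite v0i; have := M1P _ vV; have := ex_ge0 j v0V; nia.
exists v; last first.
  by split=> // v' v'V v'i; have := vmax _ v'V; rewrite vi v'i lerD2l.
apply: (@ex_extreme om) => // [l bl|v' v'V v'v]; last first.
  rewrite !omE lt_neqAle vmax // andbT; apply: contra_neq v'v => e.
  have v'i : ex v' i = w i.
    apply/eqP; rewrite eq_le ex_le //= leNgt; apply/negP => lt.
    move: e; rewrite vi; have := M1P _ v'V; have := ex_ge0 j vV; nia.
  have ej : ex v' j = ex v j by move: e; rewrite vi v'i => /addrI.
  apply/eqP; rewrite -subr_eq0; apply/eqP; apply: (det2_eq0 ij); apply: oppr_inj; rewrite -ex_sub oppr0.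
    by rewrite v'i vi subrr.
  by rewrite ej subrr.
rewrite det2_skew oppr_eq0 det2_sum.
have -> : \sum_k det2 (b l) (b k *+ om k) = - (N%:Z * D i l + D j l).
  under eq_bigr do rewrite det2Mn /om mulrnDr.
  rewrite big_split /= (bigD1 i) //= eqxx mul1n big1 ?addr0 => [|k /negPf->]; last by rewrite mul0n mulr0n.
  rewrite (bigD1 j) //= eqxx mulr1n big1 ?addr0 => [|k /negPf->]; last by rewrite mulr0n.
  by rewrite [D i l]det2_skew [D j l]det2_skew -mulr_natl natz; ring.
rewrite oppr_eq0; have [il|il] := eqVneq (D i l) 0.
  rewrite il mulr0 add0r; apply: contra_neq bl => jl; exact: det2_eq0 ij il jl.
apply/eqP => e; have := ND l; have : (N%:Z <= `|N%:Z * D i l|); first by nia.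
move: e; lia.
Qed.

Lemma parallel_dot (x y z : int * int) : det2 x z = 0 -> det2 x y * dot x z = - det2 y z * dot x x.
Proof. by move=> xz; have := dot_plucker x y z x; rewrite xz mul0r add0r dotC => ->; rewrite det2_skew. Qed.

Lemma dot_collinear (x y z : int * int) :
  dot x x * dot y z = dot y x * dot x z + det2 x y * det2 x z.
Proof. by rewrite /dot /det2; ring. Qed.

(** Rows on the two sides of b_i order the face of i in opposite ways, so [extreme_point] yields
    both of its ends. *)
Lemma extreme_ends : exists s t : 'I_n -> int * int, forall i, b i != 0 ->
  [/\ s i \in VF, t i \in VF, ex (s i) i = w i, ex (t i) i = w i &
   forall v, v \in V -> ex v i = w i -> 0 <= dot (b i) (v - s i) /\ dot (b i) (v - t i) <= 0].
Proof.
have H i : exists st : (int * int) * (int * int), b i != 0 ->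
    [/\ st.1 \in VF, st.2 \in VF, ex st.1 i = w i, ex st.2 i = w i &
    forall v, v \in V -> ex v i = w i -> 0 <= dot (b i) (v - st.1) /\ dot (b i) (v - st.2) <= 0].
  have [->|bi] := eqVneq (b i) 0; first by exists (0, 0).
  have [j ij] := exists_pos sumb (indep bi); have [k ki] := exists_neg sumb (indep bi).
  have ik : D i k < 0 by rewrite det2_skew oppr_lt0.
  have [s sVF [si sm]] := extreme_point (ltr0_neq0 ik).
  have [t tVF [ti tm]] := extreme_point (lt0r_neq0 ij).
  exists (s, t) => _; split=> // v vV vi.
  have d0 := dot_gt0 bi.
  have ps : det2 (b i) (v - s) = 0 by apply: oppr_inj; rewrite -ex_sub vi si subrr oppr0.
  have pt : det2 (b i) (v - t) = 0 by apply: oppr_inj; rewrite -ex_sub vi ti subrr oppr0.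
  split; first by rewrite -(nmulr_rle0 _ ik) (parallel_dot _ ps) -ex_sub mulr_le0_ge0 ?subr_le0 ?sm // ltW.
  by rewrite -(pmulr_rle0 _ ij) (parallel_dot _ pt) -ex_sub mulr_le0_ge0 ?subr_le0 ?tm // ltW.
have [st stP] := fin_all_exists (U := fun=> _) H.
by exists (fun i => (st i).1), (fun i => (st i).2) => i /stP.
Qed.

Variables (r0 : 'I_n).
Hypothesis br0 : b r0 != 0.
Hypothesis ex_zero : forall i, b i != 0 -> exists2 v, v \in VF & ex v i = 0.
Hypothesis kap0 : forall i, b i = 0 -> kap i = 0.
Variable R : realFieldType.

(** The first vertex of P_B is placed at s i0. Exponents are nonnegative, so det2 (b i) is at most
    kap i on the translate; [ex_zero] shows that this bound is attained, which fixes mu i. *)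
Theorem exponent_polygon (mu : 'I_n -> R) : (forall i, is_max_on_PB B i (mu i)) ->
  exists s0, (forall u, in_conv [seq to_pt R v | v <- VF] (to_pt R s0 + u) <-> in_PB B u) /\
    forall i, mu i = (ex s0 i)%:~R.
Proof.
move=> muP; have [s [t stP]] := extreme_ends.
have sV i : b i != 0 -> s i \in V by case/stP => /VFV.
have tV i : b i != 0 -> t i \in V by case/stP => _ /VFV.
have s_min i v : b i != 0 -> v \in V -> 0 <= det2 (b i) (v - s i).
  move=> bi vV; have [_ _ si _ _] := stP i bi.
  by rewrite -oppr_le0 -ex_sub si subr_le0 ex_le.
have t_min i v : b i != 0 -> v \in V -> 0 <= det2 (b i) (v - t i).
  move=> bi vV; have [_ _ _ ti _] := stP i bi.
  by rewrite -oppr_le0 -ex_sub ti subr_le0 ex_le.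
have t_last i v : b i != 0 -> v \in V -> det2 (b i) (v - t i) = 0 -> dot (b i) (v - t i) <= 0.
  move=> bi vV e; have [_ _ _ ti /(_ v vV) H] := stP i bi; apply: (H _).2.
  by rewrite -ti; apply/eqP; rewrite -subr_eq0 ex_sub e oppr0.
have st_long i j : 0 < D i j -> det2 (bsum b (ray b i)) (b j) <= det2 (t i - s i) (b j).
  move=> ij; have bi := D_neq0l ij; have [_ _ si ti stm] := stP i bi.
  have [v [v' [vV v'V vi v'i /(_ j ij) vv']]] := ex_long bi.
  have ps : det2 (b i) (v - s i) = 0 by apply: oppr_inj; rewrite -ex_sub vi si subrr oppr0.
  have pt : det2 (b i) (v' - t i) = 0 by apply: oppr_inj; rewrite -ex_sub v'i ti subrr oppr0.
  have [h1 _] := stm v vV vi; have [_ h2] := stm v' v'V v'i; have d0 := dot_gt0 bi.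
  have g1 : ex (s i) j <= ex v j.
    by rewrite -subr_ge0 ex_sub -(pmulr_lge0 _ d0) -(parallel_dot _ ps) mulr_ge0 // ltW.
  have g2 : ex v' j <= ex (t i) j.
    by rewrite -subr_le0 ex_sub -(pmulr_lle0 _ d0) -(parallel_dot _ pt) mulr_ge0_le0 // ltW.
  rewrite [leRHS]det2_skew -ex_sub lerBrDl; apply: le_trans g2; apply: le_trans vv'.
  by rewrite lerD2r.
have width i v : b i != 0 -> v \in V -> det2 (b i) (v - t i) <= w i.
  move=> bi vV; have [_ _ _ ti _] := stP i bi.
  by rewrite -[det2 _ _]opprK -ex_sub ti opprB gerBl ex_ge0.
have edge := edge_exact sumb sV tV s_min t_min st_long width indep.
have chain := chain_exact sumb sV tV s_min t_min t_last st_long width indep.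
have s_ray i r : b i != 0 -> ray b i r -> s r = s i.
  move=> bi /andP[/eqP ir dir]; have br : b r != 0.
    by apply: contraTneq dir => ->; rewrite /dot /= !mulr0 addr0 ltxx.
  have := s_min _ _ bi (sV r br); have := s_min _ _ br (sV i bi).
  have [_ _ si _ /(_ _ (sV r br)) mi] := stP i bi; have [_ _ sr _ /(_ _ (sV i bi)) mr] := stP r br.
  rewrite -[s i - s r]opprB det2N oppr_ge0 => h1 h2.
  have := dot_det2 (b i) (b r) (s r - s i); rewrite [det2 (b r) (b i)]det2_skew ir oppr0 mul0r add0r => e.
  have d0 := dot_gt0 bi; rewrite dotC in dir.
  have ei : det2 (b i) (s r - s i) = 0 by apply/eqP; rewrite eq_le h2 andbT -(pmulr_rle0 _ dir) -e mulr_ge0_le0 // ltW.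
  have er : det2 (b r) (s r - s i) = 0 by apply/eqP; move/eqP: e; rewrite ei mulr0 mulf_eq0 gt_eqF.
  have hi : 0 <= dot (b i) (s r - s i).
    by apply: (mi _).1; rewrite -si; apply/eqP; rewrite -subr_eq0 ex_sub ei oppr0.
  have hr : 0 <= dot (b r) (s i - s r).
    by apply: (mr _).1; rewrite -sr; apply/eqP; rewrite -subr_eq0 ex_sub -opprB det2N er !oppr0.
  have z0 : dot (b i) (s r - s i) = 0.
    have := dot_collinear (b i) (b r) (s r - s i); rewrite ei mulr0 addr0 => E.
    have hr' : dot (b r) (s r - s i) <= 0.
      by move: hr; rewrite -opprB /dot /= !mulrN -opprD oppr_ge0.
    apply/eqP; rewrite eq_le hi andbT -(pmulr_rle0 _ dir) -E.
    by rewrite mulr_ge0_le0 // ltW.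
  have [j ij] := indep bi; apply/eqP; rewrite -subr_eq0; apply/eqP; apply: (det2_eq0 ij ei).
  have := parallel_dot (b j) ei; rewrite z0 mulr0 => /esym/eqP.
  by rewrite mulf_eq0 oppr_eq0 (gt_eqF d0) orbF => /eqP.
pose i0 := nth r0 (sorted_rows B) 0.
have sVF i : b i != 0 -> s i \in VF by case/stP.
have tVF i : b i != 0 -> t i \in VF by case/stP.
have hull := @hull_PB _ B sumb V VF s t VFV sVF tVF s_min edge chain s_ray indep r0 br0 R.
exists (s i0); split=> // i.
have [bi|bi] := eqVneq (b i) 0.
  have [[u uP <-] _] := muP i.
  by rewrite /ex kap0 // bi /det2 /detR /= !mul0r !subrr.
apply/eqP; rewrite eq_le; apply/andP; split.
  have [[u /hull[lam [l0 [l1 e]]] <-] _] := muP i.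
  have dD (x : int * int) u1 u2 : detR x (u1 + u2) = detR x u1 + detR x u2 by rewrite /detR !mxE; ring.
  have : detR (b i) (to_pt R (s i0) + u) <= (kap i)%:~R.
    rewrite e; have -> : (kap i)%:~R = \sum_k lam k * (kap i)%:~R :> R by rewrite -mulr_suml l1 mul1r.
    have -> : detR (b i) (\sum_k lam k *: nth 0 [seq to_pt R v | v <- VF] k) =
      \sum_k lam k * detR (b i) (nth 0 [seq to_pt R v | v <- VF] k).
      rewrite /detR !summxE !mulr_sumr -sumrB; apply: eq_bigr => k _.
      by rewrite !mxE; ring.
    apply: ler_sum => k _; rewrite ler_wpM2l //.
    have /mapP[v vF ->] := mem_nth 0 (ltn_ord k).
    by rewrite detR_pt ler_int -subr_ge0; apply: ex_ge0; exact: VFV.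
  by rewrite dD detR_pt /ex [(kap i - _)%:~R]intrB lerBrDl.
have [_ muM] := muP i; have [v vF vi] := ex_zero bi.
have := muM (to_pt R (v - s i0)); rewrite detR_pt; rewrite /ex => H.
apply: le_trans (H _); first by move/eqP: vi; rewrite subr_eq0 => /eqP ->; rewrite det2D det2N.
apply/hull; rewrite -to_ptD addrC subrK; exact/conv_mem/map_f.
Qed.

End Extremes.

(** * The matrices A and B *)

Section Matrices.
Variables (n : nat) (A : 'M[int]_(n - 2, n)) (B : 'M[int]_(n, 2)).
Hypothesis hB : Zbasis_of_ker A B.
Local Notation D i j := (det2 (rowB B i) (rowB B j)).

(** The difference n - 2 is truncated: for n <= 2 the row w is empty and cannot produce the value 1,
    while n = 0 is excluded by the injectivity of B. *)
Lemma size_gt2 : (exists w : 'rV[rat]_(n - 2),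
    forall i : 'I_n, (w *m map_mx (fun z : int => z%:~R : rat) A) 0 i = 1) -> (2 < n)%N.
Proof.
case=> w hw; have [_ [_ inj]] := hB.
have n0 : (0 < n)%N.
  rewrite lt0n; apply/eqP => n0.
  have /inj/(congr1 (fun c : 'cV[int]_2 => c 0 0)) : B *m (const_mx 1 : 'cV[int]_2) = 0.
    by apply/matrixP => i; have := ltn_ord i; rewrite {2}n0.
  by rewrite !mxE.
rewrite ltnNge; apply/negP => n2; move: (hw (Ordinal n0)).
rewrite mxE big1 => [/esym/eqP|i _]; first by rewrite oner_eq0.
by have := ltn_ord i; move: n2; rewrite -subn_eq0 => /eqP {2}->.
Qed.

Lemma rows_sum : (exists w : 'rV[rat]_(n - 2),
    forall i : 'I_n, (w *m map_mx (fun z : int => z%:~R : rat) A) 0 i = 1) ->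
  \sum_l rowB B l = 0.
Proof.
case=> w hw; have [AB _] := hB; pose f (z : int) : rat := z%:~R.
have col j : \sum_l B l j = 0.
  apply/eqP; rewrite -(intr_eq0 rat) rmorph_sum /=.
  have := congr1 (fun M : 'M_(_, _) => (w *m map_mx (intr : int -> rat) M) 0 j) AB.
  rewrite map_mxM mulmxA mxE map_mx0 mulmx0 mxE => e; apply/eqP; rewrite -[RHS]e.
  by apply: eq_bigr => l _; rewrite hw mul1r mxE.
have E : \sum_l rowB B l = (\sum_l B l 0, \sum_l B l 1).
  by elim/big_ind3: _ => // x1 x2 x3 y1 y2 y3 -> ->.
by rewrite E !col.
Qed.

Lemma wt_sum : \sum_l rowB B l = 0 -> forall c, \sum_l wt B c l = 0.
Proof.
move=> sb c; have := dotC (\sum_l rowB B l) c; rewrite sb /wt => e.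
rewrite -[RHS](_ : dot c 0 = 0); last by rewrite /dot /= !mulr0 addr0.
rewrite -sb (big_morph (dot c) (id1 := 0) (op1 := +%R)) => [|y z|]; last 2 first.
- by rewrite /dot /=; ring.
- by rewrite /dot /=; ring.
by apply: eq_bigr => l _; rewrite dotC.
Qed.

Lemma independent_rows : exists i0 j0, D i0 j0 != 0.
Proof.
apply: NNPP => N; have [_ [_ inj]] := hB.
have z i j : D i j = 0 by apply/eqP/negPn/negP => h; apply: N; exists i, j.
have Bv (x y : int) l : (B *m \col_(j < 2) (if j == 0 then x else y)) l 0 = B l 0 * x + B l 1 * y.
  rewrite mxE big_ord_recl big_ord1 !mxE /=; congr (_ + B l _ * _); exact/val_inj.
have b0 i : B i 0 = 0 /\ B i 1 = 0.
  have /inj e : B *m \col_(j < 2) (if j == 0 then - B i 1 else B i 0) = 0.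
    by apply/colP => l; rewrite Bv mxE -[RHS](z i l) /det2 /=; ring.
  by have := congr1 (fun c : 'cV[int]_2 => c 0 0) e; have := congr1 (fun c : 'cV[int]_2 => c 1 0) e; rewrite !mxE /= => -> /eqP; rewrite oppr_eq0 => /eqP.
have /inj/(congr1 (fun c : 'cV[int]_2 => c 0 0)) : B *m \col_(j < 2) (if j == 0 then 1 else 1) = 0.
  by apply/colP => l; rewrite Bv mxE; case: (b0 l) => -> ->; rewrite !mul0r addr0.
by rewrite !mxE.
Qed.

Lemma B_mul (c : 'cV[int]_2) l : (B *m c) l 0 = wt B (c 0 0, c 1 0) l.
Proof.
rewrite mxE big_ord_recl big_ord1 /wt /dot /=; congr (_ + B l _ * c _ _); exact/val_inj.
Qed.

Lemma kernel_wt (u : 'cV[int]_n) : in_kerZ A u -> exists k, forall l, u l 0 = wt B k l.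
Proof. by have [_ [H _]] := hB; move=> /H[c ->]; exists (c 0 0, c 1 0) => l; apply: B_mul. Qed.

Lemma wt_kernel k : in_kerZ A (\col_l wt B k l).
Proof.
have [AB _] := hB; rewrite /in_kerZ (_ : \col_l _ = B *m \col_(j < 2) if j == 0 then k.1 else k.2).
  by rewrite mulmxA AB mul0mx.
by apply/colP => l; rewrite B_mul !mxE /=; case: k.
Qed.

Lemma in_coneE (x : 'cV[algC]_n) : in_cone_XB A x <-> inX B (fun l => x l 0).
Proof.
have E (u : 'cV[int]_n) k : (forall l, u l 0 = wt B k l) ->
    \prod_l x l 0 ^+ upos u l = mpos B k (fun l => x l 0) /\
    \prod_l x l 0 ^+ uneg u l = mneg B k (fun l => x l 0).
  by move=> uk; split; apply: eq_bigr => l _; rewrite /upos /uneg uk.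
split=> [H c|H u uA]; last first.
  by have [k /E[-> ->]] := kernel_wt uA.
have := H _ (wt_kernel c); have [l|-> ->//] := E (\col_l wt B c l) c; by rewrite mxE.
Qed.

Section ChowForm.
Variable C : {mpoly int[n * 2]}.

Lemma chow_zero : is_dual_chow_form A C -> forall p q i j, br p q i j != 0 ->
  CL C p q = 0 <-> exists s t, (s, t) != (0, 0) /\ inX B (fun l => s * p l + t * q l).
Proof.
case=> _ H p q i j /rank2_br/H{}H; apply: iff_trans H _.
split=> -[s [t [st X]]]; exists s, t; split=> //.
  by apply: inX_ext (proj1 (in_coneE _) X) => l; rewrite !mxE.
by apply/(proj2 (in_coneE _)); apply: inX_ext X => l; rewrite !mxE.
Qed.

Variable G : {mpoly int[n * n]}.
Hypothesis hG : C = comp_mpoly (bracket_tuple n) G.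

Lemma CL_bracket p q : CL C p q =
  evC G (fun l => mxvec (\matrix_(i < n, j < n) br p q i j) 0 l).
Proof.
rewrite /CL hG evC_comp; apply: evC_ext => l; rewrite tnth_mktuple.
case/mxvec_indexP: l => i j; rewrite !mxvecE !mxE /bracket /y_var evC_add evC_opp !evC_mul !evC_var.
by rewrite !ptY_index /br mulrC.
Qed.

Lemma chow_br p q p' q' : (forall i j, br p q i j = br p' q' i j) -> CL C p q = CL C p' q'.
Proof.
move=> e; rewrite !CL_bracket; apply: evC_ext => l; congr (mxvec _ 0 l).
by apply/matrixP => i j; rewrite !mxE.
Qed.

End ChowForm.

(** [rowexp_graded] wants natural weights. Adding a constant K to a row of A makes it nonnegative,
    and the grading by the all-ones weight removes K again, so e - e' lies in the kernel of A. *)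
Lemma rowexp_coset (C : {mpoly int[n * 2]}) : (2 < n)%N -> mirreducible C ->
  (forall p q i j, br p q i j != 0 ->
    CL C p q = 0 <-> exists s t, (s, t) != (0, 0) /\ inX B (fun l => s * p l + t * q l)) ->
  (forall c, \sum_l wt B c l = 0) -> forall e e', rowexp C e -> rowexp C e' ->
  exists k, forall l, (e l)%:Z - (e' l)%:Z = wt B k l.
Proof.
move=> n3 Cirr Czero sumB e e' eC e'C.
suff : in_kerZ A (\col_l ((e l)%:Z - (e' l)%:Z)).
  by move=> /kernel_wt[k H]; exists k => l; rewrite -H mxE.
apply/colP => r; rewrite !mxE.
pose K := (\sum_l `|A r l|)%N; pose et l := absz (A r l + K%:Z).
have etE l : (et l)%:Z = A r l + K%:Z.
  have : (`|A r l| <= K)%N by rewrite /K (bigD1 l) //= leq_addr.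
  rewrite /et; lia.
have gr : (\sum_l et l * e l = \sum_l et l * e' l)%N.
  apply: (rowexp_graded n3 Cirr Czero) => // c; under eq_bigr do rewrite etE mulrDl.
  rewrite big_split /= -mulr_sumr sumB mulr0 addr0.
  by have /colP/(_ r) := wt_kernel c; rewrite !mxE => {2}<-; apply: eq_bigr => l _; rewrite mxE.
have ones : (\sum_l 1 * e l = \sum_l 1 * e' l)%N.
  by apply: (rowexp_graded n3 Cirr Czero (eta := fun=> 1%N)) => // c; under eq_bigr do rewrite mul1r.
have toZ (f g : 'I_n -> nat) : (\sum_l f l * g l)%N%:Z = \sum_l (f l)%:Z * (g l)%:Z.
  by rewrite -natz natr_sum; apply: eq_bigr => l _; rewrite natz PoszM.
have := congr1 Posz gr; have := congr1 Posz ones; rewrite !toZ => h1 h2.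
have -> : \sum_l A r l * (\col_l ((e l)%:Z - (e' l)%:Z)) l 0 =
   (\sum_l (et l)%:Z * (e l)%:Z - \sum_l (et l)%:Z * (e' l)%:Z) -
   K%:Z * (\sum_l 1%:Z * (e l)%:Z - \sum_l 1%:Z * (e' l)%:Z).
  by rewrite -!sumrB mulr_sumr -sumrB; apply: eq_bigr => l _; rewrite mxE etE; ring.
by rewrite h1 h2 !subrr mulr0 subr0.
Qed.

End Matrices.

(** * The full discriminant *)

Lemma mpoly_torus_ext (n : nat) (f g : {mpoly algC[n]}) :
  (forall x, (forall l, x l != 0) -> f.@[x] = g.@[x]) -> f = g.
Proof.
move=> H; apply/eqP; rewrite -subr_eq0; apply/negPn/negP => fg0.
have X0 : \prod_(l < n) ('X_l : {mpoly algC[n]}) != 0.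
  by apply/prodf_neq0 => l _; rewrite -msupp_eq0 msuppX.
have [x] := mpoly_nonroot (mulf_neq0 fg0 X0).
rewrite mevalM mevalB rmorph_prod mulf_eq0 negb_or => /andP[/eqP + /prodf_neq0 x0].
by case; rewrite H ?subrr // => l; have := x0 l isT; rewrite /= mevalXU.
Qed.

Lemma evC_det N m (M : 'M[{mpoly int[N]}]_m) (y : 'I_N -> algC) :
  evC (\det M) y = \det (\matrix_(i, j) evC (M i j) y).
Proof.
rewrite /determinant evC_sum; apply: eq_bigr => s _; rewrite evC_mul evC_exp evC_opp evC_prod.
rewrite -mpolyC1 evC_const; congr (_ * _); by apply: eq_bigr => i _; rewrite mxE.
Qed.

Section Discriminant.
Variables (n : nat) (A : 'M[int]_(n - 2, n)) (B : 'M[int]_(n, 2)) (C : {mpoly int[n * 2]}).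
Variables (G : {mpoly int[n * n]}) (eps : 'I_n -> 'I_n -> int).
Hypothesis n3 : (2 < n)%N.
Hypothesis hG : C = comp_mpoly (bracket_tuple n) G.
Hypothesis heps : admissible_signs A B eps.
Variable D : nat.
Hypothesis Cdeg : forall e, rowexp C e -> (\sum_l e l = D + D)%N.
Hypothesis CLD : forall a p q, CL C p (fun l => a * q l) = a ^+ D * CL C p q.
Local Notation F := (CF C (fB B 0) (fB B 1)).

Lemma other_cols_prod (x : 'I_n -> algC) i j : i != j ->
  \prod_(r < n - 2) x (other_cols i j r) * (x i * x j) = \prod_l x l.
Proof.
move=> ij; set s := enum [pred l : 'I_n | (l != i) && (l != j)].
have ss : size s = (n - 2)%N.
  have e2 : #|predC [pred l : 'I_n | (l != i) && (l != j)]| = 2%N.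
    rewrite (eq_card (B := [set i; j])) ?cards2 ?ij // => l; rewrite !inE.
    by rewrite negb_and !negbK.
  have := cardC [pred l : 'I_n | (l != i) && (l != j)]; rewrite e2 card_ord -cardE.
  by move: #|_| => k; lia.
have -> : \prod_(r < n - 2) x (other_cols i j r) = \prod_(l | (l != i) && (l != j)) x l.
  rewrite -[LHS]/(\prod_(r < n - 2) x (nth i s r)) -(big_mkord xpredT (fun r => x (nth i s r))) -ss.
  rewrite -(big_nth i xpredT x) big_enum.
  by apply: eq_bigl => l.
rewrite [RHS](bigD1 i) //= [in RHS](bigD1 j) /=; last by rewrite eq_sym.
by rewrite mulrC mulrA.
Qed.

(** At x the signed minor omitting columns i, j is c prod x times the bracket of the pair with rows
    b_l / x_l; the factor c prod x is moved into q, and homogeneity turns it into its D-th power. *)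
Lemma discr_eval : exists2 c : algC, c != 0 & forall x : 'I_n -> algC, (forall l, x l != 0) ->
  evC (full_discr A eps G) x = (c * \prod_l x l) ^+ D * F.@[fun l => (x l)^-1].
Proof.
have [_ [c [c0 epsE]]] := heps; exists (ratr c); first by rewrite fmorph_eq0.
move=> x x0; set P := \prod_l x l.
pose p l : algC := (x l)^-1 * fB B 0 l; pose q l : algC := (x l)^-1 * fB B 1 l.
rewrite CF_eval -/p -/q -CLD (CL_bracket hG) /full_discr evC_comp.
rewrite (@evC_ext _ _ _ (fun i => evC (tnth (spec_tuple A) i) x)) // evC_comp.
apply: evC_ext => l; rewrite tnth_mktuple; case/mxvec_indexP: l => i j; rewrite !mxvecE !mxE.
set y := fun i => _.
have yE r l : y (mxvec_index r l) = (A r l)%:~R * x l.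
  by rewrite /y tnth_mktuple mxvecE mxE evC_mul evC_const evC_var.
have ang (a d : 'I_n) : (a < d)%N ->
    evC ((eps a d)%:MP * \det (omit2 (Zmat n) a d)) y = ratr c * P * br p q a d.
  move=> ad; rewrite evC_mul evC_const evC_det.
  have -> : \matrix_(r, k) evC (omit2 (Zmat n) a d r k) y =
      map_mx intr (omit2 A a d) *m diag_mx (\row_k x (other_cols a d k)).
    by apply/matrixP => r k; rewrite mul_mx_diag !mxE evC_var yE.
  rewrite det_mulmx det_diag det_map_mx mulrA -intrM.
  have -> : (eps a d * \det (omit2 A a d))%:~R = ratr c * (minorB B a d)%:~R :> algC.
    by have := congr1 (fun z => ratr z : algC) (epsE a d ad); rewrite /= [ratr (c * _)]rmorphM /= !ratr_int.
  under eq_bigr do rewrite mxE; set O := \prod_k _.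
  have <- : O * (x a * x d) = P by apply: other_cols_prod; rewrite neq_ltn ad.
  have xa := x0 a; have xd := x0 d; rewrite /br /p /q /fB /minorB intrB !intrM.
  by field; rewrite xa xd.
have sk (a d : 'I_n) : br p (fun l => ratr c * P * q l) a d = ratr c * P * br p q a d by rewrite /br; ring.
rewrite sk /angle; case: ltngtP => [/ang->//|ji|/val_inj->].
  by rewrite evC_opp ang // /br; ring.
by rewrite /evC raddf0 meval0 /br; ring.
Qed.

Lemma discr_support :
  (forall m, (m \in msupp (full_discr A eps G)) <->
    exists2 e, e \in msupp F & forall l, (m l + e l = D)%N) /\
  (forall e l, e \in msupp F -> (e l <= D)%N).
Proof.
pose E := map_mpoly (fun z : int => z%:~R : algC) (full_discr A eps G).
have [c c0 Ev] := discr_eval.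
have eD e l : e \in msupp F -> (e l <= D + D)%N.
  rewrite mcoeff_msupp => eF; rewrite -(@Cdeg e); last by exists (fB B 0), (fB B 1).
  by rewrite (bigD1 l) //= leq_addr.
(* Multiplying E by the D-th power of prod x makes all exponents natural, namely 2 D - e;
   divisibility by that monomial then improves e l <= 2 D to e l <= D. *)
pose co (e : 'X_{1..n}) : 'X_{1..n} := [multinom (D + D - e l)%N | l < n].
pose K : 'X_{1..n} := [multinom D | l < n].
have FE x : F.@[x] = \sum_(e <- msupp F) F@_e * \prod_l x l ^+ e l by exact: mevalE.
have id : E * 'X_[K] = \sum_(e <- msupp F) (c ^+ D * F@_e) *: 'X_[co e].
  apply: mpoly_torus_ext => x x0; rewrite mevalM mevalX -/(evC _ x) Ev // FE (raddf_sum (meval x)) /=.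
  rewrite mulr_sumr mulr_suml big_seq [RHS]big_seq; apply: eq_bigr => e eF.
  rewrite mevalZ mevalX exprMn -!mulrA; congr (_ * _).
  rewrite mulrCA; congr (_ * _); rewrite -prodrXl -!big_split /=; apply: eq_bigr => l _.
  rewrite !mnmE exprVn [x l ^+ (D + D - e l)](_ : _ = x l ^+ (D + D) / x l ^+ e l).
    by rewrite exprD; move: (x l ^+ D) (x l ^+ e l)^-1 => a b; ring.
  by rewrite expfB_cond // (negPf (x0 l)) eD.
have coE k : (E * 'X_[K])@_k = \sum_(e <- msupp F | co e == k) c ^+ D * F@_e.
  rewrite id (raddf_sum (mcoeff k)) [RHS]big_mkcond; apply: eq_bigr => e _ /=.
  by rewrite mcoeffZ mcoeffX; case: eqP => _; rewrite ?mulr1 ?mulr0.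
have supE k : (k \in msupp E) = (k \in msupp (full_discr A eps G)).
  by apply: perm_mem; apply: msupp_map_mpoly; apply: intr_inj.
have co_neq0 e : e \in msupp F -> (E * 'X_[K])@_(co e) != 0.
  move=> eF; rewrite coE -big_filter.
  rewrite (bigD1_seq e) ?mem_filter ?filter_uniq ?msupp_uniq ?eqxx //= big1_seq ?addr0.
    by rewrite mulf_neq0 ?expf_neq0 // -mcoeff_msupp.
  move=> e' /andP[e'e]; rewrite mem_filter => /andP[/eqP e'k e'F].
  case/eqP: e'e; apply/mnmP => l; have := congr1 (fun k : 'X_{1..n} => k l) e'k.
  by rewrite /= !mnmE; have := eD _ l e'F; have := eD _ l eF; lia.
split=> [m|e l eF]; last first.
  have := co_neq0 e eF; rewrite -mcoeff_msupp (perm_mem (msuppMX E K)) => /mapP[m _].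
  by move/(congr1 (fun k : 'X_{1..n} => k l)); rewrite /= mnmDE !mnmE; have := eD _ l eF; lia.
rewrite -supE mcoeff_msupp -(mcoeffMX E K m); split=> [H|[e eF meD]].
  have [e eF /eqP ek] : exists2 e, e \in msupp F & co e == (K + m)%MM.
    apply: NNPP => N; case/eqP: H; rewrite coE; apply: big1_seq => e /andP[ek eF].
    by case: N; exists e.
  exists e => // l; have /mnmP/(_ l) := ek; rewrite mnmDE !mnmE.
  by have := eD _ l eF; lia.
have <- : co e = (K + m)%MM by apply/mnmP => l; rewrite mnmDE !mnmE; have := meD l; lia.
exact: co_neq0.
Qed.

End Discriminant.

(** * The secondary polygon *)

Lemma seq_choice (T : eqType) (U : Type) (P : T -> U -> Prop) (u0 : U) (s : seq T) :
  (forall x, x \in s -> exists u, P x u) -> exists f : T -> U, forall x, x \in s -> P x (f x).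
Proof.
elim: s => [_|a s IH H]; first by exists (fun=> u0).
have [x xs|f fP] := IH; first by apply: H; rewrite inE xs orbT.
have [u Pu] := H a (mem_head _ _).
exists (fun x => if x == a then u else f x) => x; rewrite inE.
by case: eqP => [->|_ /fP].
Qed.

Lemma primitive_direction (x : int * int) : x != 0 -> exists g rho m,
  [/\ (0 < g)%N, x = (g%:Z * rho.1, g%:Z * rho.2) & dot rho m = 1].
Proof.
case: x => a c x0; have [u [v uv]] := Bezoutz a c.
pose g := gcdn `|a| `|c|; have gE : gcdz a c = g%:Z by [].
have g0 : (0 < g)%N.
  rewrite gcdn_gt0 !absz_gt0; apply: contraNT x0; rewrite negb_or !negbK.
  by move=> /andP[/eqP-> /eqP->].
have /dvdzP[a' aE] := dvdz_gcdl a c; have /dvdzP[c' cE] := dvdz_gcdr a c.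
exists g, (a', c'), (u, v); split=> //=; first by rewrite -gE ![gcdz a c * _]mulrC -aE -cE.
have gZ : g%:Z != 0 by rewrite eqz_nat -lt0n.
have e : u * (a' * g%:Z) + v * (c' * g%:Z) = g%:Z by rewrite -gE -aE -cE.
by apply: (mulfI gZ); rewrite mulr1 -[RHS]e /dot /=; ring.
Qed.

Lemma collinear_scale (rho m x : int * int) : dot rho m = 1 -> det2 rho x = 0 ->
  x = (dot x m * rho.1, dot x m * rho.2).
Proof.
case: rho m x => [r1 r2] [m1 m2] [x1 x2]; rewrite /dot /det2 /= => h e.
have e1 : m2 * (r1 * x2 - r2 * x1) = 0 by rewrite e mulr0.
have e2 : m1 * (r1 * x2 - r2 * x1) = 0 by rewrite e mulr0.
have h1 : x1 * (r1 * m1 + r2 * m2) = x1 by rewrite h mulr1.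
have h2 : x2 * (r1 * m1 + r2 * m2) = x2 by rewrite h mulr1.
by congr (_, _); move: e1 e2 h1 h2; clear; lia.
Qed.

Lemma Posz_sum n (f : 'I_n -> nat) : (\sum_l f l)%N%:Z = \sum_l (f l)%:Z.
Proof. by rewrite -natz natr_sum; apply: eq_bigr => l _; rewrite natz. Qed.

Section SecondaryPolygon.
Variables (n : nat) (B : 'M[int]_(n, 2)) (C : {mpoly int[n * 2]}).
Local Notation b := (rowB B).
Local Notation D i j := (det2 (b i) (b j)).
Local Notation F := (CF C (fB B 0) (fB B 1)).
Hypothesis n3 : (2 < n)%N.
Hypothesis Cirr : mirreducible C.
Hypothesis Czero : forall p q i j, br p q i j != 0 ->
  CL C p q = 0 <-> exists s t, (s, t) != (0, 0) /\ inX B (fun l => s * p l + t * q l).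
Hypothesis Cbr : forall p q p' q', (forall i j, br p q i j = br p' q' i j) -> CL C p q = CL C p' q'.
Hypothesis sumb : \sum_l b l = 0.
Hypothesis coset : forall e e', rowexp C e -> rowexp C e' ->
  exists k, forall l, (e l)%:Z - (e' l)%:Z = wt B k l.
Variables (i0 j0 : 'I_n).
Hypothesis ij0 : D i0 j0 != 0.

Let sumB : forall c, \sum_l wt B c l = 0 := wt_sum sumb.
Let indep : forall i, b i != 0 -> exists j, D i j != 0 := fun i => @exists_indep _ B i0 j0 ij0 i.

Lemma wt_det x l : wt B (perp x) l = det2 x (b l).
Proof. by rewrite /wt /dot /perp /det2 /=; ring. Qed.

Lemma det_scale (g : nat) rho y : det2 (g%:Z * rho.1, g%:Z * rho.2) y = g%:Z * det2 rho y.
Proof. by rewrite /det2 /=; ring. Qed.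

Lemma width_raydeg i (g : nat) rho : (0 < g)%N -> b i = (g%:Z * rho.1, g%:Z * rho.2) ->
  (g * raydeg B rho)%N%:Z = \sum_(l | 0 < D i l) D i l.
Proof.
move=> g0 bi; rewrite PoszM /raydeg Posz_sum mulr_sumr [RHS]big_mkcond.
apply: eq_bigr => l _; rewrite wt_det bi det_scale.
have [h|h] := leP (det2 rho (b l)) 0.
  by rewrite posn_eq0 // mulr0 ltNge pmulr_rle0 // h.
by rewrite posn_ge0 ?ltW // pmulr_rgt0 // h.
Qed.

Lemma rowexp_le_width e i : rowexp C e -> b i != 0 -> (e i)%:Z <= \sum_(l | 0 < D i l) D i l.
Proof.
move=> eC bi; have [g [rho [m [g0 E rm]]]] := primitive_direction bi.
have [j ij] := exists_pos sumb (indep bi).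
have jpos : 0 < wt B (perp rho) j.
  by move: ij; rewrite wt_det E det_scale pmulr_rgt0.
by rewrite -(width_raydeg g0 E) lez_nat; apply: (row_degree_bound Cirr Czero Cbr sumB rm g0 E jpos).
Qed.

Lemma rowexp_long i j : 0 < D i j -> exists e e', [/\ rowexp C e, rowexp C e',
  (e i)%:Z = \sum_(l | 0 < D i l) D i l, (e' i)%:Z = \sum_(l | 0 < D i l) D i l &
  (e j)%:Z + det2 (bsum b (ray b i)) (b j) <= (e' j)%:Z].
Proof.
move=> ij; have bi := D_neq0l ij; have [g [rho [m [g0 E rm]]]] := primitive_direction bi.
have jpos : 0 < wt B (perp rho) j by move: ij; rewrite wt_det E det_scale pmulr_rgt0.
(* The multiplicity of row l with respect to rho, set to 0 off the ray of b_i, so that opposite rows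
   are discarded too. *)
pose gr l : nat := if ray b i l then absz (dot (b l) m) else 0%N.
have grE l : ray b i l -> b l = ((gr l)%:Z * rho.1, (gr l)%:Z * rho.2).
  move=> il; have /andP[/eqP d0 dp] := il; rewrite /gr il.
  have gZ : 0 < g%:Z by [].
  have r0 : det2 rho (b l) = 0.
    by move/eqP: d0; rewrite E det_scale mulf_eq0 gt_eqF //= => /eqP.
  have := collinear_scale rm r0; set z := dot (b l) m => cs.
  have zE : dot (b i) (b l) = g%:Z * z * dot rho rho by rewrite E cs /dot /=; ring.
  rewrite gez0_abs // leNgt; apply/negP => z0.
  have rr : 0 <= dot rho rho by rewrite /dot addr_ge0 // -expr2 sqr_ge0.
  by move: dp; rewrite zE ltNge mulr_le0_ge0 // pmulr_rle0 // ltW.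
have gr_pos l : (0 < gr l)%N -> ray b i l by rewrite /gr; case: ifP.
have ii : ray b i i by rewrite /ray det2xx eqxx dot_gt0.
have gi : gr i = g.
  rewrite /gr ii; have -> : dot (b i) m = g%:Z * dot rho m by rewrite E /dot /=; ring.
  by rewrite rm mulr1.
have gi0 : (0 < gr i)%N by rewrite gi.
have [||||e [e' [eC e'C ei e'i lng]]] := @long_edge _ B C Czero sumB rho m rm j jpos _ _ gr _ _ i gi0.
- move=> m1 l g1 m1C g10 El.
  exact: (row_degree_bound Cirr Czero Cbr sumB rm g10 El jpos (supp_rowexp m1C)).
- by move=> m1 m2 /supp_rowexp h1 /supp_rowexp h2; apply: coset.
- by move=> l /gr_pos/grE.
- by case: Cirr.
exists e, e'; split=> //; first by rewrite ei gi -(width_raydeg g0 E).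
  by rewrite e'i gi -(width_raydeg g0 E).
have -> : det2 (bsum b (ray b i)) (b j) = (posn (wt B (perp rho) j) * \sum_l gr l)%N%:Z.
  rewrite PoszM posn_ge0 ?ltW // wt_det Posz_sum mulr_sumr.
  rewrite det2_skew det_bsum big_mkcond -sumrN; apply: eq_bigr => l _ /=.
  case: ifP => il; last by rewrite /gr il mulr0 oppr0.
  by rewrite -det2_skew {1}(grE l il) det_scale mulrC.
by rewrite -PoszD lez_nat.
Qed.

Lemma eta_sum om : \sum_k b k *+ om k = eta B om.
Proof.
have P (x : int * int) k : x *+ k = (k%:Z * x.1, k%:Z * x.2).
  elim: k => [|k IH]; first by rewrite mulr0n !mul0r.
  by rewrite mulrS IH intS; case: x {IH} => x y /=; congr (_, _) => /=; ring.
rewrite /eta; elim/big_ind3: _ => [|x1 x2 x3 y1 y2 y3 -> ->|k _] //; exact: P.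
Qed.

Lemma zero_row e i : e \in msupp F -> b i = 0 -> e i = 0%N.
Proof.
move=> eF bi; apply/eqP/negPn/negP; rewrite -lt0n => ei; move: eF; rewrite mcoeff_msupp.
have z0 : fB B 0 i = 0 by rewrite /fB; have := congr1 fst bi; rewrite /= => ->.
have z1 : fB B 1 i = 0 by rewrite /fB; have := congr1 snd bi; rewrite /= => ->.
rewrite /CF (raddf_sum (mcoeff e)) big1 ?eqxx // => m _ /=.
rewrite mcoeffZ mcoeffX; case: eqP => [me|_]; last by rewrite mulr0.
rewrite prod_index (bigD1 i) //= !ptY_index z0 z1 -exprD.
have := congr1 (fun k : 'X_{1..n} => k i) me; rewrite /= mnmE => ->.
by rewrite expr0n gtn_eqF // !mul0r mulr0 mul0r.
Qed.

Lemma secondary_polygon (R : realFieldType) (mu : 'I_n -> R) :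
  (forall i, is_max_on_PB B i (mu i)) ->
  exists (s0 : int * int) (kap : 'I_n -> int) (VF : seq (int * int)),
  [/\ forall u, in_conv [seq to_pt R v | v <- VF] (to_pt R s0 + u) <-> in_PB B u,
      forall i, mu i = (ex B kap s0 i)%:~R,
      forall v, v \in VF -> exists2 e, e \in msupp F & forall l, (e l)%:Z = ex B kap v l &
      forall e, e \in msupp F -> exists2 v, v \in VF & forall l, (e l)%:Z = ex B kap v l].
Proof.
move=> muP; have bi0 : b i0 != 0 by apply: contraNneq ij0 => ->; rewrite /det2 /= !mul0r subrr.
have FC e : e \in msupp F -> rowexp C e by rewrite mcoeff_msupp => H; exists (fB B 0), (fB B 1).
have [e0 e0F _] := min_exponent Czero sumB ij0 bi0.
have e0C := FC _ e0F.
have [m mC mE] : exists2 f : 'X_{1..n} -> int * int, True &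
    forall e, e \in [seq rowdeg m | m <- msupp C] -> forall l, (e l)%:Z = ex B (fun l => (e0 l)%:Z) (f e) l.
  have [e /mapP[m mC ->]|f fP] := @seq_choice _ _ (fun (e : 'X_{1..n}) (v : int * int) => forall l, (e l)%:Z = ex B (fun l => (e0 l)%:Z) v l)
      0 [seq rowdeg m | m <- msupp C]; last by exists f.
  (* (k.2, - k.1) is k turned by a quarter, so that det2 (b l) of it is - wt B k l. *)
  have [k kP] := coset (supp_rowexp mC) e0C; exists (k.2, - k.1) => l.
  have := kP l; rewrite /ex /wt /dot /det2 /= => /eqP; rewrite subr_eq => /eqP ->; ring.
have {mE} vE e : rowexp C e -> forall l, (e l)%:Z = ex B (fun l => (e0 l)%:Z) (m e) l.
  by case/rowexp_supp=> m1 m1C <-; apply: mE; apply: map_f.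
pose kap l := (e0 l)%:Z; pose V := [seq m (rowdeg m1) | m1 <- msupp C]; pose VF := [seq m e | e <- msupp F].
have Vin e : rowexp C e -> m e \in V.
  by case/rowexp_supp=> m1 m1C <-; apply/mapP; exists m1.
have Vout v : v \in V -> exists2 e, rowexp C e & v = m e.
  by case/mapP=> m1 /supp_rowexp h ->; exists (rowdeg m1).
have VFV : {subset VF <= V} by move=> v /mapP[e /FC/Vin H ->].
have [s0 [hull muE]] : exists s0, (forall u, in_conv [seq to_pt R v | v <- VF] (to_pt R s0 + u) <-> in_PB B u) /\
    forall i, mu i = (ex B kap s0 i)%:~R.
  apply: (@exponent_polygon _ B sumb indep kap V VF VFV _ _ _ _ i0 bi0) => //.
  - by move=> v l /Vout[e eC ->]; rewrite -vE.
  - by move=> v i /Vout[e eC ->] bi; rewrite -vE // rowexp_le_width.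
  - move=> i bi; have [j ij] := exists_pos sumb (indep bi).
    have [e [e' [eC e'C ei e'i lng]]] := rowexp_long ij.
    exists (m e), (m e'); split; rewrite -?vE ?Vin // => k ik; rewrite -?vE //.
    (* The pair e, e' was found for one j. Since m e' - m e and the ray sum are both parallel to
       b_i, the inequality carries over to every k on the same side of b_i. *)
    have x0 : det2 (b i) (m e' - m e) = 0.
      by apply: oppr_inj; rewrite -(ex_sub B kap) -!vE // ei e'i subrr oppr0.
    have y0 : det2 (b i) (m e' - m e - bsum b (ray b i)) = 0 by rewrite det2D x0 det2N det_ray subr0.
    have yj l : (e' l)%:Z - ((e l)%:Z + det2 (bsum b (ray b i)) (b l)) =
        det2 (m e' - m e - bsum b (ray b i)) (b l).
      by rewrite [RHS]det2Dl det2Nl [det2 (m e' - _) _]det2_skew -(ex_sub B kap) -!vE // opprD addrA.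
    rewrite -subr_ge0 yj -(pmulr_rge0 _ ij) det2_plucker y0 mul0r add0r.
    by rewrite mulr_ge0 ?(ltW ik) // -yj subr_ge0.

  - move=> om omP v /Vout[e eC ->] vmax; apply: map_f; rewrite mcoeff_msupp.
    have S e1 : rowexp C e1 -> \sum_l (om l)%:Z * ex B kap (m e1) l = (\sum_l om l * e1 l)%N%:Z.
      by move=> e1C; rewrite Posz_sum; apply: eq_bigr => l _; rewrite PoszM vE.
    apply: (extreme_coef Czero sumB ij0 (om := om)) => // [l bl|e' e'C e'e].
      by have := omP l bl; rewrite eta_sum.

    rewrite -ltz_nat -!S //; apply: vmax; first exact: Vin.
    by apply: contra_neq e'e => mm; apply/mnmP => l; have := vE _ e'C l; rewrite mm -vE // => -[].
  - move=> i bi; have [e eF ei] := min_exponent Czero sumB ij0 bi.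
    by exists (m e); [apply: map_f|rewrite -(vE e (FC e eF)) ei].
  - by move=> i bi; rewrite /kap (zero_row e0F bi).
exists s0, kap, VF; split=> // [v /mapP[e eF ->]|e eF].
  by exists e => // l; apply/vE/FC.
by exists (m e); [apply: map_f|apply/vE/FC].
Qed.

End SecondaryPolygon.

Theorem theorem3p4 (n : nat) (A : 'M[int]_(n - 2, n)) (B : 'M[int]_(n, 2))
    (hrank : \rank (map_mx (fun z : int => z%:~R : rat) A) = (n - 2)%N)
    (hw : exists w : 'rV[rat]_(n - 2),
        forall i : 'I_n, (w *m map_mx (fun z : int => z%:~R : rat) A) 0 i = 1)
    (hB : Zbasis_of_ker A B)
    (d : nat) (hd : is_degree_XB A d)
    (C : {mpoly int[n * 2]}) (hC : is_dual_chow_form A C)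
    (G : {mpoly int[n * n]}) (hG : C = comp_mpoly (bracket_tuple n) G)
    (eps : 'I_n -> 'I_n -> int) (heps : admissible_signs A B eps)
    (R : realFieldType) (mu : 'I_n -> R) (hmu : forall i, is_max_on_PB B i (mu i)) :
  injective (PB_map B d mu) /\
  (forall x : 'rV[R]_n,
     newton_polytope (full_discr A eps G) x <->
     exists2 v : 'rV[R]_2, in_PB B v & x = PB_map B d mu v).
Proof.
have n3 := size_gt2 hB hw; have sumb := rows_sum hB hw.
have [i0 [j0 ij0]] := independent_rows hB.
have Cirr := proj1 hC; have Czero := chow_zero hB hC; have Cbr := chow_br hG.
have sumB := wt_sum sumb.
have [D D0 [Cdeg CLD]] := plucker_degree n3 Cirr Czero Cbr sumB.
have dD : d = D := degree_XB n3 Cirr Czero Cbr sumB D0 CLD (in_coneE hB) hd.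
have coset := rowexp_coset hB n3 Cirr Czero sumB.
have [s0 [kap [VF [hull muE VFe eVF]]]] :=
  secondary_polygon Cirr Czero Cbr sumb coset ij0 hmu.
have [supp le_D] := discr_support n3 hG heps Cdeg CLD.
split.
  move=> v v' /rowP e; have dE i : detR (rowB B i) v = detR (rowB B i) v'.
    by have := e i; rewrite !mxE => /addrI/oppr_inj/addrI/oppr_inj.
  have d0 : (det2 (rowB B i0) (rowB B j0))%:~R != 0 :> R by rewrite intr_eq0.
  have cr (w : 'rV[R]_2) : (det2 (rowB B i0) (rowB B j0))%:~R * w 0 0 =
      (rowB B j0).1%:~R * detR (rowB B i0) w - (rowB B i0).1%:~R * detR (rowB B j0) w :> R /\
    (det2 (rowB B i0) (rowB B j0))%:~R * w 0 1 =
      (rowB B j0).2%:~R * detR (rowB B i0) w - (rowB B i0).2%:~R * detR (rowB B j0) w :> R.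
    by rewrite /detR /det2 intrB !intrM; split; ring.
  apply/rowP => j; apply: (mulfI d0); have [c1 c2] := cr v; have [c3 c4] := cr v'.
  by have [->|->] := ord2_cases j; rewrite ?c1 ?c2 ?c3 ?c4 !dE.
(* The map [PB_map] in the coordinates of V: kap takes the place of mu, and the translation of P_B
   by s0 accounts for the difference ([LE]). *)
move=> x; pose L (w : 'rV[R]_2) : 'rV[R]_n := \row_i (d%:R - ((kap i)%:~R - detR (rowB B i) w)).
have LE u : L (to_pt R s0 + u) = PB_map B d mu u.
  apply/rowP => i; rewrite !mxE muE /ex intrB -detR_pt /detR !mxE /=; ring.
have Lpt v e : (forall l, (e l)%:Z = ex B kap v l) -> forall m : 'X_{1..n},
    (forall l, (m l + e l = D)%N) -> \row_i (m i)%:R = L (to_pt R v).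
  move=> ev m mD; apply/rowP => i; rewrite !mxE detR_pt -intrB -[kap i - _]/(ex B kap v i) -ev.
  by rewrite dD -(mD i) natrD -pmulrn addrK.
have -> : newton_polytope (full_discr A eps G) x <-> in_conv (map L [seq to_pt R v | v <- VF]) x.
  split; apply: conv_sub => w.
    case/mapP=> m /supp[e eF mD] ->; have [v vV ev] := eVF e eF.
    by rewrite (Lpt v e ev m mD); apply/conv_mem/map_f/map_f.
  case/mapP=> _ /mapP[v vV ->] ->; have [e eF ev] := VFe v vV.
  have eD l : (e l <= D)%N by apply: le_D.
  pose m : 'X_{1..n} := [multinom (D - e l)%N | l < n].
  have mD l : (m l + e l = D)%N by rewrite mnmE subnK.
  rewrite -(Lpt v e ev m mD); apply/conv_mem/mapP; exists m => //.
  by apply/supp; exists e.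
rewrite conv_affine; last first.
  move=> I lam w l1; apply/rowP => i; rewrite !mxE summxE.
  under [RHS]eq_bigr do rewrite !mxE mulrBr mulrBr.
  rewrite !sumrB -!mulr_suml l1 !mul1r /detR !summxE; congr (_ - (_ - _)).
  rewrite !mulr_sumr -sumrB; apply: eq_bigr => k _; rewrite !mxE; ring.
split=> [[w wc ->]|[u uP ->]]; last by exists (to_pt R s0 + u); [apply/hull|rewrite LE].
exists (w - to_pt R s0); last by rewrite -LE addrC subrK.
by apply/hull; rewrite addrC subrK.
Qed.
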